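(* Let $m\geq 2$, and let $x_1,x_2$ be two distinct points of $\mathbb{S}^2$. Then: (a) $B_m(\mathbb{S}^2\setminus\{x_1,x_2\})\cong\mathbb{F}_m\rtimes_\phi B_m(\mathbb{D}^2)$, where $\mathbb{F}_m=\mathbb{F}_m(A_{2,3},\ldots,A_{2,m+2})$ is the free group of rank $m$ on $A_{2,3},\ldots,A_{2,m+2}$, $B_m(\mathbb{D}^2)$ is generated by $\sigma_3,\ldots,\sigma_{m+1}$, and the action $\phi$ is given by the Artin representation of $B_m(\mathbb{D}^2)$ as a subgroup of $\mathrm{Aut}(\mathbb{F}_m)$: for $3\leq i\leq m+1$ and $3\leq j\leq m+2$, $$\sigma_iA_{2,j}\sigma_i^{-1}=\begin{cases}A_{2,j+1}&\text{if }j=i\\ A_{2,j}^{-1}A_{2,j-1}A_{2,j}&\text{if }j=i+1\\ A_{2,j}&\text{otherwise.}\end{cases}$$ (b) $\Gamma_2(B_m(\mathbb{S}^2\setminus\{x_1,x_2\}))\cong\mathrm{Ker}(\rho)\rtimes\Gamma_2(B_m(\mathbb{D}^2))$, where $$\rho:\mathbb{F}_m(A_{2,3},\ldots,A_{2,m+2})\to\mathbb{Z}$$ is the augmentation homomorphism (sending each generator $A_{2,j}$ to $1$), and the action is that induced by $\phi$.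
   Context: For a surface $M$, $F_m(M)=\{(y_1,\ldots,y_m)\in M^m: y_i\neq y_j\text{ if }i\neq j\}$, and $B_m(M)=\pi_1(F_m(M)/S_m)$ is the $m$-string braid group of $M$. $\mathbb{D}^2$ is the closed $2$-disc; $B_m(\mathbb{D}^2)$ is Artin's braid group, whose standard generators are here indexed as $\sigma_3,\ldots,\sigma_{m+1}$, subject to $\sigma_i\sigma_j=\sigma_j\sigma_i$ if $|i-j|\geq 2$ and $\sigma_i\sigma_{i+1}\sigma_i=\sigma_{i+1}\sigma_i\sigma_{i+1}$. $\Gamma_2(G)=[G,G]$. In $N\rtimes Q$ the normal subgroup is $N$, and $qnq^{-1}$ denotes the image of $n\in N$ under the action of $q\in Q$. Geometrically, $A_{2,j}$ is a loop encircling the puncture $x_2$ based at the $j$th point. *)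

(* Defs.v *)
From HB Require Import structures.
From mathcomp Require Import all_boot all_order all_algebra all_fingroup generic_quotient.
From mathcomp Require Import all_classical all_reals all_analysis.
From mathcomp Require Import homotopy.
From mathcomp Require Import ring lra zify.

Set Implicit Arguments.
Unset Strict Implicit.
Unset Printing Implicit Defensive.

Import Order.TTheory GRing.Theory Num.Theory.
Import numFieldNormedType.Exports.

Local Open Scope classical_set_scope.
Local Open Scope ring_scope.

Section Subgroups.
Variable G : groupType.

Definition subgrp (H : groupClosed G) : Type := {x : G | x \in H}.

HB.instance Definition _ (H : groupClosed G) := SubChoice.on (subgrp H).

Lemma group_closed_groupClosed (H : groupClosed G) :
  group_closed (fun x => x \in H).
Proof. by split; [exact: gpred1|move=> u v; exact: gpredF]. Qed.

HB.instance Definition _ (H : groupClosed G) :=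
  SubChoice_isSubGroup.Build G (fun x => x \in H) (subgrp H)
    (group_closed_groupClosed H).

Definition gen_subgroup (A : set G) : {pred G} :=
  fun x => x \in smallest (fun S : set G => group_closed (fun y => y \in S)) A.

Lemma gen_subgroup_group_closed (A : set G) : group_closed (gen_subgroup A).
Proof.
split; first by apply/mem_set => S [/= [S1 _] _]; exact/set_mem.
move=> u v /set_mem uA /set_mem vA; apply/mem_set => S [/= SG AS].
by apply/set_mem/SG.2; apply/mem_set; [exact: uA|exact: vA].
Qed.

Definition commutators : set G :=
  [set z | exists x y : G, z = commg x y].

Definition Gamma2 : {pred G} := gen_subgroup commutators.

Lemma Gamma2_group_closed : group_closed Gamma2.
Proof. exact: gen_subgroup_group_closed. Qed.

HB.instance Definition _ :=
  isMulClosed.Build G Gamma2 (group_closedM Gamma2_group_closed).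
HB.instance Definition _ := isMul1Closed.Build G Gamma2 Gamma2_group_closed.1.
HB.instance Definition _ :=
  isInvClosed.Build G Gamma2 (group_closedV Gamma2_group_closed).

End Subgroups.
Arguments Gamma2 G : clear implicits.

Definition group_iso (G H : groupType) : Prop :=
  exists f : {multiplicative G -> H}, bijective f.

(* An action of Q on N by automorphisms, i.e. a homomorphism Q -> Aut(N). *)
Record gaction (Q N : groupType) := GAction {
  gact :> Q -> N -> N ;
  gact_morph : forall q, {morph gact q : x y / (x * y)%g} ;
  gact1 : forall n, gact 1%g n = n ;
  gactM : forall q r n, gact (q * r)%g n = gact q (gact r n)
}.

Section SemiDirect.
Variables (Q N : groupType) (phi : gaction Q N).

(* The product is such that q n q^-1 = phi q n. *)
Definition semidirect (_ : gaction Q N) : Type := (N * Q)%type.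
Local Notation S := (semidirect phi).

HB.instance Definition _ := Choice.on S.

Definition sd_one : S := (1%g, 1%g).
Definition sd_mul (a b : S) : S := ((a.1 * phi a.2 b.1)%g, (a.2 * b.2)%g).
Definition sd_inv (a : S) : S := (phi a.2^-1%g a.1^-1%g, a.2^-1%g).

Lemma gact_one q : phi q 1%g = 1%g.
Proof. by apply: (mulgI (phi q 1%g)); rewrite -gact_morph !mulg1. Qed.

Lemma sd_mulA : associative sd_mul.
Proof.
by move=> [a p] [b q] [c r]; rewrite /sd_mul /= gact_morph gactM !mulgA.
Qed.
Lemma sd_mul1 : left_id sd_one sd_mul.
Proof. by move=> [a p]; rewrite /sd_mul /= gact1 !mul1g. Qed.
Lemma sd_mulr1 : right_id sd_one sd_mul.
Proof. by move=> [a p]; rewrite /sd_mul /= gact_one !mulg1. Qed.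
Lemma sd_mulV : left_inverse sd_one sd_inv sd_mul.
Proof.
by move=> [a p]; rewrite /sd_mul /= -gact_morph !mulVg gact_one.
Qed.
Lemma sd_mulrV : right_inverse sd_one sd_inv sd_mul.
Proof.
by move=> [a p]; rewrite /sd_mul /= -gactM !mulgV gact1 mulgV.
Qed.

HB.instance Definition _ :=
  isGroup.Build S sd_mulA sd_mul1 sd_mulr1 sd_mulV sd_mulrV.

End SemiDirect.

Section FreeGroup.
Local Open Scope quotient_scope.
Variable X : choiceType.

(* The letters (x, true) and (x, false) stand for x and its inverse. *)
Definition word := seq (X * bool).

Inductive free_conv : word -> word -> Prop :=
| fc_cancel u v x b : free_conv (u ++ (x, b) :: (x, ~~ b) :: v) (u ++ v)
| fc_refl u : free_conv u u
| fc_sym u v : free_conv u v -> free_conv v u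
| fc_trans u v w : free_conv u v -> free_conv v w -> free_conv u w.

Definition free_convb : rel word := fun u v => `[< free_conv u v >].

Lemma free_convb_refl : reflexive free_convb.
Proof. by move=> u; apply/asboolP; exact: fc_refl. Qed.
Lemma free_convb_sym : symmetric free_convb.
Proof. by move=> u v; apply/asboolP/asboolP => /fc_sym. Qed.
Lemma free_convb_trans : transitive free_convb.
Proof.
by move=> v u w /asboolP uv /asboolP vw; apply/asboolP; exact: fc_trans vw.
Qed.

Canonical free_equiv :=
  EquivRel free_convb free_convb_refl free_convb_sym free_convb_trans.

Definition free_group : Type := {eq_quot free_equiv}.
HB.instance Definition _ := Choice.on free_group.
HB.instance Definition _ := EqQuotient.on free_group.

Definition winv (u : word) : word := rev [seq (a.1, ~~ a.2) | a <- u].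

Definition fg_one : free_group := \pi_free_group [::].
Definition fg_mul (x y : free_group) : free_group :=
  \pi_free_group (repr x ++ repr y).
Definition fg_inv (x : free_group) : free_group :=
  \pi_free_group (winv (repr x)).

Definition fgen (x : X) : free_group := \pi_free_group [:: (x, true)].

Lemma free_conv_pi u v : free_conv u v -> \pi_free_group u = \pi_free_group v.
Proof. by move=> uv; apply/eqmodP/asboolP. Qed.

Lemma free_conv_repr u : free_conv (repr (\pi_free_group u)) u.
Proof.
by apply/asboolP; apply/(@eqmodP _ free_equiv); rewrite reprK.
Qed.

Lemma free_conv_catl w u v : free_conv u v -> free_conv (w ++ u) (w ++ v).
Proof.
elim=> {u v} [u v x b|u|u v _|u v z _ uv _].
- by rewrite !catA; exact: fc_cancel.
- exact: fc_refl.
- exact: fc_sym.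
- exact: fc_trans.
Qed.

Lemma free_conv_catr w u v : free_conv u v -> free_conv (u ++ w) (v ++ w).
Proof.
elim=> {u v} [u v x b|u|u v _|u v z _ uv _].
- by rewrite -!catA; exact: fc_cancel.
- exact: fc_refl.
- exact: fc_sym.
- exact: fc_trans.
Qed.

Lemma fg_mulE u v :
  fg_mul (\pi_free_group u) (\pi_free_group v) = \pi_free_group (u ++ v).
Proof.
apply: free_conv_pi; apply: (@fc_trans _ (u ++ repr (\pi_free_group v))).
  exact: free_conv_catr (free_conv_repr u).
exact: free_conv_catl (free_conv_repr v).
Qed.

Lemma winvVl u : free_conv (winv u ++ u) [::].
Proof.
elim: u => [|[x b] u IH]; first exact: fc_refl.
rewrite /winv /= rev_cons cat_rcons; apply: fc_trans IH.
by rewrite -{2}(negbK b); exact: fc_cancel.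
Qed.

Lemma winvVr u : free_conv (u ++ winv u) [::].
Proof.
have := winvVl (winv u); rewrite {1}/winv /winv map_rev revK -map_comp.
rewrite (_ : map _ u = u) // -[RHS]map_id; apply: eq_map => -[x b] /=.
by rewrite negbK.
Qed.

Lemma fg_reprK (x : free_group) : \pi_free_group (repr x) = x.
Proof. exact: reprK. Qed.

Lemma fg_mulA : associative fg_mul.
Proof.
move=> x y z; rewrite -[x]fg_reprK -[y]fg_reprK -[z]fg_reprK.
by rewrite !fg_mulE catA.
Qed.
Lemma fg_mul1 : left_id fg_one fg_mul.
Proof. by move=> x; rewrite -[x]fg_reprK fg_mulE. Qed.
Lemma fg_mulr1 : right_id fg_one fg_mul.
Proof. by move=> x; rewrite -[x]fg_reprK fg_mulE cats0. Qed.
Lemma fg_mulV : left_inverse fg_one fg_inv fg_mul.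
Proof.
move=> x; rewrite -[X in fg_mul _ X]fg_reprK fg_mulE.
by apply: free_conv_pi; exact: winvVl.
Qed.
Lemma fg_mulrV : right_inverse fg_one fg_inv fg_mul.
Proof.
move=> x; rewrite -[X in fg_mul X _]fg_reprK fg_mulE.
by apply: free_conv_pi; exact: winvVr.
Qed.

HB.instance Definition _ :=
  isGroup.Build free_group fg_mulA fg_mul1 fg_mulr1 fg_mulV fg_mulrV.

(* The homomorphism to int sending every generator to 1, see augmentation_fgen
   and augmentationM. *)
Definition exponent_sum (u : word) : int :=
  \sum_(a <- u) (if a.2 then 1 else -1).

Definition augmentation (x : free_group) : int := exponent_sum (repr x).

Lemma exponent_sum_conv u v : free_conv u v -> exponent_sum u = exponent_sum v.
Proof.
elim=> {u v} [u v x b|//|u v _ ->//|u v z _ -> _ ->//].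
rewrite /exponent_sum !big_cat !big_cons /=; congr (_ + _).
by case: b => /=; rewrite addrA ?subrr ?addNr add0r.
Qed.

Lemma augmentation_fgen x : augmentation (fgen x) = 1.
Proof.
rewrite /augmentation (exponent_sum_conv (free_conv_repr _)).
by rewrite /exponent_sum big_seq1.
Qed.

Lemma augmentationM x y :
  augmentation (x * y)%g = augmentation x + augmentation y.
Proof.
rewrite {1}/augmentation (exponent_sum_conv (free_conv_repr _)).
by rewrite /exponent_sum big_cat.
Qed.

Definition Ker_augmentation : {pred free_group} :=
  fun x => augmentation x == 0.

Lemma Ker_augmentation_group_closed : group_closed Ker_augmentation.
Proof.
have a1 : augmentation 1%g = 0.
  by apply: (addrI (augmentation 1%g)); rewrite -augmentationM mulg1 addr0.
split; first exact/eqP.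
move=> u v /eqP u0 /eqP v0; apply/eqP; rewrite augmentationM u0 add0r.
by have := augmentationM v v^-1%g; rewrite mulgV a1 v0 add0r.
Qed.

HB.instance Definition _ := isMulClosed.Build _ Ker_augmentation
  (group_closedM Ker_augmentation_group_closed).
HB.instance Definition _ := isMul1Closed.Build _ Ker_augmentation
  Ker_augmentation_group_closed.1.
HB.instance Definition _ := isInvClosed.Build _ Ker_augmentation
  (group_closedV Ker_augmentation_group_closed).

End FreeGroup.
Arguments Ker_augmentation X : clear implicits.

Lemma continuous_pair (U T1 T2 : topologicalType) (f : U -> T1) (g : U -> T2) :
  continuous f -> continuous g -> continuous (fun u => (f u, g u)).
Proof.
move=> cf cg u W [[A B] [/= fA gB] AB].
have fA' : nbhs u (f @^-1` A) by exact: cf.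
have gB' : nbhs u (g @^-1` B) by exact: cg.
by apply: filterS2 _ fA' gB' => v Av Bv; exact: AB.
Qed.

Section RealContinuity.
Variables (R : realType) (U : topologicalType).
Implicit Types f g : U -> R.

Lemma continuous_maxr f g :
  continuous f -> continuous g -> continuous (fun u => Num.max (f u) (g u)).
Proof. by move=> cf cg u; exact: (@continuous_max R U f g u (cf u) (cg u)). Qed.
Lemma continuous_minr f g :
  continuous f -> continuous g -> continuous (fun u => Num.min (f u) (g u)).
Proof. by move=> cf cg u; exact: (@continuous_min R U f g u (cf u) (cg u)). Qed.
Lemma continuous_cst (a : R) : continuous (fun _ : U => a).
Proof. by move=> u; exact: cvg_cst. Qed.

Lemma continuous_affine (a b : R) f :
  continuous f -> continuous (fun u => a * f u + b).
Proof.
move=> ch u; apply: cvgD; last exact: cvg_cst.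
by apply: cvgM; [exact: cvg_cst|exact: ch].
Qed.

Lemma continuous_Dc (c : R) f : continuous f -> continuous (fun u => f u + c).
Proof. by move=> ch u; apply: cvgD; [exact: ch|exact: cvg_cst]. Qed.

Lemma continuous_affine1 (a : R) f :
  continuous f -> continuous (fun u => a * f u).
Proof. by move=> ch u; apply: cvgM; [exact: cvg_cst|exact: ch]. Qed.

Lemma continuous_cB (c : R) f :
  continuous f -> continuous (fun u => c - f u).
Proof. by move=> ch u; apply: cvgB; [exact: cvg_cst|exact: ch]. Qed.

End RealContinuity.

Section UnitInterval.
Variable R : realType.

Definition unit_interval : Type := set_type (`[0 : R, 1]%classic).
HB.instance Definition _ := Topological.on unit_interval.

Definition ival (t : unit_interval) : R := set_val t.

Lemma clamp_subproof (r : R) :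
  Num.min (Num.max 0 r) 1 \in (`[0 : R, 1]%classic).
Proof.
apply/mem_set; rewrite /= in_itv /= le_min ler01 le_max lexx /=.
by rewrite ge_min lexx orbT.
Qed.

(* The retraction of R onto [0, 1]. *)
Definition clamp (r : R) : unit_interval := 
  exist (fun u => u \in `[0 : R, 1]%classic) _ (clamp_subproof r).

Lemma ival_itv t : 0 <= ival t <= 1.
Proof. by have := set_valP t; rewrite /= in_itv. Qed.

Lemma ival_inj : injective ival.
Proof. by move=> [a ha] [b hb] /= e; exact: eq_sig_hprop. Qed.

Lemma clampK (r : R) : 0 <= r <= 1 -> ival (clamp r) = r.
Proof.
by move=> /andP[r0 r1]; rewrite /ival set_valE /= max_r // min_l.
Qed.

Lemma ivalK : cancel ival clamp.
Proof. by move=> t; apply: ival_inj; rewrite clampK // ival_itv. Qed.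

Lemma ival_continuous : continuous ival.
Proof. exact: initial_continuous. Qed.

Lemma clamp_continuous : continuous clamp.
Proof.
have ct : continuous (fun r : R => Num.min (Num.max 0 r) 1).
  apply: continuous_minr; last exact: continuous_cst.
  by apply: continuous_maxr; [exact: continuous_cst|move=> r; exact: cvg_id].
by apply: continuous_comp_initial; exact: ct.
Qed.

Lemma clamp_neq : clamp 0 != clamp 1.
Proof.
apply/eqP => /(congr1 ival); rewrite !clampK ?lexx ?ler01 // => /eqP.
by rewrite eq_sym oner_eq0.
Qed.

HB.instance Definition _ :=
  isBiPointed.Build unit_interval clamp_neq.

Lemma ival0 : ival zero = 0.
Proof. by rewrite clampK // lexx ler01. Qed.
Lemma ival1 : ival one = 1.
Proof. by rewrite clampK // lexx ler01. Qed.

End UnitInterval.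
Arguments clamp {R}.
Arguments ival {R}.

Lemma paste_continuous (R : realType) (U T : topologicalType) (f g : U -> T)
    (h : U -> R) :
  continuous f -> continuous g -> continuous h ->
  (forall u, h u = 0 -> f u = g u) ->
  continuous (fun u => if h u <= 0 then f u else g u).
Proof.
move=> cf cg ch fg u W /= Wu.
change (nbhs u [set v | W (if h v <= 0 then f v else g v)]).
have [hu|hu|hu] := ltgtP (h u) 0.
- have hn : nbhs u [set v | h v < 0].
    by apply: (cvgr_lt (h u)) => //; exact: ch.
  have fW : nbhs u (f @^-1` W) by apply: cf; rewrite (ltW hu) in Wu.
  by apply: filterS2 _ hn fW => v /= /ltW ->.
- have hn : nbhs u [set v | 0 < h v].
    by apply: (cvgr_gt (h u)) => //; exact: ch.
  have gW : nbhs u (g @^-1` W) by apply: cg; rewrite (lt_geF hu) in Wu.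
  by apply: filterS2 _ hn gW => v /= /lt_geF ->.
- rewrite hu lexx in Wu.
  have fW : nbhs u (f @^-1` W) by exact: cf.
  have gW : nbhs u (g @^-1` W) by apply: cg; rewrite -fg.
  by apply: filterS2 _ fW gW => v /= fv gv; case: ifP.
Qed.

Section FundamentalGroup.
Local Open Scope quotient_scope.
Variables (R : realType) (T : topologicalType) (x : T).
Local Notation I := (unit_interval R).

Definition loop := {path I from x to x in T}.
HB.instance Definition _ := Choice.on loop.

Definition homotopic (p q : loop) : Prop :=
  exists H : (I * I)%type -> T,
    [/\ continuous H, forall t, H (t, zero) = p t, forall t, H (t, one) = q t
      & forall s, H (zero, s) = x /\ H (one, s) = x].

(* Loops are composed from left to right. *)
Definition concat_fun (p q : I -> T) : I -> T := fun t =>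
  if 2 * ival t - 1 <= 0 then p (clamp (2 * ival t))
  else q (clamp (2 * ival t - 1)).

Definition inverse_fun (p : I -> T) : I -> T := fun t => p (clamp (1 - ival t)).

Lemma continuous_clamp (U : topologicalType) (f : I -> T) (h : U -> R) :
  continuous f -> continuous h -> continuous (fun u => f (clamp (h u))).
Proof.
move=> cf ch u; apply: (@continuous_comp _ _ _ (clamp \o h) f).
  by apply: continuous_comp; [exact: ch|exact: clamp_continuous].
exact: cf.
Qed.

Lemma continuous_clamp2 (U : topologicalType) (f : (I * I)%type -> T) (h k : U -> R) :
  continuous f -> continuous h -> continuous k ->
  continuous (fun u => f (clamp (h u), clamp (k u))).
Proof.
move=> cf ch ck u.
apply: (@continuous_comp _ _ _ (fun v => (clamp (h v), clamp (k v))) f).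
  apply: (@continuous_pair _ _ _ (clamp \o h) (clamp \o k)) => v.
    by apply: continuous_comp; [exact: ch|exact: clamp_continuous].
  by apply: continuous_comp; [exact: ck|exact: clamp_continuous].
exact: cf.
Qed.

Lemma continuous_ival1 : continuous (fun z : (I * I)%type => ival z.1).
Proof.
by move=> z; apply: continuous_comp; [exact: cvg_fst|exact: ival_continuous].
Qed.
Lemma continuous_ival2 : continuous (fun z : (I * I)%type => ival z.2).
Proof.
by move=> z; apply: continuous_comp; [exact: cvg_snd|exact: ival_continuous].
Qed.

Lemma concat_continuous (p q : loop) : continuous (concat_fun p q).
Proof.
apply: paste_continuous.
- apply: continuous_clamp; first exact: cts_fun.
  exact/continuous_affine1/ival_continuous.
- apply: continuous_clamp; first exact: cts_fun.
  exact/continuous_affine/ival_continuous.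
- exact/continuous_affine/ival_continuous.
- move=> t e; rewrite e (_ : 2 * ival t = 1); last lra.
  by rewrite [clamp 1]/(one) [clamp 0]/(zero) path_one path_zero.
Qed.

Lemma concat_zero (p q : loop) : concat_fun p q zero = x.
Proof.
by rewrite /concat_fun ival0 mulr0 sub0r oppr_le0 ler01 [clamp 0]/(zero) path_zero.
Qed.

Lemma concat_one (p q : loop) : concat_fun p q one = x.
Proof.
rewrite /concat_fun ival1 mulr1 (_ : 2 - 1 = 1 :> R); last lra.
by rewrite ler10 [clamp 1]/(one) path_one.
Qed.

Definition concat (p q : loop) : loop :=
  mk_path (@concat_continuous p q) (concat_zero p q) (concat_one p q).

Lemma inverse_continuous (p : loop) : continuous (inverse_fun p).
Proof.
apply: continuous_clamp; first exact: cts_fun.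
exact/continuous_cB/ival_continuous.
Qed.

Lemma inverse_zero (p : loop) : inverse_fun p zero = x.
Proof. by rewrite /inverse_fun ival0 subr0 [clamp 1]/(one) path_one. Qed.

Lemma inverse_one (p : loop) : inverse_fun p one = x.
Proof. by rewrite /inverse_fun ival1 subrr [clamp 0]/(zero) path_zero. Qed.

Definition inverse (p : loop) : loop :=
  mk_path (@inverse_continuous p) (inverse_zero p) (inverse_one p).

Definition const_loop : loop :=
  mk_path (fun t => @cvg_cst _ x _ (nbhs t) _) erefl erefl.

Lemma homotopic_refl p : homotopic p p.
Proof.
exists (fun z => p z.1); split=> //; last by move=> s; rewrite path_zero path_one.
by move=> z; apply: continuous_comp; [exact: cvg_fst|exact: cts_fun].
Qed.

Lemma homotopic_sym p q : homotopic p q -> homotopic q p.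
Proof.
move=> [H [cH H0 H1 Hs]].
exists (fun z => H (clamp (ival z.1), clamp (1 - ival z.2))); split.
- apply: continuous_clamp2 => //; first exact: continuous_ival1.
  exact/continuous_cB/continuous_ival2.
- by move=> t; rewrite ivalK ival0 subr0 H1.
- by move=> t; rewrite ivalK ival1 subrr H0.
- by move=> s; rewrite !ivalK; exact: Hs.
Qed.

Lemma homotopic_trans q p r : homotopic p q -> homotopic q r -> homotopic p r.
Proof.
move=> [H [cH H0 H1 Hs]] [K [cK K0 K1 Ks]].
exists (fun z => if 2 * ival z.2 - 1 <= 0 then H (clamp (ival z.1), clamp (2 * ival z.2))
  else K (clamp (ival z.1), clamp (2 * ival z.2 - 1))); split.
- apply: paste_continuous.
  + apply: continuous_clamp2 => //; first exact: continuous_ival1.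
    exact/continuous_affine1/continuous_ival2.
  + apply: continuous_clamp2 => //; first exact: continuous_ival1.
    exact/continuous_affine/continuous_ival2.
  + exact/continuous_affine/continuous_ival2.
  + move=> z e; rewrite e (_ : 2 * ival z.2 = 1); last lra.
    by rewrite [clamp 1]/(one) [clamp 0]/(zero) H1 K0.
- by move=> t; rewrite ivalK ival0 mulr0 sub0r oppr_le0 ler01 [clamp 0]/(zero).
- move=> t; rewrite ivalK ival1 mulr1 (_ : 2 - 1 = 1 :> R); last lra.
  by rewrite ler10 [clamp 1]/(one).
- by move=> s; rewrite !ivalK; split; case: ifP => _; [have [] := Hs (clamp (2 * ival s))
    |have [] := Ks (clamp (2 * ival s - 1))|have [] := Hs (clamp (2 * ival s))
    |have [] := Ks (clamp (2 * ival s - 1))].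
Qed.

Lemma homotopic_concat p p' q q' : homotopic p p' -> homotopic q q' ->
  homotopic (concat p q) (concat p' q').
Proof.
move=> [H [cH H0 H1 Hs]] [K [cK K0 K1 Ks]].
exists (fun z => if 2 * ival z.1 - 1 <= 0 then H (clamp (2 * ival z.1), clamp (ival z.2))
  else K (clamp (2 * ival z.1 - 1), clamp (ival z.2))); split.
- apply: paste_continuous.
  + apply: continuous_clamp2 => //; last exact: continuous_ival2.
    exact/continuous_affine1/continuous_ival1.
  + apply: continuous_clamp2 => //; last exact: continuous_ival2.
    exact/continuous_affine/continuous_ival1.
  + exact/continuous_affine/continuous_ival1.
  + move=> z e; rewrite e (_ : 2 * ival z.1 = 1); last lra.
    rewrite [clamp 1]/(one) [clamp 0]/(zero).
    by rewrite (Hs _).2 (Ks _).1.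
- by move=> t; rewrite ivalK H0 K0.
- by move=> t; rewrite ivalK H1 K1.
- move=> s; rewrite ivalK ival0 ival1 mulr0 sub0r oppr_le0 ler01 mulr1.
  rewrite (_ : 2 - 1 = 1 :> R); last lra.
  rewrite ler10 [clamp 1]/(one) [clamp 0]/(zero).
  by split; [exact: (Hs _).1|exact: (Ks _).2].
Qed.

Lemma homotopic_inverse p q : homotopic p q -> homotopic (inverse p) (inverse q).
Proof.
move=> [H [cH H0 H1 Hs]].
exists (fun z => H (clamp (1 - ival z.1), clamp (ival z.2))); split.
- apply: continuous_clamp2 => //; last exact: continuous_ival2.
  exact/continuous_cB/continuous_ival1.
- by move=> t; rewrite ivalK H0.
- by move=> t; rewrite ivalK H1.
- move=> s; rewrite ivalK ival0 ival1 subr0 subrr [clamp 1]/(one) [clamp 0]/(zero).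
  by split; [exact: (Hs _).2|exact: (Hs _).1].
Qed.

Lemma homotopic_reparam (r p q : loop) (f g : I -> R) :
  continuous f -> continuous g -> f zero = g zero -> f one = g one ->
  (forall t, p t = r (clamp (f t))) -> (forall t, q t = r (clamp (g t))) ->
  homotopic p q.
Proof.
move=> cf cg fg0 fg1 pE qE.
exists (fun z => r (clamp ((1 - ival z.2) * f z.1 + ival z.2 * g z.1))); split.
- apply: continuous_clamp; first exact: cts_fun.
  have cf1 : continuous (fun z : (I * I)%type => f z.1).
    by move=> z; apply: continuous_comp; [exact: cvg_fst|exact: cf].
  have cg1 : continuous (fun z : (I * I)%type => g z.1).
    by move=> z; apply: continuous_comp; [exact: cvg_fst|exact: cg].
  move=> z; apply: cvgD; apply: cvgM.
  + exact: (continuous_cB continuous_ival2).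
  + exact: cf1.
  + exact: continuous_ival2.
  + exact: cg1.
- by move=> t; rewrite ival0 subr0 mul1r mul0r addr0 -pE.
- by move=> t; rewrite ival1 subrr mul1r mul0r add0r -qE.
- move=> s /=; rewrite fg0 fg1 -!mulrDl subrK !mul1r -!qE path_zero path_one.
  by [].
Qed.

Lemma concat1p p : homotopic (concat const_loop p) p.
Proof.
apply: (@homotopic_reparam p _ _ (fun t => Num.max 0 (2 * ival t - 1)) ival).
- apply: continuous_maxr; first exact: continuous_cst.
  exact/continuous_affine/ival_continuous.
- exact: ival_continuous.
- by rewrite ival0 mulr0 sub0r max_l // oppr_le0 ler01.
- by rewrite ival1 mulr1 (_ : 2 - 1 = 1 :> R) ?max_r ?ler01 //; lra.
- move=> t; rewrite /= /mk_path /concat_fun; case: ifPn => h; rewrite -?ltNge in h.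
    by rewrite max_l // [clamp 0]/(zero) path_zero.
  by rewrite max_r // ltW.
- by move=> t; rewrite ivalK.
Qed.

Lemma concatp1 p : homotopic (concat p const_loop) p.
Proof.
apply: (@homotopic_reparam p _ _ (fun t => Num.min 1 (2 * ival t)) ival).
- apply: continuous_minr; first exact: continuous_cst.
  exact/continuous_affine1/ival_continuous.
- exact: ival_continuous.
- by rewrite ival0 mulr0 min_r // ler01.
- by rewrite ival1 mulr1 min_l //; lra.
- move=> t; rewrite /= /mk_path /concat_fun; case: ifPn => h; rewrite -?ltNge in h.
    by rewrite min_r //; lra.
  by rewrite min_l; [rewrite [clamp 1]/(one) path_one|lra].
- by move=> t; rewrite ivalK.
Qed.

Lemma concatVp p : homotopic (concat (inverse p) p) const_loop.
Proof.
apply: (@homotopic_reparam p _ _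
  (fun t => Num.max (1 - 2 * ival t) (2 * ival t - 1)) (fun=> 1)).
- apply: continuous_maxr; last exact/continuous_affine/ival_continuous.
  exact/continuous_cB/continuous_affine1/ival_continuous.
- exact: continuous_cst.
- by rewrite ival0 mulr0 max_l; lra.
- by rewrite ival1 mulr1 max_r; lra.
- move=> t; have /andP[t0 t1] := ival_itv t.
  rewrite /= /mk_path /concat_fun; case: ifPn => h; rewrite -?ltNge in h; last by rewrite max_r //; lra.
  by rewrite max_l; [rewrite /inverse_fun /= clampK //; lra|lra].
- by move=> t; rewrite [clamp 1]/(one) path_one.
Qed.

Lemma concatpV p : homotopic (concat p (inverse p)) const_loop.
Proof.
apply: (@homotopic_reparam p _ _
  (fun t => Num.min (2 * ival t) (2 - 2 * ival t)) (fun=> 0)).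
- apply: continuous_minr; first exact/continuous_affine1/ival_continuous.
  exact/continuous_cB/continuous_affine1/ival_continuous.
- exact: continuous_cst.
- by rewrite ival0 mulr0 min_l; lra.
- by rewrite ival1 mulr1 min_r; lra.
- move=> t; have /andP[t0 t1] := ival_itv t.
  rewrite /= /mk_path /concat_fun; case: ifPn => h; rewrite -?ltNge in h; first by rewrite min_l //; lra.
  rewrite min_r; last lra.
  by rewrite /inverse_fun /= /mk_path /inverse_fun clampK; [congr (p (clamp _))|]; lra.
- by move=> t; rewrite [clamp 0]/(zero) path_zero.
Qed.

Lemma concatA p q s :
  homotopic (concat (concat p q) s) (concat p (concat q s)).
Proof.
apply: (@homotopic_reparam (concat p (concat q s)) _ _
  (fun t => Num.min (2 * ival t) (Num.min (ival t + 4^-1) (2^-1 * ival t + 2^-1)))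
  ival).
- apply: continuous_minr; first exact/continuous_affine1/ival_continuous.
  apply: continuous_minr; last exact/continuous_affine/ival_continuous.
  exact/continuous_Dc/ival_continuous.
- exact: ival_continuous.
- by rewrite ival0; rewrite min_l ?mulr0 // le_min; apply/andP; split; lra.
- rewrite ival1 min_r; last by rewrite ge_min; apply/orP; left; lra.
  by rewrite min_r; lra.
- move=> t; have /andP[t0 t1] := ival_itv t.
  rewrite /= /mk_path /concat_fun /= /mk_path /concat_fun.
  case: ifPn => h1; rewrite -?ltNge in h1.
    rewrite (@clampK _ (2 * ival t)); last lra.
    case: ifPn => h2; rewrite -?ltNge in h2.
      rewrite min_l; last by rewrite le_min; apply/andP; split; lra.
      rewrite clampK; last lra.
      by case: ifPn => h3; rewrite -?ltNge in h3; [congr (p (clamp _)); lra|exfalso; lra].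
    rewrite min_r; last by rewrite ge_min; apply/orP; left; lra.
    rewrite min_l; last lra.
    rewrite clampK; last lra.
    case: ifPn => h3; rewrite -?ltNge in h3; first by exfalso; lra.
    rewrite clampK; last lra.
    by case: ifPn => h4; rewrite -?ltNge in h4; [congr (q (clamp _)); lra|exfalso; lra].
  rewrite min_r; last by rewrite ge_min; apply/orP; right; lra.
  rewrite min_r; last lra.
  rewrite clampK; last lra.
  case: ifPn => h3; rewrite -?ltNge in h3; first by exfalso; lra.
  rewrite clampK; last lra.
  by case: ifPn => h4; rewrite -?ltNge in h4; [exfalso; lra|congr (s (clamp _)); lra].
- by move=> t; rewrite ivalK.
Qed.

Definition homotopicb : rel loop := fun p q => `[< homotopic p q >].

Lemma homotopicb_refl : reflexive homotopicb.
Proof. by move=> p; apply/asboolP; exact: homotopic_refl. Qed.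
Lemma homotopicb_sym : symmetric homotopicb.
Proof. by move=> p q; apply/asboolP/asboolP => /homotopic_sym. Qed.
Lemma homotopicb_trans : transitive homotopicb.
Proof.
by move=> q p r /asboolP pq /asboolP qr; apply/asboolP; exact: homotopic_trans qr.
Qed.

Canonical homotopic_equiv :=
  EquivRel homotopicb homotopicb_refl homotopicb_sym homotopicb_trans.

Definition pi1 : Type := {eq_quot homotopic_equiv}.
HB.instance Definition _ := Choice.on pi1.
HB.instance Definition _ := EqQuotient.on pi1.

Definition pi1_class (p : loop) : pi1 := \pi_pi1 p.

Definition pi1_one : pi1 := pi1_class const_loop.
Definition pi1_mul (a b : pi1) : pi1 := pi1_class (concat (repr a) (repr b)).
Definition pi1_inv (a : pi1) : pi1 := pi1_class (inverse (repr a)).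

Lemma pi1_classP p q : homotopic p q <-> pi1_class p = pi1_class q.
Proof.
split=> [pq|/eqmodP/asboolP //].
by apply/eqmodP/asboolP.
Qed.

Lemma pi1_reprK (a : pi1) : pi1_class (repr a) = a.
Proof. exact: reprK. Qed.

Lemma pi1_mulE p q :
  pi1_mul (pi1_class p) (pi1_class q) = pi1_class (concat p q).
Proof.
by apply/pi1_classP/homotopic_concat; apply/pi1_classP; rewrite pi1_reprK.
Qed.

Lemma pi1_invE p : pi1_inv (pi1_class p) = pi1_class (inverse p).
Proof. by apply/pi1_classP/homotopic_inverse/pi1_classP; rewrite pi1_reprK. Qed.

Lemma pi1_mulA : associative pi1_mul.
Proof.
move=> a b c; rewrite -(pi1_reprK a) -(pi1_reprK b) -(pi1_reprK c) !pi1_mulE.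
by apply/esym/pi1_classP; exact: concatA.
Qed.
Lemma pi1_mul1 : left_id pi1_one pi1_mul.
Proof.
by move=> a; rewrite -(pi1_reprK a) pi1_mulE; apply/pi1_classP; exact: concat1p.
Qed.
Lemma pi1_mulr1 : right_id pi1_one pi1_mul.
Proof.
by move=> a; rewrite -(pi1_reprK a) pi1_mulE; apply/pi1_classP; exact: concatp1.
Qed.
Lemma pi1_mulV : left_inverse pi1_one pi1_inv pi1_mul.
Proof.
move=> a; rewrite -(pi1_reprK a) pi1_invE pi1_mulE.
by apply/pi1_classP; exact: concatVp.
Qed.
Lemma pi1_mulrV : right_inverse pi1_one pi1_inv pi1_mul.
Proof.
move=> a; rewrite -(pi1_reprK a) pi1_invE pi1_mulE.
by apply/pi1_classP; exact: concatpV.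
Qed.

HB.instance Definition _ :=
  isGroup.Build pi1 pi1_mulA pi1_mul1 pi1_mulr1 pi1_mulV pi1_mulrV.

End FundamentalGroup.

Section ConfigurationSpaces.
Local Open Scope quotient_scope.
Variables (m : nat) (M : topologicalType).

Definition ordered_conf : Type :=
  set_type [set y : {ptws 'I_m -> M} | injective y].
HB.instance Definition _ := Topological.on ordered_conf.

Definition conf_fun (y : ordered_conf) : {ptws 'I_m -> M} := set_val y.

Definition same_conf (y z : ordered_conf) : Prop :=
  exists s : 'S_m, forall i, conf_fun z i = conf_fun y (s i).

Definition same_confb : rel ordered_conf := fun y z => `[< same_conf y z >].

Lemma same_confb_refl : reflexive same_confb.
Proof. by move=> y; apply/asboolP; exists 1%g => i; rewrite perm1. Qed.
Lemma same_confb_sym : symmetric same_confb.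
Proof.
by move=> y z; apply/asboolP/asboolP => -[s sE]; exists s^-1%g => i;
  rewrite sE permKV.
Qed.
Lemma same_confb_trans : transitive same_confb.
Proof.
move=> z y w /asboolP[s sE] /asboolP[u uE]; apply/asboolP.
by exists (u * s)%g => i; rewrite uE sE permM.
Qed.

Canonical same_conf_equiv :=
  EquivRel same_confb same_confb_refl same_confb_sym same_confb_trans.

Definition conf : Type := quotient_topology {eq_quot same_conf_equiv}.
HB.instance Definition _ := Topological.on conf.

Definition conf_class (y : ordered_conf) : conf := \pi_{eq_quot same_conf_equiv} y.

Lemma conf_class_continuous : continuous conf_class.
Proof. exact: pi_continuous. Qed.

Lemma conf_classP y z : same_conf y z -> conf_class y = conf_class z.
Proof. by move=> yz; apply/eqmodP/asboolP. Qed.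

Lemma continuous_ordered_conf (U : topologicalType) (f : U -> ordered_conf) :
  (forall i, continuous (fun u => conf_fun (f u) i)) -> continuous f.
Proof.
move=> cf; apply: continuous_comp_initial => u.
apply/cvg_sup => i; move: u.
apply/(@continuousP _ (initial_topology (@^~ i))) => A [B oB E].
have -> : (set_val \o f) @^-1` A = (fun u => conf_fun (f u) i) @^-1` B.
  by rewrite -E.
by apply: open_comp => // v _; exact: cf.
Qed.

End ConfigurationSpaces.
Arguments conf_class {m M}.

(* The base point c is a configuration of m unordered points of M. *)
Definition braid_group (R : realType) (m : nat) (M : topologicalType)
  (c : conf m M) : Type := pi1 R c.
HB.instance Definition _ R m M (c : conf m M) := Group.on (braid_group R c).

Definition disc (R : realType) : set (R * R) :=
  [set v | v.1 ^+ 2 + v.2 ^+ 2 <= 1].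

Arguments disc R : clear implicits.

Definition sphere (R : realType) : set (R * R * R) :=
  [set v | v.1.1 ^+ 2 + v.1.2 ^+ 2 + v.2 ^+ 2 = 1].

Arguments sphere R : clear implicits.

Definition twice_punctured_sphere (R : realType) (x1 x2 : R * R * R) :
  set (R * R * R) := sphere R `\` [set x1; x2].

Section HalfTwists.
Variables (R : realType) (m : nat).

(* The m collinear points ((2 j + 1) / m - 1, 0), j < m, of the disc. *)
Definition base_point (j : nat) : R * R := ((2 * j + 1)%:R / m%:R - 1, 0).

Definition twist_center (k : nat) : R := (2 * k + 2)%:R / m%:R - 1.

(* At time t, the points number k and k + 1 have been rotated
   counterclockwise by the angle pi * t about their midpoint. *)
Definition twist_pos (k : nat) (t : R) (j : nat) : R * R :=
  if j == k then (twist_center k - cos (pi * t) / m%:R, - (sin (pi * t) / m%:R))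
  else if j == k.+1 then
    (twist_center k + cos (pi * t) / m%:R, sin (pi * t) / m%:R)
  else base_point j.

Lemma base_point_disc j : (j < m)%N -> disc R (base_point j).
Proof.
move=> jm; have m0 : 0 < m%:R :> R by rewrite ltr0n; lia.
have j0 : 0 <= j%:R :> R by [].
have jmR : j%:R + 1 <= m%:R :> R by rewrite natr1 ler_nat.
rewrite /disc /base_point /= expr0n addr0.
set x := _ / _; have x0 : 0 <= x by rewrite divr_ge0.
have x2 : x <= 2 by rewrite /x ler_pdivrMr // natrD natrM; lra.
by nra.
Qed.

Lemma twist_pos_disc k t j : (k.+1 < m)%N -> (j < m)%N -> disc R (twist_pos k t j).
Proof.
move=> km jm; rewrite /twist_pos.
have m0 : 0 < m%:R :> R by rewrite ltr0n; lia.
have main (u v : R) : u ^+ 2 + v ^+ 2 = 1 ->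
    (twist_center k + u / m%:R) ^+ 2 + (v / m%:R) ^+ 2 <= 1.
  move=> uv; set a := m%:R^-1; set c := twist_center k.
  have a0 : 0 < a by rewrite invr_gt0.
  have ma : m%:R * a = 1 by rewrite divff // gt_eqF.
  have k0 : 0 <= k%:R :> R by [].
  have kmR : k%:R + 2 <= m%:R :> R by rewrite -natrD ler_nat; lia.
  have cE : c = (2 * k%:R + 2) * a - 1 by rewrite /c /twist_center natrD natrM.
  have c1 : a - 1 <= c by rewrite cE; nra.
  have c2 : c <= 1 - a by rewrite cE; nra.
  have u1 : u ^+ 2 <= 1 by have := sqr_ge0 v; lra.
  have uN : -1 <= u by nra.
  have uP : u <= 1 by nra.
  have v2 : v ^+ 2 = 1 - u ^+ 2 by lra.
  have : c * u <= 1 - a by nra.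
  rewrite sqrrD !exprMn v2; move=> cu.
  have : c ^+ 2 <= (1 - a) ^+ 2 by nra.
  nra.
case: eqP => _.
  rewrite /disc /= -!mulNr; apply: main.
  by rewrite !sqrrN cos2Dsin2.
case: eqP => _; last exact: base_point_disc.
by apply: main; exact: cos2Dsin2.
Qed.

Lemma base_pointE k j : (0 < m)%N ->
  base_point j = (twist_center k + (2 * j%:R - 2 * k%:R - 1) / m%:R, 0).
Proof.
move=> m0; have mn0 : m%:R != 0 :> R by rewrite pnatr_eq0; lia.
have E l c : (2 * l + c)%:R = 2 * l%:R + c%:R :> R by rewrite natrD natrM.
by congr (_, _); rewrite /twist_center !E; field.
Qed.

Lemma twist_pos_inj k t i j : (k.+1 < m)%N ->
  twist_pos k t i = twist_pos k t j -> i = j.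
Proof.
move=> km; have m0 : 0 < m%:R :> R by rewrite ltr0n; lia.
have a0 : 0 < m%:R^-1 :> R by rewrite invr_gt0.
set u := cos (pi * t); set v := sin (pi * t).
have uv : u ^+ 2 + v ^+ 2 = 1 by exact: cos2Dsin2.
have far l : l <> k -> l <> k.+1 -> 3 ^+ 2 <= (2 * l%:R - 2 * k%:R - 1) ^+ 2 :> R.
  move=> lk lk1; have [h|h] : (l.+1 <= k)%N \/ (k.+2 <= l)%N by lia.
    have : l%:R + 1 <= k%:R :> R by rewrite natr1 ler_nat.
    by move=> ?; nra.
  have : k%:R + 2 <= l%:R :> R by rewrite -natrD ler_nat; lia.
  by move=> ?; nra.
have clash e l : l <> k -> l <> k.+1 -> e ^+ 2 = u ^+ 2 ->
    twist_center k + e / m%:R <> (base_point l).1.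
  move=> lk lk1 eu; rewrite (base_pointE k) /=; last lia.
  move=> /addrI /(mulIf (lt0r_neq0 a0)) el.
  by have := far l lk lk1; have := sqr_ge0 v; rewrite -el eu; lra.
have antipodal : ~ (twist_center k - u / m%:R = twist_center k + u / m%:R /\
    - (v / m%:R) = v / m%:R).
  move=> [/addrI uE vE].
  have /eqP : u / m%:R = 0 by lra.
  have /eqP : v / m%:R = 0 by lra.
  rewrite !mulf_eq0 !invr_eq0 !(gt_eqF m0) !orbF => /eqP v0 /eqP u0.
  by move: uv; rewrite v0 u0; lra.
have uN : (- u) ^+ 2 = u ^+ 2 by rewrite sqrrN.
rewrite /twist_pos -/u -/v.
case: (i =P k) => [->|ik]; case: (j =P k) => [->//|jk].
- case: (j =P k.+1) => [->|jk1]; first by case=> *; case: antipodal.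
  by rewrite -mulNr => /(congr1 fst) /= /(clash _ _ jk jk1 uN).
- case: (i =P k.+1) => [->|ik1]; first by case=> e1 e2; case: antipodal.
  by rewrite -mulNr => /(congr1 fst) /= /esym /(clash _ _ ik ik1 uN).
- case: (i =P k.+1) => [->|ik1]; case: (j =P k.+1) => [->//|jk1].
  + by move=> /(congr1 fst) /= /(clash _ _ jk jk1 erefl).
  + by move=> /(congr1 fst) /= /esym /(clash _ _ ik ik1 erefl).
  + rewrite !(base_pointE k); [|lia|lia].
    move=> /(congr1 fst) /= /addrI /(mulIf (lt0r_neq0 a0)) e.
    by apply/eqP; rewrite -(eqr_nat R); apply/eqP; lra.
Qed.

Lemma twist_pos0 k j : (k.+1 < m)%N -> twist_pos k 0 j = base_point j.
Proof.
move=> km; rewrite /twist_pos mulr0 cos0 sin0 !mul0r oppr0.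
case: eqP => [->|_].
  by rewrite (base_pointE k); [congr (_ + _, _); lra|lia].
case: eqP => [->|_ //].
by rewrite (base_pointE k); [rewrite -natr1; congr (_ + _ / _, _); lra|lia].
Qed.

Lemma twist_pos1 k (kl kr i : 'I_m) : kl = k :> nat -> kr = k.+1 :> nat ->
  twist_pos k 1 i = base_point (tperm kl kr i).
Proof.
move=> lk rk; have m0 : (0 < m)%N by case: i => i /=; lia.
rewrite /twist_pos mulr1 cospi sinpi !mul0r oppr0.
case: eqP => [ik|ik].
  have -> : i = kl by apply: val_inj; rewrite /= ik.
  rewrite tpermL rk (base_pointE k) // -natr1.
  by congr (_, _); rewrite -mulNr opprK; congr (_ + _ / _); lra.
case: eqP => [ik1|ik1].
  have -> : i = kr by apply: val_inj; rewrite /= ik1.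
  by rewrite tpermR lk (base_pointE k) //; congr (_ + _ / _, _); lra.
by rewrite tpermD //; apply/eqP => e; [apply: ik|apply: ik1]; rewrite -e.
Qed.

Lemma twist_pos_continuous k j : continuous (fun t => twist_pos k t j).
Proof.
have cpi : continuous (fun t : R => pi * t).
  by apply: continuous_affine1 => t; exact: cvg_id.
have cc : continuous (fun t : R => cos (pi * t)).
  by move=> t; apply: continuous_comp; [exact: cpi|exact: continuous_cos].
have cs : continuous (fun t : R => sin (pi * t)).
  by move=> t; apply: continuous_comp; [exact: cpi|exact: continuous_sin].
have cdiv (f : R -> R) : continuous f -> continuous (fun t => f t / m%:R).
  by move=> cf t; apply: cvgM; [exact: cf|exact: cvg_cst].
rewrite /twist_pos; case: eqP => _.
  apply: continuous_pair; first exact/continuous_cB/cdiv.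
  by move=> t; apply: cvgN; exact: cdiv.
case: eqP => _.
  apply: continuous_pair; last exact: cdiv.
  by move=> t; apply: cvgD; [exact: cvg_cst|exact: cdiv].
by move=> t; exact: cvg_cst.
Qed.

Lemma base_point_inj i j : base_point i = base_point j -> (0 < m)%N -> i = j.
Proof.
move=> + m0; rewrite !(base_pointE 0) // => /(congr1 fst) /= /addrI.
have mn0 : m%:R^-1 != 0 :> R by rewrite invr_eq0 pnatr_eq0; lia.
move=> /(mulIf mn0) e.
by apply/eqP; rewrite -(eqr_nat R); apply/eqP; lra.
Qed.

Definition disc_conf_fun (f : 'I_m -> R * R) (fD : forall i, disc R (f i)) :
  {ptws 'I_m -> disc R} := fun i => SigSub (mem_set (fD i)).

Lemma disc_conf_inj f fD : injective f -> injective (@disc_conf_fun f fD).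
Proof. by move=> fi i j /(congr1 val) /= /fi. Qed.

Definition disc_conf f (fD : forall i, disc R (f i)) (fi : injective f) :
    ordered_conf m (disc R) :=
  SigSub (mem_set (@disc_conf_inj f fD fi)).

Lemma base_conf_inj : injective (fun i : 'I_m => base_point i).
Proof. by move=> i j /base_point_inj e; apply/val_inj/e; case: i {e} => i; lia. Qed.

Definition base_conf : ordered_conf m (disc R) :=
  disc_conf (fun i => base_point_disc (ltn_ord i)) base_conf_inj.

Section OneTwist.
Variable k : 'I_m.-1.

Lemma twist_index : (k.+1 < m)%N.
Proof. by case: k => i /=; lia. Qed.

Lemma twist_conf_inj t : injective (fun i : 'I_m => twist_pos k t i).
Proof. by move=> i j /(twist_pos_inj twist_index) e; exact: val_inj. Qed.

Definition twist_conf (t : R) : ordered_conf m (disc R) :=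
  disc_conf (fun i => twist_pos_disc t twist_index (ltn_ord i))
    (@twist_conf_inj t).

Definition half_twist_fun (t : unit_interval R) : conf m (disc R) :=
  conf_class (twist_conf (ival t)).

Lemma half_twist_continuous : continuous half_twist_fun.
Proof.
move=> t; apply: continuous_comp; last exact: conf_class_continuous.
move: t; apply: continuous_ordered_conf => i.
apply: continuous_comp_initial => t.
apply: (@continuous_comp _ _ _ ival (fun t => twist_pos k t i)).
  exact: ival_continuous.
exact: twist_pos_continuous.
Qed.

Lemma half_twist_zero : half_twist_fun zero = conf_class base_conf.
Proof.
apply: conf_classP; exists 1%g => i; apply: val_inj => /=.
by rewrite ival0 perm1 twist_pos0 // twist_index.
Qed.

Lemma half_twist_one : half_twist_fun one = conf_class base_conf.
Proof.
have kl : (k < m)%N := ltnW twist_index.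
apply/esym/conf_classP.
exists (tperm (Ordinal kl) (Ordinal twist_index)) => i; apply: val_inj => /=.
by rewrite ival1; exact: twist_pos1.
Qed.

Definition half_twist : loop R (conf_class base_conf) :=
  mk_path half_twist_continuous half_twist_zero half_twist_one.

End OneTwist.

Definition disc_braid_group := braid_group R (conf_class base_conf).

(* The standard generators are numbered from 3 to m + 1, sigma 3 being the half
   twist of the two leftmost points; other values of i are irrelevant. *)
Definition sigma (i : nat) : disc_braid_group :=
  if insub (i - 3)%N is Some k then pi1_class (half_twist k) else 1%g.

End HalfTwists.

(* The free generators A_{2,j} are numbered from 3 to m + 2; other values of j
   are irrelevant. *)
Definition A2 (m j : nat) : free_group 'I_m :=
  if insub (j - 3)%N is Some k then fgen k else 1%g.

(* Main.v *)
(* Label a configuration in a convex planar region by the lexicographic order of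
   its points. Nearby configurations then differ by a permutation (their relative
   position), which gives a cocycle; by Matsumoto's theorem, which lifts
   permutations to positive braids, the cocycle lifts to any group satisfying the
   braid relations, and its holonomy shows that the configuration space has
   Artin's group as its fundamental group.

   Twice punctured, the sphere is the plane minus the origin. Adding the origin
   as an extra strand maps the braid group of the punctured plane to B_(m+1): the
   image is the stabilizer of that strand, and the map is injective because one
   may always translate the strand back to the origin.

   Sending x_j to the pure braid in which strand j.+1 goes round strand 0, and the
   generators of B_m to the last ones of B_(m+1), one gets a homomorphism from the
   semidirect product F_m x| B_m to B_(m+1). Counting cosets shows that its image
   is the same stabilizer; it is injective because the Artin representation is
   faithful, which is proved along the way by induction on m: a braid acting
   trivially on F_(m+1) fixes strand 0, so it comes from F_m x| B_m.

   For the commutator subgroups, note that the free generators become equal modulo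
   commutators of the semidirect product. *)
Require Import Defs.
From HB Require Import structures.
From mathcomp Require Import all_boot all_order all_algebra all_fingroup generic_quotient.
From mathcomp Require Import all_classical all_reals all_analysis.
From mathcomp Require Import homotopy.
From mathcomp Require Import ring lra zify.

Set Implicit Arguments.
Unset Strict Implicit.
Unset Printing Implicit Defensive.

Import Order.TTheory GRing.Theory Num.Theory.
Import numFieldNormedType.Exports.

Local Open Scope classical_set_scope.
Local Open Scope ring_scope.

(** * Matsumoto's section of the symmetric group *)

(** Why lexicographic cells work: two points whose order changes between a configuration and a
    neighbour share a vertical line in the former and not in the latter, so a further small motion
    cannot restore their order. Inversions only accumulate and lengths add up, which is exactly the
    case where the positive lift is multiplicative. No presented group is constructed: a braid group
    is any group generated by elements satisfying the braid relations and mapping to every other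
    such family; holonomy provides the maps. In a convex region the homotopies between braids come
    from one principle: the paths to be compared lie in a set of labelled configurations that is
    star-shaped about a diagonal one, and are contracted through it. The obstacle is the injectivity
    of the map from the semidirect product, which a fibration sequence would give. The action on the
    free group replaces it: faithfulness on n strands yields injectivity, and injectivity yields
    faithfulness on n + 1. This induction needs a braid group for every n, which the plane
    supplies. *)

Section PermNat.
Variable n : nat.
Implicit Types w : 'S_n.

(** Permutations act on all naturals, fixing those from n on, so that computations with indices
    carry no bound proofs. *)
Definition ap w (i : nat) : nat := if insub i is Some o then w o else i.

Lemma apE w (o : 'I_n) : ap w o = w o.
Proof. by rewrite /ap valK. Qed.

Lemma apO w i (h : (i < n)%N) : ap w i = w (Ordinal h).
Proof. by rewrite -apE. Qed.

Lemma ap_lt w i : (i < n)%N -> (ap w i < n)%N.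
Proof. by move=> h; rewrite (apO w h). Qed.

Lemma ap_out w i : (n <= i)%N -> ap w i = i.
Proof. by move=> h; rewrite /ap insubF //; apply/negbTE; rewrite -leqNgt. Qed.

Lemma ap1 i : ap 1%g i = i.
Proof. by case: (ltnP i n) => h; [rewrite (apO _ h) perm1|rewrite ap_out]. Qed.

Lemma apM w w' i : ap (w * w')%g i = ap w' (ap w i).
Proof.
case: (ltnP i n) => h; last by rewrite !ap_out // ap_out.
by rewrite (apO w h) (apO _ h) permM apE.
Qed.

Lemma ap_inj w : injective (ap w).
Proof. by move=> i j e; rewrite -[i]ap1 -[j]ap1 -(mulgV w) !apM e. Qed.

Lemma apKV w i : ap w (ap w^-1%g i) = i.
Proof. by rewrite -apM mulVg ap1. Qed.

Lemma apK w i : ap w^-1%g (ap w i) = i.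
Proof. by rewrite -apM mulgV ap1. Qed.

Lemma ap_ext w w' : (forall i, (i < n)%N -> ap w i = ap w' i) -> w = w'.
Proof. by move=> e; apply/permP => o; apply: val_inj; rewrite /= -!apE e. Qed.

Definition adj (j : nat) : 'S_n :=
  if insub j is Some a then if insub j.+1 is Some b then tperm a b else 1%g else 1%g.

Lemma adjE j (a b : 'I_n) : a = j :> nat -> b = j.+1 :> nat -> adj j = tperm a b.
Proof. by move=> <- bj; rewrite /adj valK -bj valK. Qed.

Lemma ap_adj j i : (j.+1 < n)%N ->
  ap (adj j) i = if i == j then j.+1 else if i == j.+1 then j else i.
Proof.
move=> h; have h' := ltnW h.
rewrite (@adjE _ (Ordinal h') (Ordinal h) erefl erefl).
case: (ltnP i n) => hi; last first.
  by rewrite ap_out //; repeat case: eqP => ?; lia.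
rewrite (apO _ hi) permE /= -!val_eqE /=.
by case: eqP => // _; case: eqP.
Qed.

Lemma ap_adjl j : (j.+1 < n)%N -> ap (adj j) j = j.+1.
Proof. by move=> h; rewrite ap_adj // eqxx. Qed.

Lemma ap_adjr j : (j.+1 < n)%N -> ap (adj j) j.+1 = j.
Proof. by move=> h; rewrite ap_adj // eqxx gtn_eqF. Qed.

Lemma ap_adjD j i : (j.+1 < n)%N -> i <> j -> i <> j.+1 -> ap (adj j) i = i.
Proof. by move=> h /eqP ij /eqP ij1; rewrite ap_adj // (negbTE ij) (negbTE ij1). Qed.

Lemma adj2 j : (adj j * adj j)%g = 1%g.
Proof.
rewrite /adj; case: insub => [a|]; last by rewrite mulg1.
by case: insub => [b|]; rewrite ?tperm2 ?mulg1.
Qed.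

Lemma adjV j : (adj j)^-1%g = adj j.
Proof. by apply: (mulgI (adj j)); rewrite mulgV adj2. Qed.

Lemma adjK j w : (adj j * (adj j * w))%g = w.
Proof. by rewrite mulgA adj2 mul1g. Qed.

Lemma no_descent w :
  (forall j, (j.+1 < n)%N -> (ap w j <= ap w j.+1)%N) -> w = 1%g.
Proof.
move=> h.
have mono i d : (i + d < n)%N -> (ap w i <= ap w (i + d))%N.
  elim: d => [|d IH] hd; first by rewrite addn0.
  by rewrite addnS; apply: leq_trans (IH _) (h _ _); lia.
have ge i : (i < n)%N -> (i <= ap w i)%N.
  elim: i => [//|i IH] hi.
  have := h _ hi; rewrite leq_eqVlt => /orP[/eqP/ap_inj|]; first lia.
  by have := IH (ltnW hi); lia.
have le i : (i < n)%N -> (ap w i <= i)%N.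
  move=> hi; elim: {i}(n - i)%N {-2}i (leqnn (n - i)) hi => [|d IH] i hd hi; first lia.
  case: (ltnP i.+1 n) => h1; last by have := ap_lt w hi; lia.
  have := h _ h1; rewrite leq_eqVlt => /orP[/eqP/ap_inj|]; first lia.
  by have := IH i.+1 ltac:(lia) h1; lia.
apply: ap_ext => i hi; rewrite ap1; apply/eqP; rewrite eqn_leq.
by rewrite ge // le.
Qed.

(** By rearrangement this is largest at the identity. It serves as a bounded measure that grows
    whenever a descent is undone, opposite to the Coxeter length. *)
Definition weight w : nat := (\sum_(i < n) i * ap w i)%N.

Lemma weight_le w : (weight w <= n * (n * n))%N.
Proof.
apply: (@leq_trans (\sum_(i < n) (n * n))%N).
  by apply: leq_sum => i _; apply: leq_mul; apply: ltnW; rewrite ?ap_lt.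
by rewrite sum_nat_const card_ord.
Qed.

Lemma weight_adj j w : (j.+1 < n)%N -> (ap w j.+1 < ap w j)%N ->
  (weight w < weight (adj j * w)%g)%N.
Proof.
move=> h d; have h' := ltnW h.
rewrite /weight (bigD1 (Ordinal h')) //= (bigD1 (Ordinal h)) /=; last first.
  by rewrite -val_eqE /=; lia.
rewrite [X in (_ < X)%N](bigD1 (Ordinal h')) //= [X in (_ < _ + X)%N](bigD1 (Ordinal h)) /=; last first.
  by rewrite -val_eqE /=; lia.
rewrite !apM !ap_adj // eqxx (_ : (j.+1 == j) = false); last lia.
rewrite eqxx.
rewrite [X in (_ < _ + (_ + X))%N](eq_bigr (fun i : 'I_n => (i * ap w i)%N)); last first.
  move=> i; rewrite -!val_eqE /= => /andP[i1 i2].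
  by rewrite apM ap_adj // (negbTE i1) (negbTE i2).
rewrite !addnA ltn_add2r.
by change (j * ap w j + ap w j.+1 + j * ap w j.+1 < j * ap w j.+1 + ap w j + j * ap w j)%N; lia.
Qed.

(** Induction on Coxeter length: each step prepends an adjacent transposition that creates a
    descent. *)
Lemma descent_ind (P : 'S_n -> Prop) : P 1%g ->
  (forall j w, (j.+1 < n)%N -> (ap w j < ap w j.+1)%N -> P w -> P (adj j * w)%g) ->
  forall w, P w.
Proof.
move=> P1 PS w.
elim: {w}(n * (n * n) - weight w)%N {-2}w (leqnn (n * (n * n) - weight w)) => [|d IH] w hd.
  rewrite (_ : w = 1%g) //; apply: no_descent => j hj; rewrite leqNgt; apply/negP => dj.
  by have := weight_adj hj dj; have := weight_le (adj j * w)%g; lia.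
case: (pselect (exists j, (j.+1 < n)%N /\ (ap w j.+1 < ap w j)%N)) => [[j [hj dj]]|nd]; last first.
  rewrite (_ : w = 1%g) //; apply: no_descent => j hj; rewrite leqNgt; apply/negP => dj.
  by apply: nd; exists j.
rewrite -(adjK j w); apply: PS => //.
  by rewrite !apM !ap_adj // eqxx (_ : (j.+1 == j) = false) ?eqxx //; lia.
by apply: IH; have := weight_adj hj dj; have := weight_le (adj j * w)%g; lia.
Qed.

End PermNat.
Arguments adj {n}.

Definition braid_rel (G : groupType) (n : nat) (s : nat -> G) : Prop :=
  (forall j k, (j.+1 < k)%N -> (k.+1 < n)%N -> s j * s k = s k * s j)%g /\
  (forall j, (j.+2 < n)%N -> s j * s j.+1 * s j = s j.+1 * s j * s j.+1)%g.

Lemma adj_braid n : braid_rel n (@adj n).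
Proof.
split=> [j k jk hk|j hj]; apply: ap_ext => i hi; rewrite !apM.
  have hj : (j.+1 < n)%N by lia.
  have [ij|ij] := pselect (i = j \/ i = j.+1).
    by case: ij => ->; rewrite ?ap_adjl ?ap_adjr ?(@ap_adjD _ k) ?ap_adjl ?ap_adjr //; lia.
  rewrite (@ap_adjD _ j i) //; [|lia..].
  rewrite (@ap_adj _ k) //; case: eqP => ik; [|case: eqP => ik1];
    by rewrite (@ap_adjD _ j) //; lia.
have hj' : (j.+1 < n)%N by lia.
have D2 : ap (adj j : 'S_n) j.+2 = j.+2 by rewrite ap_adjD //; lia.
have D0 : ap (adj j.+1 : 'S_n) j = j by rewrite ap_adjD //; lia.
have [->|ij] := eqVneq i j; first by rewrite D0 ap_adjl // ap_adjl // D2.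
have [->|ij1] := eqVneq i j.+1; first by rewrite ap_adjr // D0 ap_adjl // ap_adjl // D2 ap_adjr.
have [->|ij2] := eqVneq i j.+2; first by rewrite D2 ap_adjr // ap_adjr // D0.
have E : ap (adj j : 'S_n) i = i by rewrite ap_adjD //; lia.
have E' : ap (adj j.+1 : 'S_n) i = i by rewrite ap_adjD //; lia.
by rewrite !(E, E').
Qed.

Section Matsumoto.
Variables (G : groupType) (n : nat) (g : nat -> G).
Hypothesis gB : braid_rel n g.
Local Open Scope group_scope.

(** The element x is read off a reduced word of w in reverse order, which is why [pbraid] inverts
    its argument. A relation leaves the independence of the word to [lift_fun]. *)
Inductive lift_rel : 'S_n -> G -> Prop :=
| lift1 : lift_rel 1 1
| liftS j w x : (j.+1 < n)%N -> (ap w j < ap w j.+1)%N ->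
    lift_rel w x -> lift_rel (adj j * w) (x * g j).

Lemma lift_ex w : exists x, lift_rel w x.
Proof.
elim/descent_ind: w => [|j w hj dj [x wx]]; first by exists 1; constructor.
by exists (x * g j); constructor.
Qed.

Lemma lift_inv w z : lift_rel w z -> w = 1 /\ z = 1 \/ exists j z0,
  [/\ (j.+1 < n)%N, (ap w j.+1 < ap w j)%N, lift_rel (adj j * w) z0 & z = z0 * g j].
Proof.
case=> [|j w0 z0 hj dj h]; [by left|right; exists j, z0].
by rewrite adjK !apM !ap_adj // eqxx (_ : (j.+1 == j) = false) ?eqxx //; lia.
Qed.

(** A diamond argument. Two descents j and k of w lead down to a common permutation, in three steps
    if they are adjacent and in two otherwise; the relations of [g] close the diagram, and the
    induction hypothesis applies to [adj j * w] and [adj k * w]. *)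
Lemma lift_fun w x y : lift_rel w x -> lift_rel w y -> x = y.
Proof.
elim: {w}(n * (n * n) - weight w)%N {-2}w (leqnn (n * (n * n) - weight w)%N) x y => [|d IH] w hd x y.
  move=> /lift_inv[[_ ->]|[j [x0 [hj dj _ _]]]]; last first.
    by have := weight_adj hj dj; have := weight_le (adj j * w); lia.
  move=> /lift_inv[[_ ->] //|[j [x0 [hj dj _ _]]]].
  by have := weight_adj hj dj; have := weight_le (adj j * w); lia.
move=> /lift_inv[[w1 ->]|[j [x0 [hj dj h1 ->]]]].
  by move=> /lift_inv[[_ ->] //|[j [x0 [hj]]]]; rewrite w1 !ap1; lia.
move=> /lift_inv[[w1 ->]|[k [y0 [hk dk h2 ->]]]].
  by move: dj; rewrite w1 !ap1; lia.
have IHj v i : (i.+1 < n)%N -> (ap w i.+1 < ap w i)%N -> v = adj i * w ->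
    forall a b, lift_rel v a -> lift_rel v b -> a = b.
  move=> hi di -> a b; apply: IH; have := weight_adj hi di.
  by have := weight_le (adj i * w); lia.
have [jk|] := eqVneq j k.
  by subst k; rewrite (IHj _ _ hj dj erefl _ _ h1 h2).
wlog jk : j k x0 y0 hj hk dj dk h1 h2 / (j < k)%N.
  move=> H; rewrite neq_ltn => /orP[jk|kj]; first by apply: H => //; lia.
  by apply/esym; apply: H => //; lia.
move=> _; move: jk; rewrite leq_eqVlt => /orP[/eqP jk|jk].
  subst k.
  (* Here [z] lifts what remains of w once the longest permutation of j, j.+1, j.+2 is removed. *)
  have [z hz] := lift_ex (adj j * (adj j.+1 * (adj j * w))).
  have D2 : ap (adj j : 'S_n) j.+2 = j.+2 by rewrite ap_adjD //; lia.
  have D0 : ap (adj j.+1 : 'S_n) j = j by rewrite ap_adjD //; lia.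
  have L1 : lift_rel (adj j * w) (z * g j * g j.+1).
    rewrite -[adj j * w](adjK j.+1); apply: liftS => //.
      by rewrite !apM ap_adjl // ap_adjr // D2 ap_adjr //; lia.
    rewrite -[adj j.+1 * _](adjK j); apply: liftS => //.
    by rewrite !apM ap_adjl // ap_adjr // ap_adjl // D0 D2 ap_adjl //; lia.
  have L2 : lift_rel (adj j.+1 * w) (z * g j.+1 * g j).
    rewrite -[adj j.+1 * w](adjK j); apply: liftS => //.
      by rewrite !apM ap_adjl // ap_adjr // ap_adjl // D0; lia.
    rewrite -[adj j * _](adjK j.+1); apply: liftS => //.
      by rewrite !apM ap_adjl // ap_adjr // D2 ap_adjr // ap_adjr // D0; lia.
    by move: hz; rewrite !mulgA (adj_braid n).2.
  rewrite (IHj _ _ hj dj erefl _ _ h1 L1) (IHj _ _ hk dk erefl _ _ h2 L2).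
  by rewrite -!mulgA; congr (z * _); rewrite !mulgA; apply: gB.2.
have [z hz] := lift_ex (adj k * (adj j * w)).
have L1 : lift_rel (adj j * w) (z * g k).
  rewrite -[adj j * w](adjK k); apply: liftS => //.
  by rewrite !apM ap_adjl // ap_adjr // !(@ap_adjD _ j) //; lia.
have L2 : lift_rel (adj k * w) (z * g j).
  rewrite -[adj k * w](adjK j); apply: liftS => //.
    by rewrite !apM ap_adjl // ap_adjr // !(@ap_adjD _ k) //; lia.
  by move: hz; rewrite !mulgA ((adj_braid n).1 _ _ jk hk).
rewrite (IHj _ _ hj dj erefl _ _ h1 L1) (IHj _ _ hk dk erefl _ _ h2 L2).
by rewrite -!mulgA (gB.1 _ _ jk hk).
Qed.

(* The Matsumoto section: [pbraid p] is the positive lift of [p] to G. *)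
Definition pbraid (p : 'S_n) : G := sval (cid (lift_ex p^-1)).

Lemma pbraidP p : lift_rel p^-1 (pbraid p).
Proof. exact: (svalP (cid (lift_ex p^-1))). Qed.

Lemma pbraid1 : pbraid 1 = 1.
Proof. by apply: (lift_fun (pbraidP 1)); rewrite invg1; constructor. Qed.

Lemma pbraidS p j : (j.+1 < n)%N -> (ap p^-1 j < ap p^-1 j.+1)%N ->
  pbraid (p * adj j) = pbraid p * g j.
Proof.
move=> hj dj; apply: (lift_fun (pbraidP _)); rewrite invMg adjV.
by apply: liftS => //; exact: pbraidP.
Qed.

Lemma pbraid_adj j : (j.+1 < n)%N -> pbraid (adj j) = g j.
Proof.
by move=> hj; rewrite -[adj j]mul1g pbraidS ?pbraid1 ?mul1g // invg1 !ap1.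
Qed.

(** The hypothesis says that every inversion of p survives in p * q, i.e. that lengths add; a
    reduced word of p followed by one of q is then reduced. *)
Lemma pbraidM p q :
  (forall k l, (k < l)%N -> (l < n)%N -> (ap p l < ap p k)%N ->
     (ap (p * q) l < ap (p * q) k)%N) ->
  pbraid (p * q) = pbraid p * pbraid q.
Proof.
rewrite -[q]invgK; elim/descent_ind: {q}(q^-1) => [|j w hj dj IH] H.
  by rewrite invg1 mulg1 pbraid1 mulg1.
rewrite invMg adjV mulgA.
have H' k l : (k < l)%N -> (l < n)%N -> (ap p l < ap p k)%N ->
     (ap (p * w^-1) l < ap (p * w^-1) k)%N.
  move=> kl ln pkl; have := H _ _ kl ln pkl.
  rewrite invMg adjV mulgA [ap (_ * adj j) _]apM [ap (_ * adj j) k]apM !ap_adj //.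
  set a := ap (p * w^-1) l; set b := ap (p * w^-1) k => ab.
  have nab : ~ (a = j.+1 /\ b = j).
    rewrite /a /b !apM => -[ea eb]; move: dj pkl.
    by rewrite -ea -[in ap w j]eb !apKV; lia.
  by move: ab; repeat case: eqP; lia.
rewrite pbraidS //; first last.
  (* A descent here would give a pair inverted by p whose order the final [adj j] restores, against
     the hypothesis. *)
  rewrite invMg invgK.
  rewrite ltn_neqAle; apply/andP; split.
    by apply/eqP => /ap_inj; lia.
  rewrite leqNgt; apply/negP => lt.
  set k := ap (w * p^-1) j.+1 in lt; set l := ap (w * p^-1) j in lt.
  have ln : (l < n)%N by rewrite ap_lt; lia.
  have pk : ap p k = ap w j.+1 by rewrite /k apM apKV.
  have pl : ap p l = ap w j by rewrite /l apM apKV.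
  have := H _ _ lt ln; rewrite pk pl => /(_ dj).
  rewrite invMg adjV !apM pk pl !apK !ap_adj // eqxx (_ : (j.+1 == j) = false) ?eqxx //; lia.
rewrite IH // -mulgA; congr (_ * _).
by rewrite pbraidS // invgK.
Qed.

End Matsumoto.

(** * Free groups and Artin automorphisms *)

Section Morphisms.
Variables (G H : groupType) (f : G -> H).
Hypothesis fM : {morph f : x y / (x * y)%g}.
Local Open Scope group_scope.

Lemma morph_one : f 1 = 1.
Proof. by apply: (mulgI (f 1)); rewrite -fM !mulg1. Qed.

Lemma morph_inv x : f x^-1 = (f x)^-1.
Proof. by apply: (mulIg (f x)); rewrite -fM !mulVg morph_one. Qed.

End Morphisms.

Section Sym.
Variable T : Type.

(** Bijections under composition: the groups in which concrete actions of free groups and braid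
    groups take their values. *)
Record sym := MkSym { symf : T -> T ; symi : T -> T ;
  symfK : cancel symf symi ; symiK : cancel symi symf }.

HB.instance Definition _ := gen_eqMixin sym.
HB.instance Definition _ := gen_choiceMixin sym.

Lemma sym_ext (p q : sym) : symf p =1 symf q -> p = q.
Proof.
case: p q => [f f' fK f'K] [g g' gK g'K] /= /funext fg; subst g.
have e : f' = g' by apply/funext => x; apply: (can_inj fK); rewrite f'K g'K.
by subst g'; congr MkSym; exact: Prop_irrelevance.
Qed.

Definition sym1 := @MkSym id id (fun _ => erefl) (fun _ => erefl).
Definition symM (p q : sym) :=
  MkSym (can_comp (@symfK p) (@symfK q)) (can_comp (@symiK q) (@symiK p)).
Definition symV (p : sym) := MkSym (@symiK p) (@symfK p).

Lemma symA : associative symM.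
Proof. by move=> p q r; apply: sym_ext. Qed.
Lemma sym1m : left_id sym1 symM.
Proof. by move=> p; apply: sym_ext. Qed.
Lemma symm1 : right_id sym1 symM.
Proof. by move=> p; apply: sym_ext. Qed.
Lemma symVm : left_inverse sym1 symV symM.
Proof. by move=> p; apply: sym_ext => x /=; rewrite symfK. Qed.
Lemma symmV : right_inverse sym1 symV symM.
Proof. by move=> p; apply: sym_ext => x /=; rewrite symiK. Qed.

HB.instance Definition _ := isGroup.Build sym symA sym1m symm1 symVm symmV.

Lemma symfM (p q : sym) x : symf (p * q)%g x = symf p (symf q x).
Proof. by []. Qed.
Lemma symfVK (p : sym) x : symf p^-1%g (symf p x) = x.
Proof. exact: symfK. Qed.
End Sym.

Section FreeGroupHom.
Local Open Scope group_scope.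
Local Open Scope quotient_scope.
Variables (X : choiceType) (G : groupType) (h : X -> G).

Definition letter (a : X * bool) : G := if a.2 then h a.1 else (h a.1)^-1.
Definition word_hom (u : word X) : G := foldr (fun a r => letter a * r) 1 u.

Lemma word_hom_cat u v : word_hom (u ++ v) = word_hom u * word_hom v.
Proof. by elim: u => [|a u IH] /=; rewrite ?mul1g // IH mulgA. Qed.

Lemma word_hom_conv u v : free_conv u v -> word_hom u = word_hom v.
Proof.
elim=> {u v} [u v x b|//|u v _ ->//|u v z _ -> _ ->//].
rewrite !word_hom_cat /= /letter /=; congr (_ * _).
by case: b => /=; rewrite mulgA ?mulgV ?mulVg mul1g.
Qed.

Definition free_hom (x : free_group X) : G := word_hom (repr x).

Lemma free_homE u : free_hom (\pi_(free_group X) u) = word_hom u.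
Proof. exact/word_hom_conv/free_conv_repr. Qed.

Lemma free_hom_gen x : free_hom (fgen x) = h x.
Proof. by rewrite free_homE /= /letter /= mulg1. Qed.

Lemma free_homM : {morph free_hom : x y / x * y}.
Proof.
move=> x y; rewrite -[x]fg_reprK -[y]fg_reprK [X in free_hom X]fg_mulE !free_homE.
exact: word_hom_cat.
Qed.

End FreeGroupHom.

Lemma free_group_gen (X : choiceType) (P : free_group X -> Prop) : P 1%g ->
  (forall v w, P v -> P w -> P (v * w)%g) -> (forall v, P v -> P v^-1%g) ->
  (forall x, P (fgen x)) -> forall w, P w.
Proof.
move=> P1 PM PV Px w; rewrite -[w]fg_reprK; elim: (repr w) => [//|[x b] u IH].
rewrite (_ : (x, b) :: u = [:: (x, b)] ++ u) // -fg_mulE; apply: PM => //.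
case: b; first exact: Px.
rewrite (_ : \pi_(_)%qT _ = (fgen x)^-1%g); first exact/PV.
apply: (mulgI (fgen x)); rewrite mulgV [LHS]fg_mulE /=; apply: free_conv_pi.
exact: (@fc_cancel X [::] [::] x true).
Qed.

Section FreeOrd.
Variable n : nat.
Local Notation F := (free_group 'I_n).
Local Open Scope group_scope.

Definition xg (j : nat) : F := if insub j is Some k then fgen k else 1.

Lemma xgE (k : 'I_n) : fgen k = xg k.
Proof. by rewrite /xg valK. Qed.

Definition fext (G : groupType) (h : nat -> G) : F -> G := free_hom (fun k : 'I_n => h k).

Lemma fext_xg (G : groupType) (h : nat -> G) j : (j < n)%N -> fext h (xg j) = h j.
Proof. by move=> hj; rewrite -(xgE (Ordinal hj)) /fext free_hom_gen. Qed.

Lemma fextM (G : groupType) (h : nat -> G) : {morph fext h : x y / x * y}.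
Proof. exact: free_homM. Qed.

Lemma F_gen (P : F -> Prop) : P 1 ->
  (forall v w, P v -> P w -> P (v * w)) -> (forall v, P v -> P v^-1) ->
  (forall j, (j < n)%N -> P (xg j)) -> forall w, P w.
Proof. by move=> P1 PM PV Px; apply: free_group_gen => // k; rewrite xgE; exact: Px. Qed.

Lemma F_hom_ext (G : groupType) (f g : F -> G) :
  {morph f : x y / x * y} -> {morph g : x y / x * y} ->
  (forall j, (j < n)%N -> f (xg j) = g (xg j)) -> f =1 g.
Proof.
move=> fM gM e; apply: F_gen => // [|v w ev ew|v ev].
- by rewrite !(morph_one fM, morph_one gM).
- by rewrite fM gM ev ew.
- by rewrite !(morph_inv fM, morph_inv gM) ev.
Qed.

(** The formula of the statement, with both families of indices counted from 0. *)
Definition art_fun (k : nat) : F -> F := fext (fun j =>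
  if j == k then xg k.+1 else if j == k.+1 then (xg k.+1)^-1 * xg k * xg k.+1 else xg j).
Definition art_inv (k : nat) : F -> F := fext (fun j =>
  if j == k then xg k * xg k.+1 * (xg k)^-1 else if j == k.+1 then xg k else xg j).

Section OneGen.
Variable k : nat.
Hypothesis hk : (k.+1 < n)%N.
Let hk' : (k < n)%N := ltnW hk.

Lemma art_funM : {morph art_fun k : x y / x * y}. Proof. exact: fextM. Qed.
Lemma art_invM : {morph art_inv k : x y / x * y}. Proof. exact: fextM. Qed.

Lemma art_funl : art_fun k (xg k) = xg k.+1.
Proof. by rewrite /art_fun fext_xg // eqxx. Qed.
Lemma art_funr : art_fun k (xg k.+1) = (xg k.+1)^-1 * xg k * xg k.+1.
Proof. by rewrite /art_fun fext_xg // eqxx gtn_eqF. Qed.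
Lemma art_funD j : (j < n)%N -> j <> k -> j <> k.+1 -> art_fun k (xg j) = xg j.
Proof.
by move=> hj /eqP/negbTE jk /eqP/negbTE jk1; rewrite /art_fun fext_xg // jk jk1.
Qed.

Lemma art_invl : art_inv k (xg k) = xg k * xg k.+1 * (xg k)^-1.
Proof. by rewrite /art_inv fext_xg // eqxx. Qed.
Lemma art_invr : art_inv k (xg k.+1) = xg k.
Proof. by rewrite /art_inv fext_xg // eqxx gtn_eqF. Qed.
Lemma art_invD j : (j < n)%N -> j <> k -> j <> k.+1 -> art_inv k (xg j) = xg j.
Proof.
by move=> hj /eqP/negbTE jk /eqP/negbTE jk1; rewrite /art_inv fext_xg // jk jk1.
Qed.

Lemma art_funK : cancel (art_fun k) (art_inv k).
Proof.
apply: (F_hom_ext (f := art_inv k \o art_fun k) (g := id)) => [x y|//|j hj] /=.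
  by rewrite art_funM art_invM.
have [->|jk] := eqVneq j k; first by rewrite art_funl art_invr.
have [->|jk1] := eqVneq j k.+1.
  rewrite art_funr !art_invM (morph_inv art_invM) art_invl art_invr.
  by rewrite !mulgA mulVg mul1g mulgVK.
by rewrite art_funD ?art_invD //; apply/eqP.
Qed.

Lemma art_invK : cancel (art_inv k) (art_fun k).
Proof.
apply: (F_hom_ext (f := art_fun k \o art_inv k) (g := id)) => [x y|//|j hj] /=.
  by rewrite art_invM art_funM.
have [->|jk] := eqVneq j k.
  rewrite art_invl !art_funM (morph_inv art_funM) art_funl art_funr.
  by rewrite !mulgA mulgV mul1g mulgK.
have [->|jk1] := eqVneq j k.+1; first by rewrite art_invr art_funl.
by rewrite art_invD ?art_funD //; apply/eqP.
Qed.

End OneGen.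

Definition art (k : nat) : sym F :=
  if pselect (k.+1 < n)%N is left hk then MkSym (art_funK hk) (art_invK hk) else 1.

Lemma artE k : (k.+1 < n)%N -> symf (art k) = art_fun k.
Proof. by move=> hk; rewrite /art; case: pselect. Qed.

Lemma art_braid : braid_rel n art.
Proof.
have sM k : (k.+1 < n)%N -> {morph symf (art k) : x y / x * y}.
  by move=> hk x y; rewrite artE // art_funM.
split=> [j k jk hk|j hj]; apply: sym_ext.
  have hj : (j.+1 < n)%N by lia.
  apply: F_hom_ext => [x y|x y|i hi]; rewrite ?symfM ?artE //; try by rewrite !art_funM.
  have [->|ij] := eqVneq i j; first by rewrite !(art_funl, art_funD) //; lia.
  have [->|ij1] := eqVneq i j.+1.
    rewrite (@art_funD k) ?art_funr //; try lia.
    by rewrite !art_funM (morph_inv (@art_funM k)) !(@art_funD k) //; lia.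
  rewrite (@art_funD j i) //; try lia.
  have [->|ik] := eqVneq i k; first by rewrite !(art_funl hk) (@art_funD j) //; lia.
  have [->|ik1] := eqVneq i k.+1.
    by rewrite !(art_funr hk) !art_funM (morph_inv (@art_funM j)) !(@art_funD j) //; lia.
  by rewrite !art_funD //; lia.
have hj1 : (j.+1 < n)%N by lia.
have hj0 : (j < n)%N by lia.
have fM := art_funM; have fV k := morph_inv (@art_funM k).
have D2 : art_fun j (xg j.+2) = xg j.+2 by rewrite art_funD //; lia.
have D0 : art_fun j.+1 (xg j) = xg j by rewrite art_funD //; lia.
have l0 := art_funl hj1; have l1 := art_funl hj; have r0 := art_funr hj1; have r1 := art_funr hj.
apply: F_hom_ext => [x y|x y|i hi]; rewrite ?symfM ?artE //; try by rewrite !art_funM.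
have [->|ij] := eqVneq i j; first by rewrite l0 l1 D0 l0 l1 D2.
have [->|ij1] := eqVneq i j.+1.
  by rewrite r0 l1 D2 r1 !(fM, fV) l1 D0 l0 D2.
have [->|ij2] := eqVneq i j.+2.
  rewrite D2 r1 !(fM, fV) D2 r0 !(fM, fV) r1 l1 D0 !invMg !invgK !mulgA.
  by rewrite !mulgK.
by rewrite !art_funD //; lia.
Qed.

End FreeOrd.
Arguments xg {n}.
Arguments fext {n G}.

(** Artin's group up to isomorphism: generation gives induction, the last clause gives homomorphisms
    out of B. The values [s k] with [n <= k.+1] are left unconstrained. *)
Definition is_braid_group (n : nat) (B : groupType) (s : nat -> B) : Prop :=
  [/\ forall P : B -> Prop, P 1%g -> (forall x y, P x -> P y -> P (x * y)%g) ->
        (forall x, P x -> P x^-1%g) -> (forall k, (k.+1 < n)%N -> P (s k)) ->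
        forall b, P b,
      braid_rel n s &
      forall (G : groupType) (g : nat -> G), braid_rel n g ->
        exists2 f : B -> G, {morph f : x y / (x * y)%g} &
          forall k, (k.+1 < n)%N -> f (s k) = g k].

Section BraidGroup.
Local Open Scope nat_scope.
Variables (n : nat) (B : groupType) (s : nat -> B).
Hypothesis hB : is_braid_group n s.
Local Open Scope group_scope.
Local Notation F := (free_group 'I_n).

Lemma braid_gen (P : B -> Prop) : P 1 -> (forall x y, P x -> P y -> P (x * y)) ->
  (forall x, P x -> P x^-1) -> (forall k, (k.+1 < n)%N -> P (s k)) -> forall b, P b.
Proof. by case: hB => h _ _; exact: h. Qed.

(** For properties that are not closed under products, such as lying in a given union of cosets. *)
Lemma braid_gen_right (P : B -> Prop) : P 1 ->
  (forall k b, (k.+1 < n)%N -> P b -> P (b * s k) /\ P (b * (s k)^-1)) -> forall b, P b.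
Proof.
move=> P1 Ps b.
suff: forall c, P c -> P (c * b) /\ P (c * b^-1) by move=> /(_ _ P1)[+ _]; rewrite mul1g.
elim/braid_gen: b => [c|x y hx hy c Pc|x hx c /hx|k hk c Pc]; last exact: Ps.
- by rewrite invg1 mulg1.
- rewrite invMg !mulgA; split; first by have [/hy[]] := hx _ Pc.
  by have [_ /hx[]] := hy _ Pc.
- by rewrite invgK => -[].
Qed.

Lemma artin_ex : exists f : B -> sym F,
  {morph f : x y / x * y} /\ forall k, (k.+1 < n)%N -> f (s k) = art n k.
Proof. by case: hB => _ _ /(_ _ _ (art_braid n))[f fM fE]; exists f. Qed.

Definition artin : B -> sym F := sval (cid artin_ex).

Lemma artinM : {morph artin : x y / x * y}.
Proof. exact: (svalP (cid artin_ex)).1. Qed.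
Lemma artinE k : (k.+1 < n)%N -> artin (s k) = art n k.
Proof. exact: (svalP (cid artin_ex)).2. Qed.

Definition bact (b : B) : F -> F := symf (artin b).

Lemma bact1 v : bact 1 v = v.
Proof. by rewrite /bact (morph_one artinM). Qed.
Lemma bactM b c v : bact (b * c) v = bact b (bact c v).
Proof. by rewrite /bact artinM. Qed.
Lemma bactVK b v : bact b^-1 (bact b v) = v.
Proof. by rewrite -bactM mulVg bact1. Qed.
Lemma bactKV b v : bact b (bact b^-1 v) = v.
Proof. by rewrite -bactM mulgV bact1. Qed.
Lemma act_gen k : (k.+1 < n)%N -> bact (s k) =1 art_fun k.
Proof. by move=> hk v; rewrite /bact artinE // artE. Qed.

Lemma act_morph b : {morph bact b : x y / x * y}.
Proof.
elim/braid_gen: b => [x y|b c hb hc x y|b hb x y|k hk x y].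
- by rewrite !bact1.
- by rewrite !bactM hc hb.
- by apply: (can_inj (bactVK b)); rewrite hb !bactKV.
- by rewrite !act_gen // art_funM.
Qed.

Lemma act_inv b v : bact b v^-1 = (bact b v)^-1.
Proof. exact: morph_inv (@act_morph b) v. Qed.

Definition artin_gaction : gaction B F := GAction act_morph bact1 bactM.

Definition artin_faithful := forall b, (forall v, bact b v = v) -> b = 1.

Lemma perm_ex : exists f : B -> 'S_n,
  {morph f : x y / x * y} /\ forall k, (k.+1 < n)%N -> f (s k) = adj k.
Proof. by case: hB => _ _ /(_ _ _ (adj_braid n))[f fM fE]; exists f. Qed.

Definition bperm : B -> 'S_n := sval (cid perm_ex).

Lemma bpermM : {morph bperm : x y / x * y}.
Proof. exact: (svalP (cid perm_ex)).1. Qed.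
Lemma bpermE k : (k.+1 < n)%N -> bperm (s k) = adj k.
Proof. exact: (svalP (cid perm_ex)).2. Qed.

(** A braid permutes the conjugacy classes of the free generators as it permutes the strands, so the
    action determines the strand permutation. *)
Lemma act_conj b j : (j < n)%N ->
  exists u, bact b (xg j) = u^-1 * xg (ap (bperm b)^-1 j) * u.
Proof.
elim/braid_gen: b j => [j hj|b c hb hc j hj|b hb j hj|k hk j hj].
- by exists 1; rewrite bact1 (morph_one bpermM) !invg1 mulg1 mul1g ap1.
- have [u uE] := hc _ hj; have [|v vE] := hb (ap (bperm c)^-1 j); first exact: ap_lt.
  exists (v * bact b u); rewrite bactM uE !act_morph act_inv vE bpermM !invMg apM.
  by rewrite !mulgA.
- have [|u uE] := hb (ap (bperm b) j); first exact: ap_lt.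
  exists (bact b^-1 u)^-1.
  have : bact b^-1 (bact b (xg (ap (bperm b) j))) = bact b^-1 (u^-1 * xg j * u).
    by rewrite uE apK.
  rewrite bactVK !act_morph act_inv (morph_inv bpermM) !invgK => ->.
  by rewrite !mulgA mulgV mul1g mulgK.
rewrite act_gen // bpermE // adjV ap_adj //.
have [->|jk] := eqVneq j k; first by exists 1; rewrite art_funl // invg1 mulg1 mul1g.
have [->|jk1] := eqVneq j k.+1; first by exists (xg k.+1); rewrite art_funr.
by exists 1; rewrite art_funD // ?invg1 ?mulg1 ?mul1g //; apply/eqP.
Qed.

End BraidGroup.

(** * Adding a strand: from faithfulness on n strands to n + 1 *)

Section PunctureStep.
Local Open Scope nat_scope.
Variables (n : nat) (B B' : groupType) (s : nat -> B) (s' : nat -> B').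
Hypothesis hB : is_braid_group n s.
Hypothesis hB' : is_braid_group n.+1 s'.
Local Open Scope group_scope.
Local Notation F := (free_group 'I_n).
Local Notation F' := (free_group 'I_n.+1).
Local Notation bact' := (bact hB').
Local Notation bact := (bact hB).

Lemma braid' : braid_rel n.+1 s'. Proof. by case: hB'. Qed.

Lemma shift_braid : braid_rel n (fun k => s' k.+1).
Proof.
by have [h1 h2] := braid'; split=> [j k jk hk|j hj]; [apply: h1|apply: h2].
Qed.

Lemma shift_ex : exists f : B -> B',
  {morph f : x y / x * y} /\ forall k, (k.+1 < n)%N -> f (s k) = s' k.+1.
Proof. by case: hB => _ _ /(_ _ _ shift_braid)[f fM fE]; exists f. Qed.

Definition shift : B -> B' := sval (cid shift_ex).
Lemma shiftM : {morph shift : x y / x * y}.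
Proof. exact: (svalP (cid shift_ex)).1. Qed.
Lemma shiftE k : (k.+1 < n)%N -> shift (s k) = s' k.+1.
Proof. exact: (svalP (cid shift_ex)).2. Qed.

(* The pure braid in which strand j.+1 goes once round strand 0. *)
Fixpoint around (j : nat) : B' :=
  if j is i.+1 then s' j * around i * (s' j)^-1 else s' 0 * s' 0.

Lemma far j k : (j.+1 < k)%N -> (k < n)%N -> s' j * s' k = s' k * s' j.
Proof. by move=> jk kn; apply: braid'.1. Qed.
Lemma near3 j : (j.+1 < n)%N -> s' j * s' j.+1 * s' j = s' j.+1 * s' j * s' j.+1.
Proof. by move=> jn; apply: braid'.2. Qed.

Lemma conj_comm (G : groupType) (x y z : G) :
  x * y = y * x -> x * z = z * x -> x * (y * z * y^-1) = y * z * y^-1 * x.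
Proof.
move=> xy xz; have xV : x * y^-1 = y^-1 * x.
  by apply: (mulgI y); rewrite !mulgA -xy mulgV mul1g mulgK.
by rewrite -[RHS]mulgA -xV !mulgA xy -!mulgA [x * (z * _)]mulgA xz !mulgA.
Qed.

Lemma conj_intertwine (G : groupType) (b u d a : G) : b * u = u * d -> d * a = a * d ->
  b * (u * a * u^-1) = u * a * u^-1 * b.
Proof.
move=> bu da; have uV : d * u^-1 = u^-1 * b.
  by apply: (mulgI u); rewrite mulgA -bu mulgK mulVKg.
by rewrite -[RHS]mulgA -uV !mulgA bu -!(mulgA u) da.
Qed.

(** The braid relation turns b into d when b crosses d * b, and d commutes with a. *)
Lemma conj_near (G : groupType) (b d a : G) : b * d * b = d * b * d -> d * a = a * d ->
  b * (d * (b * a * b^-1) * d^-1) = d * (b * a * b^-1) * d^-1 * b.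
Proof.
move=> bd da.
have -> : d * (b * a * b^-1) * d^-1 = (d * b) * a * (d * b)^-1 by rewrite invMg !mulgA.
by apply: conj_intertwine da; rewrite mulgA.
Qed.

(* Both sides are the full twist of the three strands. *)
Lemma square_typeB (G : groupType) (a b : G) : a * b * a = b * a * b ->
  b * (a * a) * b * (a * a) = a * a * b * (a * a) * b.
Proof.
move=> ab; transitivity (b * a * b * (a * b * a)).
  transitivity (b * a * (a * b * a) * a); first by rewrite !mulgA.
  by rewrite {1}ab !mulgA.
transitivity (a * (a * b * a) * a * b); last by rewrite !mulgA.
transitivity (a * b * a * (b * a * b)); first by rewrite -ab.
by rewrite {2}ab !mulgA.
Qed.

(** Conjugation by t * u carries the pair (t, a) to (u, a'), and the relation with it. *)
Lemma conj_typeB (G : groupType) (t u a : G) : t * u * t = u * t * u -> u * a = a * u ->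
  t * a * t * a = a * t * a * t ->
  let a' := t * a * t^-1 in u * a' * u * a' = a' * u * a' * u.
Proof.
move=> tu ua ta a'.
have wt : t * u * t * (t * u)^-1 = u by rewrite tu invMg !mulgA mulgK mulgK.
have wa : t * u * a * (t * u)^-1 = a' by rewrite invMg !mulgA -(mulgA t) ua !mulgA mulgK.
have W w x y : w * x * w^-1 * (w * y * w^-1) = w * (x * y) * w^-1 :> G.
  by rewrite !mulgA mulgVK.
by rewrite -wt -wa !W ta.
Qed.

(* The relations of the Artin representation from [t a t a = a t a t]. *)
Lemma typeB_conj (G : groupType) (t a : G) : t * a * t * a = a * t * a * t ->
  let a' := t * a * t^-1 in t * a' * t^-1 = a'^-1 * a * a'.
Proof.
move=> ta a'; apply: (mulgI a'); rewrite -(mulgA a'^-1) mulVKg.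
by rewrite /a' !mulgA mulgVK ta mulgK.
Qed.

Lemma around_far k j : (j.+1 < k)%N -> (k < n)%N ->
  s' k * around j = around j * s' k.
Proof.
elim: j => [|j IH] jk kn /=; first by rewrite mulgA -(far jk kn) -mulgA -(far jk kn) mulgA.
by apply: conj_comm; [apply/esym; apply: far|apply: IH]; lia.
Qed.

Lemma around_near k j : (0 < k < j)%N -> (j < n)%N ->
  s' k * around j = around j * s' k.
Proof.
elim: j => [|j IH] kj jn; first lia.
have [kj'|kj'] := ltnP k j.
  by rewrite /=; apply: conj_comm; [apply: far|apply: IH]; lia.
have jk : j = k by lia.
subst j; case: k IH kj kj' jn => [|k] _ kj _ jn; first lia.
by apply: conj_near; [apply: near3; lia|apply: around_far; lia].
Qed.

(** Through [typeB_conj] this relation is the Artin formula for the generator k.+1, the only case of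
    [shift_push] that is not a commutation or a definition. *)
Lemma around_typeB k : (k.+1 < n)%N ->
  s' k.+1 * around k * s' k.+1 * around k = around k * s' k.+1 * around k * s' k.+1.
Proof.
elim: k => [|k IH] kn; first by apply: square_typeB; apply: near3.
apply: conj_typeB; [by apply: near3|by apply: around_far; lia|by apply: IH; lia].
Qed.

Definition push : F -> B' := fext around.

Lemma pushM : {morph push : x y / x * y}. Proof. exact: fextM. Qed.
Lemma pushE j : (j < n)%N -> push (xg j) = around j. Proof. exact: fext_xg. Qed.

Lemma comm_conj (G : groupType) (x y : G) : x * y = y * x -> x * y * x^-1 = y.
Proof. by move=> ->; rewrite mulgK. Qed.

(** This is what makes [push] and [shift] combine into a homomorphism from the semidirect product,
    see [mixedM]. *)
Lemma shift_push b w : shift b * push w * (shift b)^-1 = push (bact b w).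
Proof.
elim/(braid_gen hB): b w => [w|b c hb hc w|b hb w|k hk w].
- by rewrite bact1 (morph_one shiftM) invg1 mulg1 mul1g.
- by rewrite shiftM invMg bactM -hb -hc !mulgA.
- rewrite (morph_inv shiftM) invgK -{1}(bactKV hB b w) -hb.
  by rewrite !mulgA mulVg mul1g mulgVK.
rewrite act_gen // shiftE //.
have cM : {morph (fun w => s' k.+1 * push w * (s' k.+1)^-1) : x y / x * y}.
  by move=> x y /=; rewrite pushM !mulgA mulgVK.
apply: (F_hom_ext (g := fun w => push (art_fun k w)) cM) => [x y|j hj]; first by rewrite art_funM pushM.
rewrite pushE //.
have [jk|jk] := eqVneq j k; first by rewrite jk art_funl ?pushE //; lia.
have [jk1|jk1] := eqVneq j k.+1.
  rewrite jk1 art_funr // !pushM (morph_inv pushM) !pushE; try lia.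
  by apply: typeB_conj; apply: around_typeB.
rewrite art_funD ?pushE //; try exact/eqP.
apply: comm_conj; case: (ltnP j k) => h; first by apply: around_far; lia.
by apply: around_near; lia.
Qed.

Definition mixed (w : F) (b : B) : B' := push w * shift b.

Lemma mixedM v b w c : mixed v b * mixed w c = mixed (v * bact b w) (b * c).
Proof. by rewrite /mixed pushM -shift_push shiftM !mulgA mulgVK. Qed.

Lemma mixed1 : mixed 1 1 = 1.
Proof. by rewrite /mixed (morph_one pushM) (morph_one shiftM) mulg1. Qed.

Definition is_mixed (x : B') := exists v b, x = mixed v b.

Lemma is_mixed1 : is_mixed 1. Proof. by exists 1, 1; rewrite mixed1. Qed.
Lemma is_mixedM x y : is_mixed x -> is_mixed y -> is_mixed (x * y).
Proof.
by move=> [v [b ->]] [w [c ->]]; rewrite mixedM; exists (v * bact b w), (b * c).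
Qed.
Lemma is_mixedV x : is_mixed x -> is_mixed x^-1.
Proof.
move=> [v [b ->]]; exists (bact b^-1 v^-1), b^-1.
apply: (mulIg (mixed v b)); rewrite mulVg mixedM -act_morph mulVg mulVg.
by rewrite (morph_one (@act_morph _ _ _ hB b^-1)) mixed1.
Qed.
Lemma is_mixed_push w : is_mixed (push w).
Proof. by exists w, 1; rewrite /mixed (morph_one shiftM) mulg1. Qed.
Lemma is_mixed_gen k : (k.+1 < n)%N -> is_mixed (s' k.+1).
Proof. by move=> hk; exists 1, (s k); rewrite /mixed (morph_one pushM) mul1g shiftE. Qed.

(* Right coset representatives for the stabilizer of strand 0. *)
Fixpoint coset_rep (j : nat) : B' := if j is i.+1 then coset_rep i * s' i else 1.

Lemma coset_rep_far j k : (j < k)%N -> (k < n)%N -> coset_rep j * s' k = s' k * coset_rep j.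
Proof.
elim: j => [|j IH] jk kn /=; first by rewrite mul1g mulg1.
by rewrite mulgA -IH ?(ltnW jk) // -!mulgA far.
Qed.

Lemma coset_rep_near j k : (k.+1 < j)%N -> (j <= n)%N ->
  coset_rep j * s' k = s' k.+1 * coset_rep j.
Proof.
elim: j => [//|j IH] kj jn /=; move: kj; rewrite ltnS leq_eqVlt => /orP[/eqP kj|kj].
  rewrite -kj /= -!mulgA (mulgA (s' k)) near3; last lia.
  by rewrite -!mulgA mulgA coset_rep_far ?mulgA //; lia.
by rewrite mulgA -IH ?(ltnW jn) // -!mulgA (far kj jn).
Qed.

(** Apart from the commuting r, this is the form [t * u^2 * t^-1 = u^-1 * t^2 * u] of the braid
    relation. *)
Lemma square_conj (G : groupType) (r t u : G) : t * u * t = u * t * u -> r * u = u * r ->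
  r * t * (u * u) * (r * t)^-1 = u^-1 * (r * (t * t) * r^-1) * u.
Proof.
move=> tu ru; apply: (mulgI u); apply: (mulIg (r * t)).
transitivity (r * t * t * u * t).
  rewrite -(mulgA u) mulgVK !mulgA -ru -(mulgA r u) -(mulgA r (u * t)) -tu !mulgA.
  by rewrite -(mulgA (r * t) u) -(mulgA (r * t) (u * t)) -tu !mulgA.
by rewrite !mulgA mulgV mul1g -(mulgA _ u r) -ru !mulgA mulgVK.
Qed.

(** The Schreier generators that are not visibly in the subgroup: strand 0 is brought to place k,
    goes once round the next strand, and returns. *)
Lemma is_mixed_square k : (k < n)%N ->
  is_mixed (coset_rep k * (s' k * s' k) * (coset_rep k)^-1).
Proof.
elim: k => [|k IH] kn /=.
  by rewrite invg1 mulg1 mul1g -[s' 0 * s' 0]/(around 0) -pushE //; exact: is_mixed_push.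
rewrite (square_conj (near3 kn)); last by apply: coset_rep_far.
apply: is_mixedM; last exact: is_mixed_gen.
by apply: is_mixedM; [apply/is_mixedV/is_mixed_gen|apply: IH; apply: ltnW].
Qed.

(** Schreier's argument. Right multiplication by [s' k] exchanges the cosets of [coset_rep k] and
    [coset_rep k.+1] and preserves the others, so the cosets with j <= n cover the group. *)
Lemma cosets b : exists2 j, (j <= n)%N & is_mixed (b * (coset_rep j)^-1).
Proof.
elim/(braid_gen_right hB'): b => [|k b kn [j jn mj]].
  by exists 0%N => //; rewrite mulgV; exact: is_mixed1.
rewrite ltnS in kn.
have [jk|kj|jk] := ltngtP j k.
- have c : s' k * (coset_rep j)^-1 = (coset_rep j)^-1 * s' k.
    by apply: (mulgI (coset_rep j)); rewrite mulgA coset_rep_far // mulgK mulKVg.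
  have cV : (s' k)^-1 * (coset_rep j)^-1 = (coset_rep j)^-1 * (s' k)^-1.
    by rewrite -!invMg coset_rep_far.
  have mk : is_mixed (s' k) by case: k jk kn {c cV} => // k _ kn; exact: is_mixed_gen.
  split; exists j => //; rewrite -mulgA ?c ?cV mulgA; apply: is_mixedM => //.
  exact: is_mixedV.
- have [kj'|jk] := ltnP k.+1 j.
    have mk : is_mixed (s' k.+1) by apply: is_mixed_gen; lia.
    have c := coset_rep_near kj' jn.
    have e : s' k * (coset_rep j)^-1 = (coset_rep j)^-1 * s' k.+1.
      by apply: (mulgI (coset_rep j)); rewrite mulgA c mulgK mulKVg.
    have eV : (s' k)^-1 * (coset_rep j)^-1 = (coset_rep j)^-1 * (s' k.+1)^-1.
      by rewrite -!invMg c.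
    split; exists j => //; rewrite -mulgA ?e ?eV mulgA; apply: is_mixedM => //.
    exact: is_mixedV.
  have {kj jk} jk : j = k.+1 by lia.
  subst j; split; exists k; try exact: ltnW.
    rewrite (_ : b * s' k * (coset_rep k)^-1 = b * (coset_rep k.+1)^-1 *
        (coset_rep k * (s' k * s' k) * (coset_rep k)^-1)).
      by apply: is_mixedM => //; exact: is_mixed_square.
    by rewrite /= invMg !mulgA mulgVK mulgVK.
  by move: mj; rewrite /= invMg mulgA.
subst j; split; exists k.+1 => //.
  by rewrite /= invMg !mulgA mulgK.
rewrite (_ : b * (s' k)^-1 * (coset_rep k.+1)^-1 = b * (coset_rep k)^-1 *
    (coset_rep k * (s' k * s' k) * (coset_rep k)^-1)^-1).
  by apply: is_mixedM => //; apply: is_mixedV; exact: is_mixed_square.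
by rewrite /= !invMg !invgK !mulgA mulgVK.
Qed.

Local Notation perm := (bperm hB').

Lemma perm_around j : (j < n)%N -> perm (around j) = 1.
Proof.
elim: j => [|j IH] hj /=; first by rewrite bpermM bpermE // adj2.
by rewrite !bpermM (morph_inv (@bpermM _ _ _ hB')) IH ?mulg1 ?mulgV //; apply: ltnW.
Qed.

Lemma perm_push w : perm (push w) = 1.
Proof.
move: w; apply: F_gen => [|v w hv hw|v hv|j hj].
- by rewrite (morph_one pushM) (morph_one (@bpermM _ _ _ hB')).
- by rewrite pushM bpermM hv hw mulg1.
- by rewrite (morph_inv pushM) (morph_inv (@bpermM _ _ _ hB')) hv invg1.
- by rewrite pushE // perm_around.
Qed.

Lemma perm_shift b : ap (perm (shift b)) 0 = 0.
Proof.
elim/(braid_gen hB): b => [|b c hb hc|b hb|k hk].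
- by rewrite (morph_one shiftM) (morph_one (@bpermM _ _ _ hB')) ap1.
- by rewrite shiftM bpermM apM hb hc.
- by rewrite (morph_inv shiftM) (morph_inv (@bpermM _ _ _ hB')) -{1}hb apK.
- by rewrite shiftE // bpermE // ap_adjD //; lia.
Qed.

Lemma perm_coset_rep j : (j <= n)%N -> ap (perm (coset_rep j)) 0 = j.
Proof.
elim: j => [|j IH] hj /=; first by rewrite (morph_one (@bpermM _ _ _ hB')) ap1.
by rewrite bpermM apM IH ?(ltnW hj) // bpermE // ap_adjl.
Qed.

(** The coset representatives send strand 0 to distinct places, so only the trivial coset fixes
    it. *)
Lemma is_mixedP b : is_mixed b <-> ap (perm b) 0 = 0.
Proof.
split=> [[v [c ->]]|b0].
  by rewrite /mixed bpermM perm_push mul1g perm_shift.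
have [j hj mj] := cosets b.
suff j0 : j = 0 by subst j; move: mj; rewrite /= invg1 mulg1.
move: mj => [v [c e]].
have : b = mixed v c * coset_rep j by rewrite -e mulgVK.
move=> eb; move: b0; rewrite eb /mixed !bpermM perm_push mul1g apM perm_shift.
by rewrite perm_coset_rep.
Qed.

(** Geometrically, the puncture of strand 0 is filled in. Along this map the action of [shift b]
    descends to that of b, and the action of [push w] becomes trivial. *)
Definition forget : F' -> F := fext (fun j => if j is i.+1 then xg i else 1).

Lemma forgetM : {morph forget : x y / x * y}. Proof. exact: fextM. Qed.
Lemma forget0 : forget (xg 0) = 1. Proof. by rewrite /forget fext_xg. Qed.
Lemma forgetS j : (j < n)%N -> forget (xg j.+1) = xg j.
Proof. by move=> hj; rewrite /forget fext_xg. Qed.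

Lemma forget_shift b v : forget (bact' (shift b) v) = bact b (forget v).
Proof.
elim/(braid_gen hB): b v => [v|b c hb hc v|b hb v|k hk v].
- by rewrite (morph_one shiftM) !bact1.
- by rewrite shiftM !bactM hb hc.
- by rewrite -[LHS](bactVK hB b) -hb (morph_inv shiftM) bactKV.
rewrite shiftE // !act_gen //.
have M1 : {morph (fun v => forget (art_fun k.+1 v)) : x y / x * y}.
  by move=> x y /=; rewrite art_funM forgetM.
apply: (F_hom_ext (g := fun v => art_fun k (forget v)) M1) => [x y|[|j] hj] /=; first by rewrite forgetM art_funM.
  by rewrite art_funD // forget0 (morph_one (@art_funM _ _)).
have [->|jk] := eqVneq j k; first by rewrite art_funl // !forgetS ?art_funl //; lia.
have [->|jk1] := eqVneq j k.+1.
  rewrite art_funr // !forgetM (morph_inv forgetM) !forgetS //; try lia.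
  by rewrite art_funr.
by rewrite art_funD ?forgetS ?art_funD //; lia.
Qed.

Lemma act_around j : (j < n)%N ->
  [/\ forall v, forget (bact' (around j) v) = forget v &
    bact' (around j) (xg 0) = (xg j.+1)^-1 * xg 0 * xg j.+1].
Proof.
elim: j => [|j IH] hj /=.
  split=> [v|]; rewrite bactM !act_gen //; last by rewrite art_funl // art_funr.
  move: v.
  have M1 : {morph (fun v => forget (art_fun 0 (art_fun 0 v))) : x y / x * y}.
    by move=> x y /=; rewrite !art_funM forgetM.
  apply: (F_hom_ext M1 forgetM) => -[|[|i]] hi /=.
  - by rewrite art_funl // art_funr // !forgetM forget0 mulg1 (morph_inv forgetM) mulVg.
  - rewrite art_funr // !art_funM (morph_inv (@art_funM _ _)) art_funl // art_funr //.
    by rewrite !forgetM !(morph_inv forgetM) !forgetM !(morph_inv forgetM) forget0 !mulg1 !mulVg invg1 mul1g mulg1.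
  - by rewrite !art_funD.
have {IH} [h1 h2] := IH (ltnW hj).
have e : s' j.+1 = shift (s j) by rewrite shiftE.
split=> [v|].
  rewrite !bactM e forget_shift h1 -(morph_inv shiftM) forget_shift.
  by rewrite bactKV.
have f0 : bact' (s' j.+1)^-1 (xg 0) = xg 0.
  by rewrite -{2}(bactVK hB' (s' j.+1) (xg 0)) act_gen // art_funD.
rewrite !bactM f0 h2 !act_morph act_inv !act_gen //.
by rewrite (@art_funD _ j.+1 0) // art_funl.
Qed.

Lemma forget_push w v : forget (bact' (push w) v) = forget v.
Proof.
move: w v; apply: F_gen => [v|w u hw hu v|w hw v|j hj v].
- by rewrite (morph_one pushM) bact1.
- by rewrite pushM bactM hw hu.
- by rewrite -hw (morph_inv pushM) bactKV.
- by rewrite pushE //; have [+ _] := act_around hj; apply.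
Qed.

(** The conjugator V is determined up to the centralizer of [xg 0]; this is how w is recovered from
    the action of [push w]. *)
Lemma act_push w : exists2 V, bact' (push w) (xg 0) = V^-1 * xg 0 * V & forget V = w.
Proof.
move: w; apply: F_gen => [|v w [V hV fV] [W hW fW]|v [V hV fV]|j hj].
- by exists 1; rewrite ?(morph_one forgetM) // (morph_one pushM) bact1 invg1 mulg1 mul1g.
- exists (V * bact' (push v) W); last by rewrite forgetM forget_push fV fW.
  by rewrite pushM bactM hW !act_morph act_inv hV invMg !mulgA.
- have e := congr1 (bact' (push v)^-1) hV.
  exists (bact' (push v)^-1 V)^-1.
    move: e; rewrite bactVK !act_morph act_inv (morph_inv pushM) invgK => e.
    by rewrite [in RHS]e !mulgA mulgV mul1g mulgK.
  by rewrite (morph_inv forgetM) -(morph_inv pushM) forget_push fV.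
- exists (xg j.+1); last by rewrite forgetS.
  by rewrite pushE //; have [] := act_around hj.
Qed.

Lemma togK : involutive (fun p : F * bool => (p.1, p.2 (+) (p.1 == 1))).
Proof. by move=> [v c] /=; rewrite -addbA addbb addbF. Qed.
Definition tog : sym (F * bool) := MkSym togK togK.

Lemma transl_subproof (w : F) :
  cancel (fun p : F * bool => (w * p.1, p.2)) (fun p : F * bool => (w^-1 * p.1, p.2)).
Proof. by move=> [v c] /=; rewrite mulKg. Qed.
Lemma translV_subproof (w : F) :
  cancel (fun p : F * bool => (w^-1 * p.1, p.2)) (fun p : F * bool => (w * p.1, p.2)).
Proof. by move=> [v c] /=; rewrite mulKVg. Qed.
Definition transl (w : F) : sym (F * bool) := MkSym (transl_subproof w) (translV_subproof w).

(* An action of F' on F * bool in which the generator 0 flips the second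
   coordinate over 1 only; it is a quotient of the lamplighter group over F. *)
Definition lamp : F' -> sym (F * bool) :=
  fext (fun j => if j is i.+1 then transl (xg i) else tog).

Lemma lampE V : exists f : F -> bool, forall v c,
  symf (lamp V) (v, c) = (forget V * v, c (+) f v).
Proof.
have lM : {morph lamp : x y / x * y} by exact: fextM.
move: V; apply: F_gen => [|V W [f hf] [g hg]|V [f hf]|[|j] hj].
- by exists (fun=> false) => v c; rewrite (morph_one lM) (morph_one forgetM) mul1g addbF.
- exists (fun v => g v (+) f (forget W * v)) => v c.
  by rewrite lM symfM hg hf forgetM mulgA addbA.
- exists (fun v => f (forget V^-1 * v)) => v c.
  have -> : (v, c) = symf (lamp V) (forget V^-1 * v, c (+) f (forget V^-1 * v)).
    by rewrite hf (morph_inv forgetM) mulKVg -addbA addbb addbF.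
  by rewrite (morph_inv lM) symfVK.
- by exists (fun v => v == 1) => v c; rewrite /lamp fext_xg //= forget0 mul1g.
- by exists (fun=> false) => v c; rewrite /lamp fext_xg //= forgetS // addbF.
Qed.

(** Both sides are compared at (1, false) in the lamp action. In V * xg 0 the flip takes place over
    1, in xg 0 * V it would take place over [forget V], and it only occurs over 1. *)
Lemma commute_xg0 V : V * xg 0 = xg 0 * V -> forget V = 1.
Proof.
move=> /(congr1 lamp); have lM : {morph lamp : x y / x * y} by exact: fextM.
rewrite !lM => /(congr1 (fun p => symf p (1, false))); rewrite !symfM.
have [f hf] := lampE V; rewrite hf.
have -> : lamp (xg 0) = tog by rewrite /lamp fext_xg.
by rewrite /= eqxx hf !mulg1 => -[]; case: eqP => //; case: (f 1).
Qed.

(** A homomorphism to the group of order two that is nontrivial on [xg 0] alone separates it from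
    the conjugates of the other generators. *)
Lemma flipper j : (0 < j)%N -> (j < n.+1)%N -> forall u : F', xg 0 <> u^-1 * xg j * u.
Proof.
move=> j0 jn u e.
pose h i : sym bool := if i is i'.+1 then 1 else MkSym negbK negbK.
have hM : {morph fext h : x y / (x : F') * y >-> x * y} by exact: fextM.
have := congr1 (fext h) e; rewrite !hM (morph_inv (@fextM _ _ h)) !fext_xg //.
case: j j0 jn {e} => // j _ _ /=; rewrite mulg1 mulVg => /(congr1 (fun p => symf p true)).
by [].
Qed.

Hypothesis faithful : artin_faithful hB.

(** Under [forget] the action becomes that of b, so b = 1 by faithfulness. Then [push w] fixes
    [xg 0], and its conjugator V commutes with [xg 0]. *)
Lemma mixed_trivial w b : (forall v, bact' (mixed w b) v = v) -> w = 1 /\ b = 1.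
Proof.
move=> triv; have b1 : b = 1.
  apply: faithful => v.
  have [v' ->] : exists v', v = forget v'.
    move: v; apply: F_gen => [|_ _ [v ->] [w' ->]|_ [v ->]|j hj].
    - by exists 1; rewrite (morph_one forgetM).
    - by exists (v * w'); rewrite forgetM.
    - by exists v^-1; rewrite (morph_inv forgetM).
    - by exists (xg j.+1); rewrite forgetS.
  by rewrite -forget_shift -(forget_push w) -bactM triv.
split=> //; have [V hV <-] := act_push w.
apply: commute_xg0; have := triv (xg 0).
rewrite b1 /mixed (morph_one shiftM) mulg1 hV => e.
by rewrite -[in LHS]e !mulgA mulgV mul1g.
Qed.

Lemma mixed_inj v b w c : mixed v b = mixed w c -> v = w /\ b = c.
Proof.
move=> e; have [x [d hx]] : is_mixed (mixed w c)^-1 by apply: is_mixedV; exists w, c.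
have : mixed v b * (mixed w c)^-1 = 1 by rewrite e mulgV.
have : mixed w c * (mixed w c)^-1 = 1 by rewrite mulgV.
rewrite hx !mixedM => e1 e2.
have [|vx bd] := @mixed_trivial (v * bact b x) (b * d); first by move=> u; rewrite e2 bact1.
have [|wx cd] := @mixed_trivial (w * bact c x) (c * d); first by move=> u; rewrite e1 bact1.
have bc : b = c by apply: (mulIg d); rewrite bd cd.
by split=> //; subst c; apply: (mulIg (bact b x)); rewrite vx wx.
Qed.

Lemma artin_faithfulS : artin_faithful hB'.
Proof.
move=> b triv.
have b0 : ap (perm b) 0 = 0.
  have [u] := act_conj hB' b (ltn0Sn n); rewrite triv => e.
  have [j0|j0] := posnP (ap (perm b)^-1 0); first by rewrite -{1}j0 apKV.
  by exfalso; apply: flipper e => //; exact: ap_lt.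
have [w [c bE]] := (is_mixedP b).2 b0.
have [|w1 c1] := @mixed_trivial w c; first by rewrite -bE.
by rewrite bE w1 c1 mixed1.
Qed.

End PunctureStep.

(** * Commutator subgroups *)

(** The existence hypothesis supplies the group with one strand less; [braid_group_ex] discharges it
    topologically. *)
Lemma artin_faithful_all :
  (forall n, exists (B : groupType) (s : nat -> B), is_braid_group n s) ->
  forall n (B : groupType) (s : nat -> B) (hB : is_braid_group n s), artin_faithful hB.
Proof.
move=> ex; elim=> [|n IH] B s hB.
  by move=> b _; elim/(braid_gen hB): b => // [x y -> ->|x ->]; rewrite ?mulg1 ?invg1.
by have [B0 [s0 hB0]] := ex n; apply: (artin_faithfulS (IH _ _ hB0)).
Qed.

Section GammaTwo.
Local Open Scope group_scope.

Lemma gen_subgroup_ind (G : groupType) (A : set G) (P : G -> Prop) :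
  P 1 -> (forall x y, P x -> P y -> P (x * y)) -> (forall x, P x -> P x^-1) ->
  (forall x, A x -> P x) -> forall x, x \in gen_subgroup A -> P x.
Proof.
move=> P1 PM PV PA x /set_mem; apply: (_ : smallest _ _ `<=` P).
apply: smallest_sub => //; split; first exact/mem_set.
by move=> u v /set_mem uP /set_mem vP; apply/mem_set; apply: PM => //; exact: PV.
Qed.

Lemma sub_gen_subgroup (G : groupType) (A : set G) x : A x -> x \in gen_subgroup A.
Proof. by move=> Ax; apply/mem_set => S [_]; exact. Qed.

Lemma Gamma2_comm (G : groupType) (x y : G) : commg x y \in Gamma2 G.
Proof. by apply: sub_gen_subgroup; exists x, y. Qed.

Lemma Gamma2_conj (G : groupType) (x y : G) : y * x * y^-1 * x^-1 \in Gamma2 G.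
Proof.
have := Gamma2_comm y^-1 x^-1.
by rewrite /commg /conjg !invgK !mulgA.
Qed.

Lemma Gamma2_normal (G : groupType) (x y : G) : x \in Gamma2 G -> y * x * y^-1 \in Gamma2 G.
Proof. by move=> hx; rewrite -(mulgVK x (y * x * y^-1)) gpredM // Gamma2_conj. Qed.

Lemma Gamma2_morph (G H : groupType) (f : G -> H) :
  {morph f : x y / x * y} -> forall x, x \in Gamma2 G -> f x \in Gamma2 H.
Proof.
move=> fM; apply: gen_subgroup_ind => [|x y hx hy|x hx|_ [x [y ->]]].
- by rewrite (morph_one fM) gpred1.
- by rewrite fM gpredM.
- by rewrite (morph_inv fM) gpredV.
- rewrite /commg /conjg !fM !(morph_inv fM); exact: Gamma2_comm.
Qed.

End GammaTwo.

Section ArtinGammaTwo.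
Variables (n : nat) (B : groupType) (s : nat -> B).
Hypothesis hB : is_braid_group n s.
Local Open Scope group_scope.
Local Notation F := (free_group 'I_n).
Local Notation bact := (bact hB).
Local Notation phi := (artin_gaction hB).
Local Notation S := (semidirect phi).

Lemma augmentation1 : augmentation (1 : F) = 0%R.
Proof. by have := (Ker_augmentation_group_closed 'I_n).1 => /eqP. Qed.

Lemma augmentationV (v : F) : augmentation v^-1 = (- augmentation v)%R.
Proof.
have := augmentationM v v^-1; rewrite mulgV augmentation1 => /esym/eqP.
by rewrite addrC addr_eq0 => /eqP.
Qed.

Lemma augmentation_xg j : (j < n)%N -> augmentation (xg j : F) = 1%R.
Proof. by move=> hj; rewrite -(xgE (Ordinal hj)) augmentation_fgen. Qed.

Lemma augmentation_act b v : augmentation (bact b v) = augmentation v.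
Proof.
elim/(braid_gen hB): b v => [v|b c hb hc v|b hb v|k hk v].
- by rewrite bact1.
- by rewrite bactM hb hc.
- by rewrite -hb bactKV.
rewrite act_gen //; move: v; apply: F_gen => [|v w hv hw|v hv|j hj].
- by rewrite (morph_one (@art_funM n k)).
- by rewrite art_funM !augmentationM hv hw.
- by rewrite (morph_inv (@art_funM n k)) !augmentationV hv.
have hk' := ltnW hk.
have [->|jk] := eqVneq j k; first by rewrite art_funl // !augmentation_xg.
have [->|jk1] := eqVneq j k.+1.
  by rewrite art_funr // !augmentationM augmentationV !augmentation_xg // addNr add0r.
by rewrite art_funD //; apply/eqP.
Qed.

Lemma Ker_act (q : B) (v : F) : v \in Ker_augmentation 'I_n -> bact q v \in Ker_augmentation 'I_n.
Proof. by rewrite !unfold_in /Ker_augmentation augmentation_act. Qed.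

Definition gamma_act (q : subgrp (Gamma2 B)) (v : subgrp (Ker_augmentation 'I_n)) :
    subgrp (Ker_augmentation 'I_n) :=
  exist _ (bact (val q) (val v)) (Ker_act (val q) (valP v)).

Lemma gamma_act_morph q : {morph gamma_act q : x y / x * y}.
Proof. by move=> x y; apply: val_inj; rewrite /= act_morph. Qed.
Lemma gamma_act1 v : gamma_act 1 v = v.
Proof. by apply: val_inj; rewrite /= bact1. Qed.
Lemma gamma_actM q r v : gamma_act (q * r) v = gamma_act q (gamma_act r v).
Proof. by apply: val_inj; rewrite /= bactM. Qed.

Definition gamma_gaction : gaction (subgrp (Gamma2 B)) (subgrp (Ker_augmentation 'I_n)) :=
  GAction gamma_act_morph gamma_act1 gamma_actM.

Definition inF (v : F) : S := (v, 1).
Definition inB (b : B) : S := (1, b).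

Lemma inFM : {morph inF : x y / x * y}.
Proof. by move=> x y; congr (_, _); rewrite /= ?bact1 ?mulg1. Qed.
Lemma inBM : {morph inB : x y / x * y}.
Proof. by move=> x y; congr (_, _); rewrite /= (morph_one (@act_morph _ _ _ hB x)) mulg1. Qed.
Lemma inFB v b : inF v * inB b = (v, b) :> S.
Proof. by congr (_, _); rewrite /= ?bact1 ?mulg1 ?mul1g. Qed.
Lemma inBF v b : inB b * inF v * (inB b)^-1 = inF (bact b v).
Proof.
rewrite -(morph_inv inBM); congr (_, _); rewrite /= ?mulg1 ?mulgV //.
by rewrite mul1g (morph_one (@act_morph _ _ _ hB b)) mulg1.
Qed.

(* Modulo commutators all the free generators coincide. *)
Lemma inF_gen_Gamma2 j : (j < n)%N -> inF (xg j * (xg 0%N)^-1) \in Gamma2 S.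
Proof.
elim: j => [|j IH] hj; first by rewrite mulgV (morph_one inFM) gpred1.
have -> : inF (xg j.+1 * (xg 0%N)^-1) =
    inB (s j) * inF (xg j) * (inB (s j))^-1 * (inF (xg j))^-1 * inF (xg j * (xg 0%N)^-1).
  rewrite inBF act_gen // art_funl // -(morph_inv inFM) -!inFM.
  by rewrite !mulgA mulgVK.
by rewrite gpredM ?Gamma2_conj // IH // ltnW.
Qed.

(** A representative of v modulo [Gamma2 S], where the image of F is cyclic. [collapse_aug]
    identifies it as the power of exponent [augmentation v], an integer written there as k - l. *)
Definition collapse : F -> F := fext (fun=> xg 0%N).

Lemma collapse_Gamma2 v : inF (v * (collapse v)^-1) \in Gamma2 S.
Proof.
have cM : {morph collapse : x y / x * y} by exact: fextM.
move: v; apply: F_gen => [|v w hv hw|v hv|j hj].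
- by rewrite (morph_one cM) mulgV (morph_one inFM) gpred1.
- have -> : inF (v * w * (collapse (v * w))^-1) = inF v * inF (w * (collapse w)^-1) *
      (inF v)^-1 * inF (v * (collapse v)^-1).
    by rewrite -(morph_inv inFM) -!inFM cM invMg !mulgA mulgVK.
  by rewrite gpredM // Gamma2_normal.
- have -> : inF (v^-1 * (collapse v^-1)^-1) = inF v^-1 *
      (inF (v * (collapse v)^-1))^-1 * (inF v^-1)^-1.
    by rewrite -!(morph_inv inFM) -!inFM (morph_inv cM) invMg !invgK !mulgA mulgVK.
  by rewrite Gamma2_normal // gpredV.
- by rewrite /collapse fext_xg //; exact: inF_gen_Gamma2.
Qed.

Lemma collapse_aug v : exists k l : nat,
  augmentation v = (k%:Z - l%:Z)%R /\ collapse v = xg 0%N ^+ k * xg 0%N ^- l.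
Proof.
have cM : {morph collapse : x y / x * y} by exact: fextM.
have cX (x : F) a b : commute (x ^+ a) (x ^- b).
  by apply: commuteV; apply: commuteX2.
move: v; apply: F_gen => [|v w [k [l [a1 c1]]] [k' [l' [a2 c2]]]|v [k [l [a1 c1]]]|j hj].
- by exists 0%N, 0%N; rewrite augmentation1 (morph_one cM) expg0 invg1 mulg1.
- exists (k + k')%N, (l' + l)%N; split; first by rewrite augmentationM a1 a2; lia.
  rewrite cM c1 c2 !expgnDr invMg !mulgA; congr (_ * _).
  by rewrite -!mulgA cX.
- exists l, k; split; first by rewrite augmentationV a1; lia.
  by rewrite (morph_inv cM) c1 invMg invgK.
- exists 1%N, 0%N; split; first by rewrite augmentation_xg.
  by rewrite /collapse fext_xg // expg0 expg1 invg1 mulg1.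
Qed.

Lemma Gamma2_inF v : v \in Ker_augmentation 'I_n -> inF v \in Gamma2 S.
Proof.
rewrite unfold_in /Ker_augmentation => /eqP v0; have := collapse_Gamma2 v.
have [k [l [a ->]]] := collapse_aug v.
have -> : k = l by lia.
by rewrite mulgV invg1 mulg1.
Qed.

(** Left to right, the augmentation is invariant under the action, hence vanishes on the first
    component of a commutator. Right to left, an element is the product of its two components. *)
Lemma Gamma2_semidirect (x : S) : x \in Gamma2 S <->
  x.1 \in Ker_augmentation 'I_n /\ x.2 \in Gamma2 B.
Proof.
split; last first.
  case: x => v b [/= hv hb]; rewrite -inFB gpredM ?Gamma2_inF //.
  exact: (Gamma2_morph inBM).
move=> hx; split; last first.
  by apply: (Gamma2_morph (f := snd : S -> B)).
move: x hx; apply: gen_subgroup_ind => [|x y hx hy|x hx|_ [x [y ->]]].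
- exact: gpred1.
- by rewrite /= gpredM //; exact: Ker_act.
- by rewrite /=; apply: Ker_act; rewrite gpredV.
- rewrite unfold_in /Ker_augmentation /commg /conjg /= !(augmentationM, augmentation_act).
  by rewrite !augmentationV; apply/eqP; ring.
Qed.

End ArtinGammaTwo.

Section IsoGammaTwo.
Variables (n : nat) (B : groupType) (s : nat -> B).
Hypothesis hB : is_braid_group n s.
Local Open Scope group_scope.
Local Notation S := (semidirect (artin_gaction hB)).
Variables (A : groupType) (f : A -> S).
Hypotheses (fM : {morph f : x y / x * y}) (f_bij : bijective f).

Lemma iso_semidirect : group_iso A S.
Proof.
pose f' : A -> S := f.
pose m := isMultiplicative.Build A S f' fM.
by exists (HB.pack_for {multiplicative A -> S} f' m).
Qed.

Lemma iso_fst (a : subgrp (Gamma2 A)) : (f (val a)).1 \in Ker_augmentation 'I_n.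
Proof. by have [] := (Gamma2_semidirect _).1 (Gamma2_morph fM (valP a)). Qed.
Lemma iso_snd (a : subgrp (Gamma2 A)) : (f (val a)).2 \in Gamma2 B.
Proof. by have [] := (Gamma2_semidirect _).1 (Gamma2_morph fM (valP a)). Qed.

Definition gamma_iso (a : subgrp (Gamma2 A)) : semidirect (gamma_gaction hB) :=
  (exist (fun v => v \in Ker_augmentation 'I_n) _ (iso_fst a),
   exist (fun b => b \in Gamma2 B) _ (iso_snd a)).

Lemma gamma_isoM : {morph gamma_iso : x y / x * y}.
Proof.
move=> x y; congr (_, _); apply: val_inj; rewrite /= ?fM //.
Qed.

Lemma gamma_iso_bij : bijective gamma_iso.
Proof.
have [g fK gK] := f_bij.
have gM : {morph g : x y / x * y} by move=> x y; rewrite -{1}(gK x) -{1}(gK y) -fM fK.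
have h (p : semidirect (gamma_gaction hB)) : g (val p.1, val p.2) \in Gamma2 A.
  apply: (Gamma2_morph gM); apply/Gamma2_semidirect.
  by split; exact: valP.
exists (fun p => exist (fun a => a \in Gamma2 A) _ (h p)) => [a|[v b]].
  by apply: val_inj; rewrite /= -[RHS]fK; case: (f _).
by congr (_, _); apply: val_inj; rewrite /= gK.
Qed.

Lemma iso_Gamma2 : group_iso (subgrp (Gamma2 A)) (semidirect (gamma_gaction hB)).
Proof.
pose m := isMultiplicative.Build _ _ gamma_iso gamma_isoM.
by exists (HB.pack_for {multiplicative subgrp (Gamma2 A) -> semidirect (gamma_gaction hB)}
  gamma_iso m); exact: gamma_iso_bij.
Qed.

End IsoGammaTwo.

(** * Holonomy of cocycles along paths *)

Section Cousin.
Variable R : realType.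

(** Compactness of [p, q] in the form used for the local-to-global arguments on paths: the supremum
    of the right ends that can be reached from p cannot lie short of q. *)
Lemma cousin (P : R -> R -> Prop) (p q : R) : p <= q ->
  (forall x, exists2 e, 0 < e &
     forall a b, a <= x <= b -> x - e < a -> b < x + e -> P a b) ->
  (forall a b c, a <= b <= c -> P a b -> P b c -> P a c) -> P p q.
Proof.
move=> pq loc add.
pose S := [set t | p <= t <= q /\ P p t].
have Sp : S p.
  by split; rewrite ?lexx //; have [e e0] := loc p; apply; rewrite ?lexx //; lra.
have Sub : has_sup S by split; [exists p|exists q => t [/andP[]]].
have St t : S t -> t <= sup S by move=> h; apply: ub_le_sup => //; case: Sub.
have pS : p <= sup S by exact: St.
have Sq : sup S <= q by apply: ge_sup => [|t [/andP[]]] //; exists p.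
have [e e0 he] := loc (sup S).
have [t [/andP[pt tq] Pt] te] := sup_adherent e0 Sub.
have tS : t <= sup S by apply: St; split=> //; rewrite pt.
have [qe|qe] := ltP q (sup S + e).
  by apply: (add p t q) => //; [rewrite pt|apply: he => //; rewrite tS].
have : S (sup S + e / 2).
  split; first lra.
  by apply: (add p t) => //; [lra|apply: he; lra].
by move=> /St; lra.
Qed.

(** The inner use of [cousin] fixes an abscissa and glues vertically, giving thin strips of full
    height; the outer one glues the strips. *)
Lemma cousin2 (Q : R -> R -> R -> R -> Prop) (p q r s : R) : p <= q -> r <= s ->
  (forall x y, exists2 e, 0 < e & forall a b c d, a <= x <= b -> c <= y <= d ->
     x - e < a -> b < x + e -> y - e < c -> d < y + e -> Q a b c d) ->
  (forall a b b' c d, a <= b <= b' -> c <= d -> Q a b c d -> Q b b' c d -> Q a b' c d) ->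
  (forall a b c d d', a <= b -> c <= d <= d' -> Q a b c d -> Q a b d d' -> Q a b c d') ->
  Q p q r s.
Proof.
move=> pq rs loc addh addv.
apply: (@cousin (fun a b => Q a b r s)) => // [x|a b b' abb']; last exact: addh.
pose P c d := c <= d -> exists2 e, 0 < e & forall a b, a <= x <= b -> x - e < a -> b < x + e ->
  Q a b c d.
suff /(_ rs) : P r s by [].
apply: (@cousin P) => // [y|c d d' /andP[cd dd'] hcd hdd' cd'].
  have [e e0 he] := loc x y; exists e => // c d cyd ce de _; exists e => // a b axb ae be.
  exact: he.
have [e e0 he] := hcd cd; have [e' e'0 he'] := hdd' dd'.
exists (Num.min e e'); first by rewrite lt_min e0.
move=> a b axb; rewrite ltrBlDr -ltrBlDl lt_min => /andP[ae ae'].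
rewrite -ltrBlDl lt_min => /andP[be be'].
apply: (addv _ _ _ d); rewrite ?cd //.
- by case/andP: axb => h1 h2; apply: le_trans h2.
- by apply: he => //; lra.
- by apply: he' => //; lra.
Qed.

End Cousin.

Section Clip.
Variable R : realType.
Implicit Types a b t : R.

Definition clip a b t : R := Num.max a (Num.min b t).

Lemma clip_continuous a b : continuous (clip a b).
Proof.
apply: continuous_maxr; first exact: continuous_cst.
by apply: continuous_minr; [exact: continuous_cst|move=> t; exact: cvg_id].
Qed.

Lemma clip_itv a b t : a <= b -> a <= clip a b t <= b.
Proof.
move=> ab; rewrite /clip le_max lexx /=.
by rewrite ge_max ab ge_min lexx.
Qed.

Lemma clip_id a b t : a <= t <= b -> clip a b t = t.
Proof. by move=> /andP[h1 h2]; rewrite /clip min_r // max_r. Qed.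

Lemma clip_left a b b' t : a <= b <= b' -> t <= b -> clip a b' t = clip a b t.
Proof.
by move=> /andP[h1 h2] tb; rewrite /clip !min_r // (le_trans tb).
Qed.

Lemma clip_right a b b' t : a <= b <= b' -> b <= t -> clip a b' t = clip b b' t.
Proof.
move=> /andP[h1 h2] tb; rewrite /clip.
have h : b <= Num.min b' t by rewrite le_min h2.
by rewrite !max_r // (le_trans h1).
Qed.

End Clip.

Section Cocycle.
Variables (R : realType) (X : topologicalType) (G : groupType) (c : X -> X -> G).
Local Open Scope group_scope.

(** The neighbourhood of y may shrink with y, and x and y are not interchangeable: lying in the cell
    of a configuration is not a symmetric relation. *)
Definition cocycle := forall x, \forall y \near x, \forall z \near y, c x z = c x y * c y z.

(** A flat section over f, i.e. a primitive of the cocycle along f. *)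
Definition adm (U : topologicalType) (f : U -> X) (g : U -> G) :=
  forall u, \forall v \near u, g v = g u * c (f u) (f v).

Hypothesis cC : cocycle.

Lemma cocycle1 x : c x x = 1.
Proof.
have /nbhs_singleton/nbhs_singleton e := cC x.
by apply: (mulgI (c x x)); rewrite mulg1 -e.
Qed.

Lemma adm_comp (U V : topologicalType) (f : U -> X) g (h : V -> U) :
  continuous h -> adm f g -> adm (f \o h) (g \o h).
Proof. by move=> ch fg v; exact: (ch v _ (fg (h v))). Qed.

Lemma adm_mul (U : topologicalType) (f : U -> X) g k : adm f g -> adm f (fun u => k * g u).
Proof. by move=> fg u; apply: filterS (fg u) => v ->; rewrite mulgA. Qed.

Lemma adm_cst (U : topologicalType) x : adm (fun _ : U => x) (fun _ => 1).
Proof. by move=> u; apply: nearW => v; rewrite cocycle1 mulg1. Qed.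

(** The quotient of the two sections is locally constant, and [cousin] propagates this. *)
Lemma adm_unique (f : R -> X) g g' : adm f g -> adm f g' ->
  forall s t, g' s * (g s)^-1 = g' t * (g t)^-1.
Proof.
move=> fg fg' s t; wlog st : s t / (s <= t)%R.
  by move=> H; case/orP: (le_total s t) => h; [|apply/esym]; apply: H.
pose h s := g' s * (g s)^-1.
apply: (@cousin R (fun a b => h a = h b)) st _ _ => [x|a b d _ -> //].
have hx : \forall v \near x, h v = h x.
  apply: filterS2 _ (fg x) (fg' x) => v; rewrite /h => -> ->.
  by rewrite invMg !mulgA mulgK.
have /nbhs_ballP[e /= e0 he] := hx; exists e => // a b /andP[ax xb] ae be.
rewrite !he //= /ball /= ltr_distl; apply/andP; split; lra.
Qed.

Lemma adm_glue (U : topologicalType) (f f1 f2 : U -> X) g1 g2 (h : U -> R) :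
  continuous h -> adm f1 g1 -> adm f2 g2 ->
  (forall u, (h u <= 0)%R -> f u = f1 u) -> (forall u, (0 <= h u)%R -> f u = f2 u) ->
  (forall u, h u = 0%R -> g1 u = g2 u) ->
  adm f (fun u => if (h u <= 0)%R then g1 u else g2 u).
Proof.
move=> ch A1 A2 E1 E2 E u.
have [hu|hu|hu] := ltgtP (h u) 0%R.
- have hn : nbhs u [set v | (h v < 0)%R] by apply: (cvgr_lt (h u)) => //; exact: ch.
  apply: filterS2 _ hn (A1 u) => v /= hv ->.
  by rewrite (ltW hv) !E1 // ltW.
- have hn : nbhs u [set v | (0 < h v)%R] by apply: (cvgr_gt (h u)) => //; exact: ch.
  apply: filterS2 _ hn (A2 u) => v /= hv ->.
  by rewrite (lt_geF hv) !E2 // ltW.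
- apply: filterS2 _ (A1 u) (A2 u) => v.
  case: (leP (h v) 0%R) => hv h1 h2; first by rewrite h1 (E1 u) ?hu ?(E1 v).
  by rewrite h2 (E u hu) (E2 u) ?hu ?(E2 v) // ltW.
Qed.

(** On a small rectangle the values of [c] from a centre form a section. To glue two rectangles, the
    second section is multiplied on the left by the constant that makes them agree at one point of
    the common edge; they then agree along the edge by [adm_unique]. *)
Lemma adm_ex2 (f : R * R -> X) (p q r s : R) : (p <= q)%R -> (r <= s)%R -> continuous f ->
  exists g, adm (fun u => f (clip p q u.1, clip r s u.2)) g.
Proof.
move=> pq rs cf.
pose Q a b d e := exists g, adm (fun u => f (clip a b u.1, clip d e u.2)) g.
have c1 : continuous (fst : R * R -> R) by move=> u; exact: cvg_fst.
have c2 : continuous (snd : R * R -> R) by move=> u; exact: cvg_snd.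
have ccl a b d e : continuous (fun u : R * R => (clip a b u.1, clip d e u.2)).
  apply: continuous_pair => u; apply: continuous_comp; try exact: clip_continuous.
    exact: c1.
  exact: c2.
apply: (@cousin2 R Q) => // {p q r s pq rs} [x y|a b b' d e abb' de|a b d e e' ab dee'].
- have [[A B] [/= /nbhs_ballP[e1 /= e10 he1] /nbhs_ballP[e2 /= e20 he2]] AB] :=
    cf (x, y) _ (cC (f (x, y))).
  exists (Num.min e1 e2); first by rewrite lt_min e10.
  have m1 : (Num.min e1 e2 <= e1)%R by rewrite ge_min lexx.
  have m2 : (Num.min e1 e2 <= e2)%R by rewrite ge_min lexx orbT.
  move=> a b d e /andP[ax xb] /andP[dy ye] h1 h2 h3 h4.
  exists (fun u => c (f (x, y)) (f (clip a b u.1, clip d e u.2))) => u.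
  have cfu := continuous_comp (ccl a b d e u) (cf (clip a b u.1, clip d e u.2)).
  apply: (cfu _ (AB (clip a b u.1, clip d e u.2) _)).
  split => /=; [apply: he1|apply: he2]; rewrite /ball /= ltr_distl.
  + by have := @clip_itv R a b u.1 (le_trans ax xb); move=> /andP[k1 k2]; apply/andP; split; lra.
  + by have := @clip_itv R d e u.2 (le_trans dy ye); move=> /andP[k1 k2]; apply/andP; split; lra.
- move=> [g1 A1] [g2 A2].
  have cl : continuous (fun y : R => (b, y)).
    by apply: continuous_pair => u; [exact: cvg_cst|exact: cvg_id].
  have [ab bb'] := andP abb'.
  have B1 := adm_comp cl A1; have B2 := adm_comp cl A2.
  have {}B2 : adm ((fun u => f (clip a b u.1, clip d e u.2)) \o (fun y : R => (b, y)))
      (g2 \o (fun y : R => (b, y))).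
    move: B2; congr adm; apply/funext => z /=.
    by rewrite !(clip_id (t := b)) ?lexx ?ab ?bb'.
  pose k := g1 (b, 0%R) * (g2 (b, 0%R))^-1.
  exists (fun u => if (u.1 - b <= 0)%R then g1 u else k * g2 u).
  apply: adm_glue A1 (adm_mul k A2) _ _ _.
  + by move=> u; apply: cvgB; [exact: c1|exact: cvg_cst].
  + by move=> u hu; rewrite (clip_left abb') // -subr_le0.
  + by move=> u hu; rewrite (clip_right abb') // -subr_ge0.
  + move=> [u v] /= /subr0_eq ->.
    by rewrite /k (adm_unique B2 B1 0%R v) /= mulgVK.
- move=> [g1 A1] [g2 A2].
  have cl : continuous (fun x : R => (x, e)).
    by apply: continuous_pair => u; [exact: cvg_id|exact: cvg_cst].
  have [de ee'] := andP dee'.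
  have B1 := adm_comp cl A1; have B2 := adm_comp cl A2.
  have {}B2 : adm ((fun u => f (clip a b u.1, clip d e u.2)) \o (fun x : R => (x, e)))
      (g2 \o (fun x : R => (x, e))).
    move: B2; congr adm; apply/funext => z /=.
    by rewrite !(clip_id (t := e)) ?lexx ?de ?ee'.
  pose k := g1 (0%R, e) * (g2 (0%R, e))^-1.
  exists (fun u => if (u.2 - e <= 0)%R then g1 u else k * g2 u).
  apply: adm_glue A1 (adm_mul k A2) _ _ _.
  + by move=> u; apply: cvgB; [exact: c2|exact: cvg_cst].
  + by move=> u hu; rewrite (clip_left dee') // -subr_le0.
  + by move=> u hu; rewrite (clip_right dee') // -subr_ge0.
  + move=> [u v] /= /subr0_eq ->.
    by rewrite /k (adm_unique B2 B1 0%R u) /= mulgVK.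
Qed.

End Cocycle.

(** * Homotopies of paths *)

Section Paths.
Variables (R : realType) (T : topologicalType).
Implicit Types f g h r : R -> T.

(* Paths are maps defined on the whole line, considered on [0, 1]. *)
Definition hpt f g := exists2 H : R * R -> T, continuous H &
  [/\ forall t, 0 <= t <= 1 -> H (t, 0) = f t, forall t, 0 <= t <= 1 -> H (t, 1) = g t,
      forall s, 0 <= s <= 1 -> H (0, s) = f 0 & forall s, 0 <= s <= 1 -> H (1, s) = f 1].

Definition cat f g t := if 2 * t - 1 <= 0 then f (2 * t) else g (2 * t - 1).
Definition sub f a b t := f (a + (b - a) * t).
Definition flip f t := f (1 - t).

Lemma itv0 : 0 <= (0 : R) <= 1. Proof. by rewrite lexx ler01. Qed.
Lemma itv1 : 0 <= (1 : R) <= 1. Proof. by rewrite lexx ler01. Qed.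
Hint Resolve itv0 itv1 : core.

Lemma continuous_fst2 : continuous (fst : R * R -> R). Proof. by move=> u; exact: cvg_fst. Qed.
Lemma continuous_snd2 : continuous (snd : R * R -> R). Proof. by move=> u; exact: cvg_snd. Qed.
Lemma continuous_idR : continuous (fun t : R => t). Proof. by move=> t; exact: cvg_id. Qed.

Lemma continuous_comp2 (U V W : topologicalType) (f : U -> V) (g : V -> W) :
  continuous f -> continuous g -> continuous (fun u => g (f u)).
Proof. by move=> cf cg u; apply: continuous_comp; [exact: cf|exact: cg]. Qed.

Lemma cat0 f g : cat f g 0 = f 0.
Proof. by rewrite /cat mulr0 sub0r oppr_le0 ler01. Qed.
Lemma cat1 f g : cat f g 1 = g 1.
Proof. by rewrite /cat mulr1 (_ : 2 - 1 = 1 :> R) ?ler10 //; lra. Qed.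

Lemma cat_continuous f g : continuous f -> continuous g -> f 1 = g 0 -> continuous (cat f g).
Proof.
move=> cf cg fg; apply: paste_continuous.
- exact: continuous_comp2 (continuous_affine1 continuous_idR) cf.
- exact: continuous_comp2 (continuous_affine continuous_idR) cg.
- exact: continuous_affine continuous_idR.
- by move=> t e; rewrite e (_ : 2 * t = 1) //; lra.
Qed.

Lemma sub_continuous f a b : continuous f -> continuous (sub f a b).
Proof.
move=> cf; apply: continuous_comp2 cf.
by move=> t; apply: cvgD; [exact: cvg_cst|exact: (continuous_affine1 continuous_idR)].
Qed.

Lemma flip_continuous f : continuous f -> continuous (flip f).
Proof. by move=> cf; apply: continuous_comp2 cf; exact: continuous_cB continuous_idR. Qed.

Lemma sub0 f a b : sub f a b 0 = f a. Proof. by rewrite /sub mulr0 addr0. Qed.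
Lemma sub1 f a b : sub f a b 1 = f b. Proof. by rewrite /sub mulr1 addrC subrK. Qed.
Lemma flip0 f : flip f 0 = f 1. Proof. by rewrite /flip subr0. Qed.
Lemma flip1 f : flip f 1 = f 0. Proof. by rewrite /flip subrr. Qed.

Lemma hpt_ends f g : hpt f g -> g 0 = f 0 /\ g 1 = f 1.
Proof. by move=> [H _ [_ h1 h2 h3]]; rewrite -!h1 // h2 // h3. Qed.

(** The homotopy is linear between the two parameter functions, all along the same path r. *)
Lemma hpt_reparam r f g (phi psi : R -> R) : continuous r -> continuous phi ->
  continuous psi -> phi 0 = psi 0 -> phi 1 = psi 1 ->
  (forall t, 0 <= t <= 1 -> f t = r (phi t)) ->
  (forall t, 0 <= t <= 1 -> g t = r (psi t)) -> hpt f g.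
Proof.
move=> cr cp cq e0 e1 fE gE.
exists (fun u => r ((1 - u.2) * phi u.1 + u.2 * psi u.1)).
  apply: continuous_comp2 cr => u; apply: cvgD; apply: cvgM.
  + exact: (continuous_cB continuous_snd2).
  + exact: (continuous_comp2 continuous_fst2 cp).
  + exact: continuous_snd2.
  + exact: (continuous_comp2 continuous_fst2 cq).
split=> [t ht|t ht|s _|s _] /=.
- by rewrite subr0 mul1r mul0r addr0 fE.
- by rewrite subrr mul0r mul1r add0r gE.
- by rewrite -e0 -mulrDl subrK mul1r fE.
- by rewrite -e1 -mulrDl subrK mul1r fE.
Qed.

Lemma hpt_eq f g : continuous f -> (forall t, 0 <= t <= 1 -> f t = g t) -> hpt f g.
Proof.
move=> cf e; apply: (@hpt_reparam f f g id id) => //; try exact: continuous_idR.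
by move=> t /e.
Qed.

Lemma hpt_refl f : continuous f -> hpt f f.
Proof. by move=> cf; exact: hpt_eq. Qed.

Lemma hpt_sym f g : hpt f g -> hpt g f.
Proof.
move=> hfg; have [e0 e1] := hpt_ends hfg; move: hfg => [H cH [h0 h1 h2 h3]].
exists (fun u => H (u.1, 1 - u.2)).
  apply: continuous_comp2 cH; apply: continuous_pair; first exact: continuous_fst2.
  exact: continuous_cB continuous_snd2.
split=> [t ht|t ht|s hs|s hs] /=; rewrite ?subr0 ?subrr; [exact: h1|exact: h0|..].
- by rewrite h2 ?e0 //; lra.
- by rewrite h3 ?e1 //; lra.
Qed.

Lemma hpt_trans f g h : hpt f g -> hpt g h -> hpt f h.
Proof.
move=> hfg; have [e0 e1] := hpt_ends hfg.
move: hfg => [H cH [h0 h1 h2 h3]] [K cK [k0 k1 k2 k3]].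
exists (fun u => if 2 * u.2 - 1 <= 0 then H (clip 0 1 u.1, 2 * u.2)
   else K (clip 0 1 u.1, 2 * u.2 - 1)).
  have cc : continuous (fun u : R * R => clip 0 1 u.1).
    exact: continuous_comp2 continuous_fst2 (@clip_continuous _ _ _).
  apply: paste_continuous.
  - apply: continuous_comp2 cH; apply: continuous_pair cc _.
    exact: continuous_affine1 continuous_snd2.
  - apply: continuous_comp2 cK; apply: continuous_pair cc _.
    exact: continuous_affine continuous_snd2.
  - exact: continuous_affine continuous_snd2.
  - move=> u e; rewrite e (_ : 2 * u.2 = 1); last lra.
    by rewrite h1 ?k0 // clip_itv.
have c0 : clip 0 1 0 = 0 :> R by rewrite clip_id.
have c1 : clip 0 1 1 = 1 :> R by rewrite clip_id.
split=> [t ht|t ht|s hs|s hs] /=.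
- by rewrite mulr0 sub0r oppr_le0 ler01 clip_id // h0.
- by rewrite mulr1 (_ : 2 - 1 = 1 :> R) ?ler10 ?clip_id ?k1 //; lra.
- by rewrite c0; case: leP => h'; [rewrite h2 //; lra|rewrite k2 ?e0 //; lra].
- by rewrite c1; case: leP => h'; [rewrite h3 //; lra|rewrite k3 ?e1 //; lra].
Qed.

Lemma hpt_cat f f' g g' : hpt f f' -> hpt g g' -> f 1 = g 0 -> hpt (cat f g) (cat f' g').
Proof.
move=> [H cH [h0 h1 h2 h3]] [K cK [k0 k1 k2 k3]] fg.
have cc : continuous (fun u : R * R => clip 0 1 u.2).
  exact: continuous_comp2 continuous_snd2 (@clip_continuous _ _ _).
have c0 : clip 0 1 0 = 0 :> R by rewrite clip_id.
have c1 : clip 0 1 1 = 1 :> R by rewrite clip_id.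
exists (fun u => if 2 * u.1 - 1 <= 0 then H (2 * u.1, clip 0 1 u.2)
   else K (2 * u.1 - 1, clip 0 1 u.2)).
  apply: paste_continuous.
  - apply: continuous_comp2 cH; apply: continuous_pair cc.
    exact: continuous_affine1 continuous_fst2.
  - apply: continuous_comp2 cK; apply: continuous_pair cc.
    exact: continuous_affine continuous_fst2.
  - exact: continuous_affine continuous_fst2.
  - move=> u e; rewrite e (_ : 2 * u.1 = 1); last lra.
    by rewrite h3 ?k2 // clip_itv.
split=> [t ht|t ht|s hs|s hs] /=.
- by rewrite c0 /cat; case: leP => h'; [rewrite h0 //; lra|rewrite k0 //; lra].
- by rewrite c1 /cat; case: leP => h'; [rewrite h1 //; lra|rewrite k1 //; lra].
- by rewrite cat0 mulr0 sub0r oppr_le0 ler01 clip_id // h2.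
- by rewrite cat1 mulr1 (_ : 2 - 1 = 1 :> R) ?ler10 ?clip_id ?k3 //; lra.
Qed.

(** The numbers a, b, c come in any order, so constant and reversed paths are subpaths as well; the
    laws for units and inverses below are instances. *)
Lemma hpt_subcat f a b c : continuous f -> hpt (cat (sub f a b) (sub f b c)) (sub f a c).
Proof.
move=> cf; pose phi (t : R) : R := if 2 * t - 1 <= 0 then a + (b - a) * (2 * t) else b + (c - b) * (2 * t - 1).
have cA (x y : R) (k : R -> R) : continuous k -> continuous (fun t => x + y * k t).
  by move=> ck t; apply: cvgD; [exact: cvg_cst|exact: (continuous_affine1 ck)].
apply: (@hpt_reparam f _ _ phi (fun t => a + (c - a) * t)) => //.
- apply: paste_continuous.
  + exact/cA/(continuous_affine1 continuous_idR).
  + exact/cA/(continuous_affine continuous_idR).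
  + exact: (continuous_affine continuous_idR).
  + by move=> t e; rewrite e (_ : 2 * t = 1); lra.
- exact: cA continuous_idR.
- by rewrite /phi mulr0 sub0r oppr_le0 ler01 !mulr0.
- by rewrite /phi mulr1 (_ : 2 - 1 = 1 :> R) ?ler10; lra.
- by move=> t _; rewrite /cat /sub /phi; case: ifP.
Qed.

Lemma hpt_1cat f : continuous f -> hpt (cat (fun=> f 0) f) f.
Proof.
move=> cf; have := @hpt_subcat f 0 0 1 cf.
have -> : sub f 0 0 = (fun=> f 0) by apply/funext => t; rewrite /sub subrr mul0r addr0.
by have -> : sub f 0 1 = f by apply/funext => t; rewrite /sub subr0 mul1r add0r.
Qed.

Lemma hpt_cat1 f : continuous f -> hpt (cat f (fun=> f 1)) f.
Proof.
move=> cf; have := @hpt_subcat f 0 1 1 cf.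
have -> : sub f 1 1 = (fun=> f 1) by apply/funext => t; rewrite /sub subrr mul0r addr0.
by have -> : sub f 0 1 = f by apply/funext => t; rewrite /sub subr0 mul1r add0r.
Qed.

Lemma hpt_catV f : continuous f -> hpt (cat f (flip f)) (fun=> f 0).
Proof.
move=> cf; have := @hpt_subcat f 0 1 0 cf.
have -> : sub f 0 0 = (fun=> f 0) by apply/funext => t; rewrite /sub subrr mul0r addr0.
have -> : sub f 1 0 = flip f by apply/funext => t; rewrite /sub /flip sub0r mulN1r.
by have -> : sub f 0 1 = f by apply/funext => t; rewrite /sub subr0 mul1r add0r.
Qed.

Lemma flipK f : flip (flip f) = f.
Proof. by apply/funext => t; rewrite /flip opprB addrC subrK. Qed.

Lemma hpt_Vcat f : continuous f -> hpt (cat (flip f) f) (fun=> f 1).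
Proof.
by move=> cf; have := hpt_catV (flip_continuous cf); rewrite flipK flip0.
Qed.

(* Both bracketings follow the path that runs f, g, h on [0, 3]. *)
Lemma hpt_catA f g h : continuous f -> continuous g -> continuous h ->
  f 1 = g 0 -> g 1 = h 0 -> hpt (cat (cat f g) h) (cat f (cat g h)).
Proof.
move=> cf cg ch fg gh.
pose r (t : R) := if t - 1 <= 0 then f t else if t - 2 <= 0 then g (t - 1) else h (t - 2).
have cD (x : R) : continuous (fun t : R => t - x) by exact: continuous_Dc continuous_idR.
have cr : continuous r.
  apply: paste_continuous => //.
    apply: paste_continuous => //; try exact: continuous_comp2 (cD _) _.
    by move=> t e; rewrite e (_ : t - 1 = 1) //; lra.
  by move=> t e; rewrite (_ : t - 2 <= 0) ?e //; [have -> : t = 1 by lra|lra].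
pose phi (t : R) : R := if 2 * t - 1 <= 0 then 4 * t else 2 * t + 1.
pose psi (t : R) : R := if 2 * t - 1 <= 0 then 2 * t else 4 * t - 1.
have c4 (x y : R) : continuous (fun t : R => x * t + y).
  exact: continuous_affine continuous_idR.
have c5 (x : R) : continuous (fun t : R => x * t).
  exact: continuous_affine1 continuous_idR.
apply: (@hpt_reparam r _ _ phi psi) => //.
- by apply: paste_continuous => // t e; lra.
- by apply: paste_continuous => // t e; lra.
- by rewrite /phi /psi mulr0 sub0r oppr_le0 ler01 !mulr0.
- by rewrite /phi /psi !mulr1 (_ : 2 - 1 = 1 :> R) ?ler10; lra.
- clear fg gh => t /andP[t0 t1]; rewrite /cat /r /phi.
  case: leP => h1; case: leP => h2.
  + case: leP => h3; first by congr f; lra.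
    by exfalso; lra.
  + case: leP => h3; first by exfalso; lra.
    case: leP => h4; first by congr g; lra.
    by exfalso; lra.
  + by exfalso; lra.
  + case: leP => h4; first by exfalso; lra.
    by congr h; lra.
- clear fg gh => t /andP[t0 t1]; rewrite /cat /r /psi.
  case: leP => h1; first by rewrite (_ : 2 * t - 1 <= 0).
  case: leP => h2; (case: leP => h3; first by exfalso; lra);
    case: leP => h4; try (exfalso; lra).
  + by congr g; lra.
  + by congr h; lra.
Qed.

Lemma hpt_catI (p : R -> T) f g : continuous p -> continuous f -> continuous g ->
  p 1 = f 0 -> p 1 = g 0 -> hpt (cat p f) (cat p g) -> hpt f g.
Proof.
move=> cp cf cg pf pg e.
have main k : continuous k -> p 1 = k 0 -> hpt (cat (flip p) (cat p k)) k.
  move=> ck pk; have cfl := flip_continuous cp.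
  apply: hpt_trans (hpt_sym (hpt_catA cfl cp ck (flip1 p) pk)) _.
  apply: (@hpt_trans _ (cat (fun=> k 0) k)); last exact: hpt_1cat.
  apply: hpt_cat; [|exact: hpt_refl|by rewrite cat1].
  by rewrite -pk; exact: hpt_Vcat.
apply: hpt_trans (hpt_sym (main f cf pf)) _.
apply: hpt_trans (main g cg pg).
apply: hpt_cat e _; first exact/hpt_refl/flip_continuous.
by rewrite flip1 cat0.
Qed.

End Paths.
Hint Resolve itv0 itv1 : core.

Section LoopClasses.
Variables (R : realType) (T : topologicalType) (x : T).
Implicit Types f g : R -> T.

Definition is_loop f := [/\ continuous f, f 0 = x & f 1 = x].

Section OfFun.
Variable f : R -> T.
Hypothesis fl : is_loop f.

Lemma loop_of_continuous : continuous (f \o (@ival R)).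
Proof. by case: fl => cf _ _; apply: continuous_comp2 cf; exact: ival_continuous. Qed.
Lemma loop_of_zero : (f \o (@ival R)) zero = x.
Proof. by case: fl => _ f0 _; rewrite /= ival0. Qed.
Lemma loop_of_one : (f \o (@ival R)) one = x.
Proof. by case: fl => _ _ f1; rewrite /= ival1. Qed.

Definition loop_of : loop R x := mk_path loop_of_continuous loop_of_zero loop_of_one.
End OfFun.

Definition cls f : pi1 R x :=
  if pselect (is_loop f) is left fl then pi1_class (loop_of fl) else 1%g.

Lemma clsE f (fl : is_loop f) : cls f = pi1_class (loop_of fl).
Proof.
by rewrite /cls; case: pselect => // fl'; rewrite (Prop_irrelevance fl fl').
Qed.

Definition fun_of (p : loop R x) (t : R) : T := p (clamp t).

Lemma fun_of_loop p : is_loop (fun_of p).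
Proof.
split; first exact: continuous_comp2 (@clamp_continuous R) (@cts_fun _ _ p).
  by rewrite /fun_of [clamp 0]/(zero) path_zero.
by rewrite /fun_of [clamp 1]/(one) path_one.
Qed.

Lemma cls_fun_of p : cls (fun_of p) = pi1_class p.
Proof.
rewrite (clsE (fun_of_loop p)); congr pi1_class; apply/path_eqP => t.
by rewrite /= /mk_path /= /fun_of ivalK.
Qed.

Lemma cls_surj a : exists2 f, is_loop f & a = cls f.
Proof.
by exists (fun_of (repr a)); [exact: fun_of_loop|rewrite cls_fun_of pi1_reprK].
Qed.

Lemma homotopic_hpt f g (fl : is_loop f) (gl : is_loop g) :
  homotopic (loop_of fl) (loop_of gl) <-> hpt f g.
Proof.
have iv (t : R) : 0 <= t <= 1 -> ival (clamp t) = t by exact: clampK.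
split=> [[H [cH h0 h1 hs]]|[H cH [h0 h1 h2 h3]]].
  exists (fun u => H (clamp u.1, clamp u.2)).
    exact: continuous_clamp2 cH (@continuous_fst2 R) (@continuous_snd2 R).
  case: fl h0 => cf f0 f1 h0; case: gl h1 => cg g0 g1 h1.
  split=> [t ht|t ht|s hs'|s hs'] /=.
  - by rewrite [clamp 0]/(zero) h0 /= /mk_path /= iv.
  - by rewrite [clamp 1]/(one) h1 /= /mk_path /= iv.
  - by rewrite [clamp 0]/(zero) f0; case: (hs (clamp s)).
  - by rewrite [clamp 1]/(one) f1; case: (hs (clamp s)).
exists (fun u => H (ival u.1, ival u.2)); split=> [|t|t|s] /=.
- apply: continuous_comp2 cH; apply: continuous_pair; first exact: continuous_ival1.
  exact: continuous_ival2.
- by rewrite ival0 h0 ?ival_itv.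
- by rewrite ival1 h1 ?ival_itv.
- case: fl => cf f0 f1.
  by rewrite ival0 ival1 h2 ?ival_itv // h3 ?ival_itv.
Qed.

Lemma cls_eqP f g : is_loop f -> is_loop g -> cls f = cls g <-> hpt f g.
Proof.
by move=> fl gl; rewrite (clsE fl) (clsE gl) -pi1_classP; exact: homotopic_hpt.
Qed.

Lemma is_loop_cat f g : is_loop f -> is_loop g -> is_loop (cat f g).
Proof.
move=> [cf f0 f1] [cg g0 g1]; split; rewrite ?cat0 ?cat1 //.
by apply: cat_continuous => //; rewrite f1.
Qed.

Lemma cls_cat f g : is_loop f -> is_loop g -> cls (cat f g) = (cls f * cls g)%g.
Proof.
move=> fl gl; rewrite (clsE fl) (clsE gl) [RHS]pi1_mulE (clsE (is_loop_cat fl gl)).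
congr pi1_class; apply/path_eqP => t; rewrite /= /mk_path /= /concat_fun /cat /= /mk_path /=.
have /andP[t0 t1] := ival_itv t.
by case: leP => h; rewrite clampK //; lra.
Qed.

Lemma is_loop_cst : is_loop (fun=> x).
Proof. by split=> // t; exact: cvg_cst. Qed.

Lemma cls_cst : cls (fun=> x) = 1%g.
Proof. by rewrite (clsE is_loop_cst); congr pi1_class; apply/path_eqP. Qed.

End LoopClasses.

Lemma hpt_map (R : realType) (V W : topologicalType) (k : V -> W) (f g : R -> V) :
  continuous k -> hpt f g -> hpt (k \o f) (k \o g).
Proof.
move=> ck [H cH [h0 h1 h2 h3]]; exists (k \o H); first exact: continuous_comp2.
by split=> t ht /=; rewrite ?h0 ?h1 ?h2 ?h3.
Qed.

Lemma is_loop_map (R : realType) (V W : topologicalType) (k : V -> W) x (f : R -> V) :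
  continuous k -> is_loop x f -> is_loop (k x) (k \o f).
Proof.
move=> ck [cf f0 f1]; split; rewrite /= ?f0 ?f1 //; exact: continuous_comp2 cf ck.
Qed.

Section Holonomy.
Variables (R : realType) (X : topologicalType) (G : groupType) (c : X -> X -> G).
Hypothesis cC : cocycle c.
Local Open Scope group_scope.

Lemma adm_ex1 (f : R -> X) : continuous f ->
  exists g, adm c (fun t => f (clip 0%R 1%R t)) g.
Proof.
move=> cf; have [|g hg] := @adm_ex2 R X G c cC (fun u => f u.1) 0%R 1%R 0%R 1%R ler01 ler01.
  exact: continuous_comp2 (@continuous_fst2 R) cf.
exists (fun t => g (t, 0%R)).
apply: (adm_comp (h := fun t : R => (t, 0%R)) _ hg).
by apply: continuous_pair => t; [exact: cvg_id|exact: cvg_cst].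
Qed.

(** The increment of a section along f, independent of the section by [hol_eq]; 1 is a default for
    discontinuous maps. *)
Definition hol (f : R -> X) : G :=
  if pselect (continuous f) is left cf then
    let g := sval (cid (adm_ex1 cf)) in (g 0%R)^-1 * g 1%R else 1.

Lemma hol_eq (f : R -> X) g : continuous f -> adm c (fun t => f (clip 0%R 1%R t)) g ->
  hol f = (g 0%R)^-1 * g 1%R.
Proof.
move=> cf fg; rewrite /hol; case: pselect => // cf'; case: cid => g' /= fg'.
have := adm_unique fg fg' 0%R 1%R; set h := g' 1%R * _ => e.
have -> : g' 1%R = h * g 1%R by rewrite /h mulgVK.
have -> : g' 0%R = h * g 0%R by rewrite -e mulgVK.
by rewrite invMg -mulgA mulKg.
Qed.

Lemma hol_adm f g : continuous f -> adm c f g -> hol f = (g 0%R)^-1 * g 1%R.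
Proof.
move=> cf fg; rewrite (@hol_eq f (g \o clip 0%R 1%R)) //=.
  by rewrite !clip_id ?lexx ?ler01.
by apply: adm_comp fg; exact: clip_continuous.
Qed.

(** A section over the square is constant on the two sides where the homotopy is constant, so its
    increments along the other two sides agree. *)
Lemma hol_hpt (f g : R -> X) : continuous f -> continuous g -> hpt f g -> hol f = hol g.
Proof.
move=> cf cg [H cH [h0 h1 h2 h3]].
have [k hk] := @adm_ex2 R X G c cC H 0%R 1%R 0%R 1%R ler01 ler01 cH.
have c1 (s : R) : continuous (fun t : R => (t, s)).
  by apply: continuous_pair => t; [exact: cvg_id|exact: cvg_cst].
have c2 (t : R) : continuous (fun s : R => (t, s)).
  by apply: continuous_pair => s; [exact: cvg_cst|exact: cvg_id].
have e0 : hol f = (k (0%R, 0%R))^-1 * k (1%R, 0%R).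
  apply: (@hol_eq f (fun t => k (t, 0%R))) => //.
  have := adm_comp (c1 0%R) hk; congr adm; apply/funext => t /=.
  by rewrite (clip_id (t := 0%R)) ?lexx ?ler01 // h0 ?clip_itv ?ler01.
have e1 : hol g = (k (0%R, 1%R))^-1 * k (1%R, 1%R).
  apply: (@hol_eq g (fun t => k (t, 1%R))) => //.
  have := adm_comp (c1 1%R) hk; congr adm; apply/funext => t /=.
  by rewrite (clip_id (t := 1%R)) ?lexx ?ler01 // h1 ?clip_itv ?ler01.
have vert (t : R) y : (forall s, (0 <= s <= 1)%R -> H (clip 0%R 1%R t, s) = y) ->
    k (t, 0%R) = k (t, 1%R).
  move=> hy; have A := adm_comp (c2 t) hk.
  have := adm_unique (adm_cst cC (U := R) y) (_ : adm c (fun=> y) (fun s => k (t, s))) 0%R 1%R.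
  rewrite invg1 !mulg1; apply.
  move: A; congr adm; apply/funext => s /=.
  by rewrite hy ?clip_itv ?ler01.
rewrite e0 e1 (vert 0%R (f 0%R)); last by move=> s hs; rewrite clip_id ?lexx ?ler01 ?h2.
by rewrite (vert 1%R (f 1%R)) // => s hs; rewrite clip_id ?lexx ?ler01 ?h3.
Qed.

Lemma clip_double (t : R) : (2 * t - 1 <= 0)%R ->
  (clip 0 1 (2 * t) = 2 * clip 0 1 t)%R /\ (2 * clip 0 1 t - 1 <= 0)%R.
Proof.
move=> ht; rewrite /clip (min_r (y := t)) ?(min_r (y := (2 * t)%R)); try lra.
by case: (leP 0%R t) => h; [rewrite max_r|rewrite max_l]; lra.
Qed.

Lemma clip_double1 (t : R) : (0 <= 2 * t - 1)%R ->
  (clip 0 1 (2 * t - 1) = 2 * clip 0 1 t - 1)%R /\ (0 <= 2 * clip 0 1 t - 1)%R.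
Proof.
move=> ht; rewrite /clip; case: (leP 1%R t) => h.
  by rewrite min_l ?(max_r (y := 1%R)) ?ler01; lra.
by rewrite min_r ?(max_r (y := t)) ?(max_r (y := (2 * t - 1)%R)); lra.
Qed.

Lemma hol_cat (f g : R -> X) : continuous f -> continuous g -> f 1%R = g 0%R ->
  hol (cat f g) = hol f * hol g.
Proof.
move=> cf cg fg; have [kf hf] := adm_ex1 cf; have [kg hg] := adm_ex1 cg.
have cat_c := cat_continuous cf cg fg.
rewrite (hol_eq cf hf) (hol_eq cg hg).
pose k := kf 1%R * (kg 0%R)^-1.
rewrite (@hol_eq _ (fun t => if (2 * t - 1 <= 0)%R then kf (2 * t)%R else k * kg (2 * t - 1)%R)) //.
  rewrite mulr0 sub0r oppr_le0 ler01 mulr1 (_ : 2 - 1 = 1 :> R)%R; last lra.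
  by rewrite ler10 /k !mulgA.
have d1 : continuous (fun t : R => 2 * t)%R by exact: continuous_affine1 (@continuous_idR R).
have d2 : continuous (fun t : R => 2 * t - 1)%R by exact: continuous_affine (@continuous_idR R).
apply: adm_glue d2 (adm_comp d1 hf) (adm_mul k (adm_comp d2 hg)) _ _ _ => t /= ht.
- have [e le] := clip_double ht.
  by rewrite /cat le e.
- have [e le] := clip_double1 ht; rewrite /cat e; case: ifP => // h.
  have -> : (2 * clip 0 1 t = 1)%R by apply/eqP; rewrite -subr_eq0 eq_le h.
  by rewrite subrr fg.
- have -> : (2 * t = 1)%R by apply/eqP; rewrite -subr_eq0 ht.
  by rewrite subrr /k mulgVK.
Qed.

Definition Hol (x : X) (a : pi1 R x) : G := hol (fun_of (repr a)).

Lemma Hol_cls x f : is_loop x f -> Hol (cls x f) = hol f.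
Proof.
move=> fl; have gl := fun_of_loop (repr (cls x f)).
case: (fl) (gl) => cf _ _ [cg _ _]; apply: hol_hpt => //.
by apply/(cls_eqP gl fl); rewrite cls_fun_of pi1_reprK.
Qed.

Lemma HolM x : {morph @Hol x : a b / a * b}.
Proof.
move=> a b; have [f fl ->] := cls_surj a; have [g gl ->] := cls_surj b.
rewrite -cls_cat // !Hol_cls //; last exact: is_loop_cat.
by case: fl gl => cf _ f1 [cg g0 _]; apply: hol_cat => //; rewrite f1.
Qed.

End Holonomy.

(** * Configurations and their cells *)

Lemma fin_eps (R : realType) (I : finType) (P : I -> R -> Prop) :
  (forall i, exists2 e, 0 < e & P i e) ->
  (forall i e e', 0 < e' -> e' <= e -> P i e -> P i e') -> exists2 e, 0 < e & forall i, P i e.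
Proof.
move=> ex mono.
suff [e e0 he] : exists2 e, 0 < e & forall i, i \in enum I -> P i e.
  by exists e => // i; apply: he; rewrite mem_enum.
elim: (enum I) => [|i s [e e0 he]]; first by exists 1.
have [d d0 hd] := ex i; have m0 : 0 < Num.min e d by rewrite lt_min e0.
exists (Num.min e d) => // j; rewrite in_cons => /predU1P[->|js].
  by apply: mono hd => //; rewrite ge_min lexx orbT.
by apply: mono (he _ js) => //; rewrite ge_min lexx.
Qed.

Lemma conf_class_eqP n (M : topologicalType) (a b : ordered_conf n M) : conf_class a = conf_class b <-> same_conf a b.
Proof.
split=> [e|]; last exact: conf_classP.
by apply/asboolP; move/(@eqmodP _ (same_conf_equiv n M)): e.
Qed.

Section Configurations.
Variables (R : realType) (n : nat) (K : set (R * R)).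
Local Notation tup := ('I_n -> R * R).
Implicit Types (v w : tup) (x y z : conf n K).

Definition valid v := (forall i, K (v i)) /\ injective v.

Section OfTuple.
Variables (v : tup) (h : valid v).

Definition sub_tuple : {ptws 'I_n -> K} := fun i => SigSub (mem_set (h.1 i)).

Lemma sub_tuple_inj : injective sub_tuple.
Proof. by move=> i j /(congr1 val) /= /h.2. Qed.

Definition conf_of : ordered_conf n K := SigSub (mem_set sub_tuple_inj).

End OfTuple.

Variable x0 : conf n K.

(* The default value x0 is only used for invalid tuples. *)
Definition lab v : conf n K := if pselect (valid v) is left h then conf_class (conf_of h) else x0.

Lemma labE v (h : valid v) : lab v = conf_class (conf_of h).
Proof. by rewrite /lab; case: pselect => // h'; rewrite (Prop_irrelevance h h'). Qed.

Lemma lab_eqP v w : valid v -> valid w ->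
  lab v = lab w <-> exists s : 'S_n, forall i, w i = v (s i).
Proof.
move=> hv hw; rewrite (labE hv) (labE hw) conf_class_eqP; split=> -[s e]; exists s => i.
  by have := congr1 val (e i).
by apply: val_inj; rewrite /= e.
Qed.

Definition oval (a : ordered_conf n K) : tup := fun i => val (conf_fun a i).

Lemma oval_valid (a : ordered_conf n K) : valid (oval a).
Proof.
split=> [i|i j /val_inj e]; first exact: set_valP (conf_fun a i).
exact: (set_valP a) e.
Qed.

Lemma lab_oval (a : ordered_conf n K) : lab (oval a) = conf_class a.
Proof.
rewrite (labE (oval_valid a)); apply: conf_classP; exists 1%g => i.
by apply: val_inj; rewrite /= perm1.
Qed.

Lemma lab_surj x : exists2 v, valid v & x = lab v.
Proof.
exists (oval (repr (x : {eq_quot same_conf_equiv n K}%qT))); first exact: oval_valid.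
by rewrite lab_oval /conf_class reprK.
Qed.

Lemma valid_perm v (s : 'S_n) : valid v -> valid (fun i => v (s i)).
Proof. by move=> [h1 h2]; split=> [i //|i j /h2/perm_inj]. Qed.

Lemma lab_perm v (s : 'S_n) : valid v -> lab (fun i => v (s i)) = lab v.
Proof.
by move=> h; apply/esym/lab_eqP => //; [exact: valid_perm|exists s].
Qed.

Lemma lab_continuous (U : topologicalType) (v : U -> 'I_n -> R * R) :
  (forall i, continuous (fun u => v u i)) -> (forall u, valid (v u)) ->
  continuous (fun u => lab (v u)).
Proof.
move=> cv hv; have -> : (fun u => lab (v u)) = conf_class \o (fun u => conf_of (hv u)).
  by apply/funext => u; rewrite (labE (hv u)).
move=> u; apply: continuous_comp; last exact: conf_class_continuous.
move: u; apply: continuous_ordered_conf => i.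
by apply: continuous_comp_initial; exact: cv.
Qed.

Lemma oval_continuous i : continuous (fun a : ordered_conf n K => oval a i).
Proof.
move=> a; apply: (@continuous_comp _ _ _ (fun a => conf_fun a i) (fun p : K => set_val p)).
  apply: (@continuous_comp _ _ _ (@conf_fun n K) (fun f : {ptws 'I_n -> K} => f i)).
    exact: initial_continuous.
  exact: (@proj_continuous 'I_n (fun _ => K) i).
exact: initial_continuous.
Qed.

(** The quotient by a finite group is open: the preimage of O is the union of the translates, under
    permutations of the indices, of a product of open sets. *)
Lemma lab_near v (A : 'I_n -> set (R * R)) : valid v -> (forall i, nbhs (v i) (A i)) ->
  \forall y \near lab v, exists2 w, valid w /\ y = lab w & forall i, A i (w i).
Proof.
move=> hv hA.
pose O := [set y | exists2 w, valid w /\ y = lab w & forall i, (A i)^° (w i)].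
have oO : open O.
  rewrite /open /= /quotient_open.
  rewrite (_ : _ @^-1` _ = \bigcup_(s : 'S_n) (\bigcap_(i : 'I_n)
     [set a | (A i)^° (oval a (s i))])).
    apply: bigcup_open => s _.
    rewrite openE => a ha; have : \forall b \near a, forall i, (A i)^° (oval b (s i)).
      suff H i : \forall b \near a, (A i)^° (oval b (s i)) by exact: filter_forall H.
      have := @oval_continuous (s i) a; apply.
      by apply: open_nbhs_nbhs; split; [exact: open_interior|exact: ha].
    by apply: filterS => b hb i _; exact: hb.
  apply/seteqP; split=> a /=.
    move=> [w [hw e] wA].
    have {}e : lab (oval a) = lab w by rewrite lab_oval; exact: e.
    have [s es] := (lab_eqP (oval_valid a) hw).1 e.
    by exists s => // i _ /=; rewrite -es.
  move=> [s _ sA]; exists (fun i => oval a (s i)); last by move=> i; exact: sA.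
  split; first exact/valid_perm/oval_valid.
  by rewrite lab_perm ?lab_oval //; exact: oval_valid.
apply: (@filterS _ _ _ O) => [y [w hw wA]|].
  by exists w => // i; exact: interior_subset (wA i).
by apply: open_nbhs_nbhs; split=> //; exists v.
Qed.

End Configurations.

(** * Lexicographic order and its cells *)

Section Lex.
Variables (R : realType) (n : nat).
Local Notation tup := ('I_n -> R * R).
Implicit Types (v w u : tup).

Definition lexlt (p q : R * R) : bool := (p.1 < q.1) || ((p.1 == q.1) && (p.2 < q.2)).

Lemma lexlt_irr p : lexlt p p = false.
Proof. by rewrite /lexlt !ltxx andbF. Qed.

Lemma lexlt_trans q p r : lexlt p q -> lexlt q r -> lexlt p r.
Proof.
rewrite /lexlt => /orP[h1|/andP[/eqP e1 h1]] /orP[h2|/andP[/eqP e2 h2]].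
- by rewrite (lt_trans h1 h2).
- by rewrite -e2 h1.
- by rewrite e1 h2.
- by rewrite e1 e2 eqxx (lt_trans h1 h2) orbT.
Qed.

Lemma lexlt_total p q : p <> q -> lexlt p q \/ lexlt q p.
Proof.
rewrite /lexlt; case: (ltgtP p.1 q.1) => h1; [by left|by right|].
case: (ltgtP p.2 q.2) => h2; [by left|by right|].
by case: p q h1 h2 => [a b] [c d] /= -> ->.
Qed.

Definition lexsorted v := forall k l : 'I_n, (k < l)%N -> lexlt (v k) (v l).

Lemma lexsorted_le v (k l : 'I_n) : lexsorted v -> lexlt (v k) (v l) -> (k < l)%N.
Proof.
move=> sv vkl; rewrite ltnNge; apply/negP; rewrite leq_eqVlt => /orP[/eqP/val_inj e|/sv h].
  by move: vkl; rewrite e lexlt_irr.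
by have := lexlt_trans vkl h; rewrite lexlt_irr.
Qed.

Lemma lexsorted_inj v : lexsorted v -> injective v.
Proof.
move=> sv k l e; apply: val_inj; case: (ltngtP k l) => // /sv; by rewrite e lexlt_irr.
Qed.

Definition lexrank v (i : 'I_n) : nat := #|[set j | lexlt (v j) (v i)]%SET|.

Lemma lexrank_lt v i : (lexrank v i < n)%N.
Proof.
rewrite /lexrank -[X in (_ < X)%N]card_ord -cardsT; apply: proper_card.
apply/properP; split; first exact: finset.subsetT.
by exists i; rewrite ?inE // lexlt_irr.
Qed.

Lemma lexrank_mono v i j : lexlt (v i) (v j) -> (lexrank v i < lexrank v j)%N.
Proof.
move=> ij; apply: proper_card; apply/properP; split.
  by apply/fintype.subsetP => k; rewrite !inE => ki; exact: lexlt_trans ij.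
by exists i; rewrite !inE ?ij // lexlt_irr.
Qed.

Lemma lexsort_ex v : injective v -> exists s : 'S_n, lexsorted (fun i => v (s i)).
Proof.
move=> vi; pose r i := Ordinal (lexrank_lt v i).
have ri : injective r.
  move=> i j /(congr1 val) /= e; apply: vi; apply/eqP/negPn/negP => /eqP ne.
  by have [/lexrank_mono|/lexrank_mono] := lexlt_total ne; rewrite e ltnn.
exists (perm ri)^-1%g => k l kl.
have rk i : lexrank v ((perm ri)^-1%g i) = i.
  by have := permKV (perm ri) i; rewrite permE => /(congr1 val).
have ne : v ((perm ri)^-1%g k) <> v ((perm ri)^-1%g l).
  by move=> /vi e; move: kl; rewrite -(rk k) -(rk l) e ltnn.
by have [//|/lexrank_mono] := lexlt_total ne; rewrite !rk ltnNge ltnW.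
Qed.

Lemma perm_mono (s : 'S_n) : (forall k l : 'I_n, (k < l)%N -> (s k < s l)%N) -> s = 1%g.
Proof.
move=> h; apply: no_descent => j hj; have hj' := ltnW hj.
by rewrite (apO s hj) (apO s hj') ltnW // h.
Qed.

Lemma lexsorted_uniq v (s : 'S_n) : lexsorted v -> lexsorted (fun i => v (s i)) -> s = 1%g.
Proof.
by move=> sv svs; apply: perm_mono => k l kl; apply: (lexsorted_le sv); exact: svs.
Qed.

(* [refines u v]: the labelled configuration v lies in the convex open cell of
   the sorted configuration u: points of u on distinct vertical lines stay
   ordered by abscissa, points on the same vertical line by ordinate. *)
Definition refines u v := forall k l : 'I_n, (k < l)%N ->
  ((u k).1 < (u l).1 -> (v k).1 < (v l).1) /\ ((u k).1 = (u l).1 -> (v k).2 < (v l).2).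

Lemma lexsorted1 u (k l : 'I_n) : lexsorted u -> (k < l)%N ->
  (u k).1 < (u l).1 \/ (u k).1 = (u l).1 /\ (u k).2 < (u l).2.
Proof.
by move=> su /su; rewrite /lexlt => /orP[|/andP[/eqP]]; [left|right].
Qed.

Lemma lexsorted_fst u (k l : 'I_n) : lexsorted u -> (k <= l)%N -> (u k).1 <= (u l).1.
Proof.
move=> su; rewrite leq_eqVlt => /orP[/eqP/val_inj -> //|kl].
by have [/ltW|[->]] := lexsorted1 su kl.
Qed.

Lemma refines_refl u : lexsorted u -> refines u u.
Proof. by move=> su k l kl; split=> // e; have [|[]//] := lexsorted1 su kl; rewrite e ltxx. Qed.

(** A cell meets each unordered configuration in at most one labelling. The indices to the left of a
    vertical line of u can be recognized in v, so s preserves the abscissae of u; on a single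
    vertical line the ordinates of v force s to be increasing. *)
Lemma refines_uniq u v (s : 'S_n) : lexsorted u -> refines u v ->
  refines u (fun i => v (s i)) -> s = 1%g.
Proof.
move=> su uv uvs.
have blk (k l : 'I_n) : (u k).1 < (u l).1 -> (v k).1 < (v l).1.
  move=> h; apply: (uv _ _ _).1 => //; rewrite ltnNge; apply/negP => /(lexsorted_fst su).
  by rewrite leNgt h.
have blks (k l : 'I_n) : (u k).1 < (u l).1 -> (v (s k)).1 < (v (s l)).1.
  move=> h; apply: (uvs _ _ _).1 => //; rewrite ltnNge; apply/negP => /(lexsorted_fst su).
  by rewrite leNgt h.
(* s maps the set of points on the left of a vertical line to itself *)
have pres (a : R) : s @: [set k | (u k).1 < a]%SET = [set k | (u k).1 < a]%SET.
  apply/eqP; rewrite eqEcard card_imset ?leqnn ?andbT; last exact: perm_inj.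
  apply/fintype.subsetP => _ /imsetP[k + ->]; rewrite !inE => ka; rewrite ltNge; apply/negP => ska.
  have : [set k | (u k).1 < a]%SET == s @: [set k | (u k).1 < a]%SET.
    rewrite eqEcard card_imset ?leqnn ?andbT; last exact: perm_inj.
    apply/fintype.subsetP => j; rewrite !inE => ja.
    apply/imsetP; exists (s^-1%g j); last by rewrite permKV.
    rewrite inE ltNge; apply/negP => sja.
    have := blks _ _ (lt_le_trans ka sja); rewrite permKV => h1.
    have := blk _ _ (lt_le_trans ja ska) => h2.
    by have := lt_trans h1 h2; rewrite ltxx.
  move=> /eqP/setP/(_ (s k)); rewrite imset_f ?inE // => h.
  by move: ska; rewrite leNgt h.
have su1 k : (u (s k)).1 = (u k).1.
  have mem a : ((u (s k)).1 < a) = ((u k).1 < a).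
    by have := pres a => /setP/(_ (s k)); rewrite mem_imset ?inE //; exact: perm_inj.
  by apply/eqP; rewrite eq_le !leNgt -mem ltxx mem ltxx.
apply: perm_mono => k l kl; rewrite ltnNge; apply/negP => lk.
have {}lk : (s l < s k)%N.
  by rewrite ltn_neqAle lk andbT; apply/eqP => /val_inj/perm_inj e; rewrite e ltnn in kl.
have e : (u k).1 = (u l).1.
  apply/eqP; rewrite eq_le (lexsorted_fst su (ltnW kl)) -su1 -(su1 k).
  exact: lexsorted_fst su (ltnW lk).
have h1 := (uvs _ _ kl).2 e.
have h2 : (v (s l)).2 < (v (s k)).2 by apply: (uv _ _ lk).2; rewrite !su1.
by have := lt_trans h1 h2; rewrite ltxx.
Qed.

Lemma ball_pairP (p q : R * R) (e : R) : ball p e q <-> `|p.1 - q.1| < e /\ `|p.2 - q.2| < e.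
Proof. by []. Qed.

Lemma refines_open u v : lexsorted u -> refines u v ->
  exists2 e, 0 < e & forall w, (forall i, ball (v i) e (w i)) -> refines u w.
Proof.
move=> su uv.
pose P (p : 'I_n * 'I_n) (e : R) := forall w : tup, (forall i, ball (v i) e (w i)) ->
  (p.1 < p.2)%N -> ((u p.1).1 < (u p.2).1 -> (w p.1).1 < (w p.2).1) /\
     ((u p.1).1 = (u p.2).1 -> (w p.1).2 < (w p.2).2).
have [[k l]|p e e' e'0 e'e h w hw|e e0 he] := @fin_eps R _ P.
- rewrite /P /=; case: (ltnP k l) => kl; last by exists 1.
  have [h1 h2] := uv _ _ kl; have [lt|[eq _]] := lexsorted1 su kl.
    exists (((v l).1 - (v k).1) / 2) => [|w hw _]; first by have := h1 lt; lra.
    split=> [_|e]; last by rewrite e ltxx in lt.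
    have [] := (ball_pairP _ _ _).1 (hw k); have [] := (ball_pairP _ _ _).1 (hw l).
    rewrite !ltr_distl => /andP[a1 a2] _ /andP[a3 a4] _; lra.
  exists (((v l).2 - (v k).2) / 2) => [|w hw _]; first by have := h2 eq; lra.
  split=> [e|_]; first by rewrite eq ltxx in e.
  have [] := (ball_pairP _ _ _).1 (hw k); have [] := (ball_pairP _ _ _).1 (hw l).
  rewrite !ltr_distl => _ /andP[a1 a2] _ /andP[a3 a4]; lra.
- by apply: h => i; exact: le_ball (hw i).
- by exists e => // w hw k l kl; exact: (he (k, l) w hw kl).
Qed.

End Lex.

(** * Relative position of neighbouring configurations *)

Section Cells.
Variables (R : realType) (n : nat) (K : set (R * R)) (x0 : conf n K).
Local Notation tup := ('I_n -> R * R).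
Local Notation X := (conf n K).
Local Notation lab := (lab x0).
Implicit Types (v w : tup) (x y z : X).

Lemma sorted_ex x : exists v, [/\ valid K v, lexsorted v & x = lab v].
Proof.
have [v hv ->] := lab_surj x0 x; have [s sv] := lexsort_ex hv.2.
by exists (fun i => v (s i)); split; [exact: valid_perm|exact: sv|rewrite lab_perm].
Qed.

Definition srt x : tup := sval (cid (sorted_ex x)).

Lemma srt_valid x : valid K (srt x). Proof. by case: (svalP (cid (sorted_ex x))). Qed.
Lemma srt_sorted x : lexsorted (srt x). Proof. by case: (svalP (cid (sorted_ex x))). Qed.
Lemma srtK x : lab (srt x) = x. Proof. by case: (svalP (cid (sorted_ex x))). Qed.

Lemma srt_lab v : valid K v -> exists s : 'S_n, forall i, v i = srt (lab v) (s i).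
Proof.
by move=> hv; apply/(lab_eqP x0 (srt_valid _) hv); rewrite srtK.
Qed.

Lemma srt_sortedE v : valid K v -> lexsorted v -> srt (lab v) = v.
Proof.
move=> hv sv; have [s es] := srt_lab hv.
have s1 : s = 1%g.
  by apply: (lexsorted_uniq (srt_sorted (lab v))) => k l kl; rewrite -!es; exact: sv.
by apply/funext => i; rewrite es s1 perm1.
Qed.

(* Only meaningful when y lies in the cell of x; 1 otherwise. *)
Definition relpos x y : 'S_n :=
  if pselect (exists s : 'S_n, refines (srt x) (fun i => srt y (s i))) is left h
  then sval (cid h) else 1%g.

Lemma relposP x v : valid K v -> refines (srt x) v ->
  forall i, v i = srt (lab v) (relpos x (lab v) i).
Proof.
move=> hv xv; have [s es] := srt_lab hv.
have rs : refines (srt x) (fun i => srt (lab v) (s i)).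
  by have <- : v = (fun i => srt (lab v) (s i)) by apply/funext.
rewrite /relpos; case: pselect => [h|[]]; last by exists s.
case: cid => q /= rq i.
have : (q * s^-1)%g = 1%g.
  apply: (refines_uniq (srt_sorted x) rs) => k l kl.
  by rewrite !permM !permKV; exact: rq.
by move=> /(congr1 (fun p => (p * s)%g)); rewrite mulgVK mul1g => ->; exact: es.
Qed.

Definition incell x y := refines (srt x) (fun i => srt y (relpos x y i)).

Lemma incell_lab x v : valid K v -> refines (srt x) v -> incell x (lab v).
Proof.
move=> hv xv; rewrite /incell.
by have <- : v = (fun i => srt (lab v) (relpos x (lab v) i)) by apply/funext/relposP.
Qed.

Lemma relpos_uniq x y (s : 'S_n) : refines (srt x) (fun i => srt y (s i)) -> relpos x y = s.
Proof.
move=> h; have hv := valid_perm s (srt_valid y).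
have := relposP hv h; rewrite lab_perm ?srtK //; last exact: srt_valid.
by move=> e; apply/permP => i; apply: (srt_valid y).2; rewrite -e.
Qed.

Lemma relpos_self x : relpos x x = 1%g.
Proof.
apply: relpos_uniq => k l kl; rewrite !perm1.
exact: (refines_refl (srt_sorted x) kl).
Qed.

Lemma incell_self x : incell x x.
Proof. by move=> k l kl; rewrite relpos_self !perm1; exact: (refines_refl (srt_sorted x) kl). Qed.

(** A small motion of y stays in the open cell of y, and also in that of x for the labelling
    inherited from x; the uniqueness of relative positions then gives the composition rule. *)
Lemma cell_near x y (e : R) : incell x y -> 0 < e -> \forall z \near y,
  [/\ incell y z, incell x z, relpos x z = (relpos x y * relpos y z)%g &
    forall i, ball (srt y i) e (srt z (relpos y z i))].
Proof.
move=> xy e0.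
have [e1 e10 he1] := refines_open (srt_sorted y) (refines_refl (srt_sorted y)).
have [e2 e20 he2] := refines_open (srt_sorted x) xy.
pose d := Num.min e (Num.min e1 e2).
have d0 : 0 < d by rewrite !lt_min e0 e10.
have dle : [/\ d <= e, d <= e1 & d <= e2].
  by split; rewrite /d !ge_min lexx ?orbT.
have [de de1 de2] := dle.
have nb i : nbhs (srt y i) (ball (srt y i) d) by exact: nbhsx_ballx.
have := lab_near x0 (srt_valid y) nb; rewrite srtK.
apply: filterS => z [w [hw zE] wd]; subst z.
have yw : refines (srt y) w by apply: he1 => i; exact: le_ball (wd i).
have E := relposP hw yw.
have xw : refines (srt x) (fun i => srt (lab w) ((relpos x y * relpos y (lab w))%g i)).
  apply: he2 => i; rewrite permM -E; exact: le_ball (wd _).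
have r := relpos_uniq xw.
split=> //; first exact: incell_lab.
  by rewrite /incell r.
by move=> i; rewrite -E; exact: le_ball (wd i).
Qed.

Lemma relpos_cocycle_cell x y : incell x y ->
  \forall z \near y, relpos x z = (relpos x y * relpos y z)%g.
Proof. by move=> /cell_near /(_ ltr01); apply: filterS => z []. Qed.

Lemma relpos_cocycle : cocycle relpos.
Proof.
move=> x; apply: filterS (cell_near (incell_self x) ltr01) => y [/relpos_cocycle_cell h _ _ _].
exact: h.
Qed.

(* A pair inverted between x and y has distinct abscissae in y, so it keeps its
   order near y. *)
Lemma relpos_additive x y z : incell x y -> incell y z ->
  forall k l, (k < l)%N -> (l < n)%N -> (ap (relpos x y) l < ap (relpos x y) k)%N ->
     (ap (relpos x y * relpos y z)%g l < ap (relpos x y * relpos y z)%g k)%N.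
Proof.
move=> xy yz k l kl ln; have kn := ltn_trans kl ln.
rewrite !apM (apO _ ln) (apO _ kn) => lk; rewrite !apE.
set p := relpos x y (Ordinal ln) in lk *; set q := relpos x y (Ordinal kn) in lk *.
have h1 := xy (Ordinal kn) (Ordinal ln) kl; rewrite -/p -/q in h1.
have h2 := yz p q lk.
have [lt|[eq lt]] := lexsorted1 (srt_sorted y) lk.
  apply: (lexsorted_le (srt_sorted z)).
  by rewrite /lexlt (h2.1 lt).
have [x1|[x1 _]] := lexsorted1 (srt_sorted x) (kl : (Ordinal kn < Ordinal ln)%N).
  by have := h1.1 x1; rewrite eq ltxx.
by have := lt_trans lt (h1.2 x1); rewrite ltxx.
Qed.

Section Braided.
Variables (G : groupType) (g : nat -> G).
Hypothesis gB : braid_rel n g.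

Definition crossing x y : G := pbraid g (relpos x y).

(** By [relpos_additive] lengths add in the cocycle relation of [relpos], which is the hypothesis
    under which [pbraid] is multiplicative. *)
Lemma crossing_cell x y : incell x y ->
  \forall z \near y, crossing x z = (crossing x y * crossing y z)%g.
Proof.
move=> xy; apply: filterS (cell_near xy ltr01) => z [yz _ e _].
rewrite /crossing e (pbraidM gB) //; exact: relpos_additive.
Qed.

Lemma crossing_cocycle : cocycle crossing.
Proof.
move=> x; apply: filterS (cell_near (incell_self x) ltr01) => y [_ /crossing_cell h _ _].
exact: h.
Qed.

End Braided.

(** Ranks jump when two points cross a vertical line together; the labelling inherited from the
    centre of the cell follows the points continuously. *)
Lemma local_lift (U : topologicalType) (f : U -> X) x (t : U) :
  continuous f -> incell x (f t) ->
  forall i, {for t, continuous (fun u => srt (f u) (relpos x (f u) i))}.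
Proof.
move=> cf xt i A /nbhs_ballP[e /= e0 he].
have h : \forall u \near t, [/\ incell (f t) (f u), incell x (f u),
    relpos x (f u) = (relpos x (f t) * relpos (f t) (f u))%g &
    forall j, ball (srt (f t) j) e (srt (f u) (relpos (f t) (f u) j))].
  exact: (cf t _ (cell_near xt e0)).
suff: \forall u \near t, A (srt (f u) (relpos x (f u) i)) by [].
apply: filterS h => u /= [_ _ r hb].
by apply: he; rewrite /= r permM; exact: hb.
Qed.

End Cells.

(** * Braid groups of convex regions *)

Section LabelledPaths.
Variables (R : realType) (n : nat) (K : set (R * R)) (x0 : conf n K).
Local Notation tup := ('I_n -> R * R).
Local Notation lab := (lab x0).
Local Notation c01 := (clip (0 : R) 1).
Implicit Types (a b : R -> tup) (S : tup -> Prop).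

Definition lcontinuous (a : R -> tup) := forall i, continuous (fun t => a t i).
Definition lin S (a : R -> tup) := forall t, 0 <= t <= 1 -> S (a t).
(** Clipping makes the path continuous on the whole line while a needs to be valid on [0, 1]
    only. *)
Definition lpath (a : R -> tup) (t : R) : conf n K := lab (a (c01 t)).
Definition lcat (a b : R -> tup) (t : R) : tup :=
  fun i => cat (fun s => a s i) (fun s => b s i) t.
Definition seg (u v : tup) (t : R) : tup := fun i =>
  ((1 - t) * (u i).1 + t * (v i).1, (1 - t) * (u i).2 + t * (v i).2).

Lemma c01_itv t : 0 <= c01 t <= 1. Proof. exact: clip_itv ler01. Qed.
Lemma c01_id t : 0 <= t <= 1 -> c01 t = t. Proof. exact: clip_id. Qed.

Lemma c01_le0 t : t <= 0 -> c01 t = 0.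
Proof. by move=> h; rewrite /clip min_r ?max_l // (le_trans h). Qed.
Lemma c01_ge1 t : 1 <= t -> c01 t = 1.
Proof. by move=> h; rewrite /clip min_l ?max_r. Qed.

Lemma continuous_convex (U : topologicalType) (k p q : U -> R) :
  continuous k -> continuous p -> continuous q ->
  continuous (fun u => (1 - k u) * p u + k u * q u).
Proof.
move=> ck cp cq u; apply: cvgD; apply: cvgM; [exact: (continuous_cB ck)|exact: cp|exact: ck|exact: cq].
Qed.

Lemma continuous_seg (U : topologicalType) (u v : U -> tup) (k : U -> R) i :
  continuous k -> continuous (fun s => u s i) -> continuous (fun s => v s i) ->
  continuous (fun s => seg (u s) (v s) (k s) i).
Proof.
move=> ck cu cv; have c1 (w : U -> tup) : continuous (fun s => w s i) ->
    continuous (fun s => (w s i).1) /\ continuous (fun s => (w s i).2).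
  by move=> cw; split=> s; apply: continuous_comp; try exact: cw; [exact: cvg_fst|exact: cvg_snd].
have [u1 u2] := c1 _ cu; have [v1 v2] := c1 _ cv.
by apply: continuous_pair; exact: continuous_convex.
Qed.

Lemma seg_lcontinuous u v : lcontinuous (seg u v).
Proof.
move=> i; apply: (@continuous_seg R (fun=> u) (fun=> v)); first exact: continuous_idR.
  by move=> t; exact: cvg_cst.
by move=> t; exact: cvg_cst.
Qed.

Lemma seg0 u v : seg u v 0 = u.
Proof. by apply/funext => i; rewrite /seg subr0 !mul1r !mul0r !addr0 -surjective_pairing. Qed.
Lemma seg1 u v : seg u v 1 = v.
Proof. by apply/funext => i; rewrite /seg subrr !mul1r !mul0r !add0r -surjective_pairing. Qed.

Lemma lpath_continuous a : lcontinuous a -> lin (valid K) a -> continuous (lpath a).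
Proof.
move=> ca va; apply: (@lab_continuous R n K x0 R (fun t => a (c01 t))) => [i|t].
  by apply: continuous_comp2 (@clip_continuous R 0 1) (ca i).
exact/va/c01_itv.
Qed.

Lemma lpath0 a : lpath a 0 = lab (a 0). Proof. by rewrite /lpath c01_id ?lexx ?ler01. Qed.
Lemma lpath1 a : lpath a 1 = lab (a 1). Proof. by rewrite /lpath c01_id ?lexx ?ler01. Qed.

Lemma lcat_continuous a b : lcontinuous a -> lcontinuous b -> a 1 = b 0 ->
  lcontinuous (lcat a b).
Proof. by move=> ca cb ab i; apply: cat_continuous; rewrite ?ab. Qed.

Lemma lcat_in S a b : lin S a -> lin S b -> lin S (lcat a b).
Proof.
move=> ha hb t ht; rewrite /lcat /cat; case: leP => h; [apply: ha; lra|apply: hb; lra].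
Qed.

Lemma lcat0 a b : lcat a b 0 = a 0.
Proof. by apply/funext => i; rewrite /lcat /cat mulr0 sub0r oppr_le0 ler01. Qed.
Lemma lcat1 a b : lcat a b 1 = b 1.
Proof.
by apply/funext => i; rewrite /lcat /cat mulr1 (_ : 2 - 1 = 1 :> R) ?ler10 //; lra.
Qed.

Lemma lpath_lcat a b t : 0 <= t <= 1 -> lpath (lcat a b) t = cat (lpath a) (lpath b) t.
Proof.
move=> ht; rewrite /lpath c01_id // /cat /lcat /cat.
by case: leP => h; rewrite c01_id //; lra.
Qed.

Section Star.
Variables (S : tup -> Prop) (o : tup).
Hypothesis S_valid : forall v, S v -> valid K v.
Hypothesis S_star : forall v t, S v -> 0 <= t <= 1 -> S (seg v o t).

(** On the first third of the time [w] pulls the start of a to o, on the last third it lets the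
    points go to the end of a; on the middle third [rho] runs through [0, 1] while [w] is 1 and
    every point is held at o. Hence [through a] depends only on the ends of a. *)
Let rho (t : R) : R := c01 (3 * t - 1).
Let w (t : R) : R := c01 (Num.min (3 * t) (3 - 3 * t)).

Let rho_continuous : continuous rho.
Proof.
apply: continuous_comp2 (@clip_continuous R 0 1).
exact: continuous_affine (@continuous_idR R).
Qed.

Let w_continuous : continuous w.
Proof.
apply: continuous_comp2 (@clip_continuous R 0 1).
apply: continuous_minr; first exact: continuous_affine1 (@continuous_idR R).
exact: continuous_cB (continuous_affine1 (@continuous_idR R)).
Qed.

Let through a (t : R) : conf n K := lab (seg (a (rho t)) o (w t)).

Let star_through a : lcontinuous a -> lin S a -> hpt (lpath a) (through a).
Proof.
move=> ca Sa; have ca' := lpath_continuous ca (fun t ht => S_valid (Sa t ht)).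
have rho0 : rho 0 = 0 by rewrite /rho /clip mulr0 sub0r min_r ?max_l; lra.
have rho1 : rho 1 = 1 by rewrite /rho /clip mulr1 min_l ?max_r ?ler01; lra.
have w0 : w 0 = 0 by rewrite /w /clip mulr0 [Num.min 0 _]min_l ?min_r ?max_r; lra.
have w1 : w 1 = 0 by rewrite /w /clip mulr1 subrr [Num.min 3 0]min_r ?min_r ?max_r; lra.
apply: (@hpt_trans _ _ _ (fun t => lpath a (rho t))).
  apply: (@hpt_reparam _ _ (lpath a) _ _ id rho) => //.
  exact: continuous_idR.
have itv s t : 0 <= c01 s * w t <= 1.
  have /andP[a0 a1] := c01_itv s; have /andP[b0 b1] := c01_itv (Num.min (3 * t) (3 - 3 * t)).
  by rewrite mulr_ge0 //= mulr_ile1.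
exists (fun u : R * R => lab (seg (a (rho u.1)) o (c01 u.2 * w u.1))).
  apply: (@lab_continuous R n K x0 (R * R)%type
    (fun u : R * R => seg (a (rho u.1)) o (c01 u.2 * w u.1))) => [i|u].
    have cr : continuous (fun u : R * R => a (rho u.1) i).
      apply: (@continuous_comp2 _ _ _ _ (fun t => a t i)) (ca i).
      exact: continuous_comp2 (@continuous_fst2 R) rho_continuous.
    apply: (@continuous_seg _ (fun u : R * R => a (rho u.1)) (fun=> o)) => //.
      move=> u; apply: cvgM.
        exact: (continuous_comp2 (@continuous_snd2 R) (@clip_continuous R 0 1)).
      exact: (continuous_comp2 (@continuous_fst2 R) w_continuous).
    by move=> u; exact: cvg_cst.
  by apply: S_valid; apply: S_star; [apply/Sa/c01_itv|exact: itv].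
have cc t : c01 (rho t) = rho t by apply: c01_id; exact: c01_itv.
split=> [t ht|t ht|s hs|s hs] /=.
- by rewrite c01_id ?lexx ?ler01 // mul0r seg0 /lpath cc.
- by rewrite c01_id ?lexx ?ler01 // mul1r.
- by rewrite w0 mulr0 seg0 /lpath cc.
- by rewrite w1 mulr0 seg0 /lpath cc.
Qed.

Lemma star_hpt a b : lcontinuous a -> lcontinuous b -> lin S a -> lin S b ->
  a 0 = b 0 -> a 1 = b 1 -> hpt (lpath a) (lpath b).
Proof.
move=> ca cb Sa Sb e0 e1.
apply: hpt_trans (star_through ca Sa) _.
rewrite (_ : through a = through b); first exact/hpt_sym/star_through.
apply/funext => t; rewrite /through.
case: (leP (3 * t - 1) 0) => h1.
  have -> : rho t = 0 by exact: c01_le0.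
  by rewrite e0.
case: (leP 1 (3 * t - 1)) => h2.
  have -> : rho t = 1 by exact: c01_ge1.
  by rewrite e1.
have -> : w t = 1; last by rewrite !seg1.
apply: c01_ge1; rewrite le_min; clear e0 e1.
by apply/andP; split; lra.
Qed.

End Star.
End LabelledPaths.

Section Pairs.
Variable R : realType.
Implicit Types p q : R * R.

Definition sg p p' (t : R) : R * R := ((1 - t) * p.1 + t * p'.1, (1 - t) * p.2 + t * p'.2).

(** The vector from p to q has a direction in [0, pi]. Such vectors do not form a convex set,
    opposite horizontal ones being allowed; whence the strict inequality at one end in [up_sg1] and
    [up_sg2]. *)
Definition up p q : Prop := p.2 < q.2 \/ p.2 = q.2 /\ p.1 <> q.1.

Lemma up_sg1 p q p' q' t : 0 <= t <= 1 -> p.2 < q.2 -> up p' q' -> up (sg p p' t) (sg q q' t).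
Proof.
move=> /andP[t0]; rewrite le_eqVlt => /orP[/eqP ->|t1] pq pq'.
  by rewrite /sg subrr !mul0r !mul1r !add0r /up /=.
left; rewrite /sg /=; have pq2 : p'.2 <= q'.2 by case: pq' => [/ltW|[-> _]].
nra.
Qed.

Lemma up_sg2 p q p' q' t : 0 <= t <= 1 -> up p q -> p'.2 < q'.2 -> up (sg p p' t) (sg q q' t).
Proof.
move=> /andP[]; rewrite le_eqVlt => /orP[/eqP <-|t0] t1 pq pq'.
  by rewrite /sg subr0 !mul0r !mul1r !addr0 /up /=.
left; rewrite /sg /=; have pq2 : p.2 <= q.2 by case: pq => [/ltW|[-> _]].
nra.
Qed.

Lemma convex_lt (a b c d t : R) : 0 <= t <= 1 -> a < b -> c < d ->
  (1 - t) * a + t * c < (1 - t) * b + t * d.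
Proof.
move=> /andP[t0 t1] ab cd; case: (ltP t 1) => t1'; last by have -> : t = 1; lra.
have h1 : 0 < (1 - t) * (b - a) by rewrite mulr_gt0 ?subr_gt0.
have h2 : 0 <= t * (d - c) by rewrite mulr_ge0 // subr_ge0 ltW.
lra.
Qed.

Lemma lexlt_sg p q p' q' t : 0 <= t <= 1 -> lexlt p q -> lexlt p' q' ->
  lexlt (sg p p' t) (sg q q' t).
Proof.
rewrite /lexlt /sg /= => /andP[t0 t1] /orP[h|/andP[/eqP e h]] /orP[h'|/andP[/eqP e' h']].
- by rewrite convex_lt ?t0.
- case: (ltP t 1) => t1'; first by apply/orP; left; nra.
  have -> : t = 1 by lra.
  by apply/orP; right; rewrite subrr !mul0r !mul1r !add0r e' eqxx.
- case: (ltP 0 t) => t0'; first by apply/orP; left; nra.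
  have -> : t = 0 by lra.
  by apply/orP; right; rewrite subr0 !mul0r !mul1r !addr0 e eqxx.
- by apply/orP; right; rewrite e e' eqxx /= convex_lt ?t0.
Qed.

End Pairs.

(** * Canonical positive braids in a convex region *)

Section ConvexBraids.
Variables (R : realType) (n : nat) (K : set (R * R)) (x0 : conf n K).
Local Notation tup := ('I_n -> R * R).
Local Notation lab := (lab x0).
Local Notation lpath := (lpath x0).
Local Notation c01 := (clip (0 : R) 1).

Definition bt : tup := fun i => base_point R n i.
Definition beta (i : 'I_n) : R := (base_point R n i).1.
Arguments beta : simpl never.

Hypothesis convK : forall p q t, K p -> K q -> 0 <= t <= 1 -> K (sg p q t).
Hypothesis discK : forall p, disc R p -> K p.
Hypothesis x0E : x0 = lab bt.

Lemma beta_lt (k l : 'I_n) : (k < l)%N -> beta k < beta l.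
Proof.
move=> kl; rewrite /beta /base_point /= ltrD2r ltr_pM2r ?ltr_nat; first lia.
by rewrite invr_gt0 ltr0n; case: k kl => k /=; lia.
Qed.

Lemma beta_itv (k : 'I_n) : -1 <= beta k <= 1.
Proof.
have := base_point_disc R (ltn_ord k); rewrite /disc /= expr0n addr0 -[_ - 1]/(beta k) => h.
by apply/andP; split; nra.
Qed.

Lemma beta_inj (k l : 'I_n) : beta k = beta l -> k = l.
Proof.
by case: (ltngtP k l) => [/beta_lt h|/beta_lt h|/val_inj //] e; rewrite e ltxx in h.
Qed.

(** The reason for the halves in the configurations below: a square of side 1 about the origin fits
    in the disc. The first coordinate of [col] is written 0 / 2 to match. *)
Lemma half_in (a b : R) : -1 <= a <= 1 -> -1 <= b <= 1 -> K (a / 2, b / 2).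
Proof. by move=> /andP[a0 a1] /andP[b0 b1]; apply: discK; rewrite /disc /=; nra. Qed.

Definition col : tup := fun i => (0 / 2, beta i / 2).
Definition vp (p : 'S_n) : tup := fun i => (beta (p i) / 2, beta i / 2).
Definition bp (p : 'S_n) : tup := fun i => bt (p i).
Definition ctr : tup := fun i => (beta i / 2, beta i / 2).

Lemma bt_in i : K (bt i). Proof. exact/discK/base_point_disc. Qed.
Lemma col_in i : K (col i). Proof. by apply: half_in; [lra|exact: beta_itv]. Qed.
Lemma vp_in p i : K (vp p i). Proof. by apply: half_in; exact: beta_itv. Qed.
Lemma ctr_in i : K (ctr i). Proof. by apply: half_in; exact: beta_itv. Qed.

(* Regions of labelled configurations that are star-shaped about ctr: the pairs
   in C may turn counterclockwise by at most pi, the others keep their order. *)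
Definition reg (C : 'I_n -> 'I_n -> Prop) (v : tup) : Prop := (forall i, K (v i)) /\
  forall k l : 'I_n, (k < l)%N ->
    (C k l -> up (v k) (v l)) /\ (~ C k l -> lexlt (v k) (v l)).

Lemma reg_valid C v : reg C v -> valid K v.
Proof.
move=> [h1 h2]; split=> // i j e; apply: val_inj.
have ne (k l : 'I_n) : (k < l)%N -> v k <> v l.
  move=> /h2[a1 a2] ekl; case: (pselect (C k l)) => [/a1|/a2].
    by rewrite ekl => -[|[_]]; rewrite ?ltxx.
  by rewrite ekl lexlt_irr.
by case: (ltngtP i j) => // /ne; rewrite e.
Qed.

Lemma seg_in C u v : (forall i, K (u i)) -> (forall i, K (v i)) ->
  (forall k l : 'I_n, (k < l)%N ->
    (C k l -> ((u k).2 < (u l).2 /\ up (v k) (v l)) \/ (up (u k) (u l) /\ (v k).2 < (v l).2)) /\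
    (~ C k l -> lexlt (u k) (u l) /\ lexlt (v k) (v l))) ->
  lin (reg C) (seg u v).
Proof.
move=> Ku Kv h t ht; split=> [i|k l kl]; first exact: convK.
have [h1 h2] := h _ _ kl; split=> [/h1[[a b]|[a b]]|/h2[a b]].
- exact: up_sg1.
- exact: up_sg2.
- exact: lexlt_sg.
Qed.

Lemma reg_star C v t : reg C v -> 0 <= t <= 1 -> reg C (seg v ctr t).
Proof.
move=> [Kv hv] ht; apply: seg_in => //; first exact: ctr_in.
move=> k l kl; have [h1 h2] := hv _ _ kl; have b := beta_lt kl.
split=> [/h1 c|/h2 c]; first by right; split=> //; rewrite /ctr /=; lra.
by split=> //; rewrite /lexlt /ctr /=; apply/orP; left; lra.
Qed.

Lemma bt_lexsorted : lexsorted bt.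
Proof. by move=> k l /beta_lt kl; apply/orP; left; exact: kl. Qed.

(** The positive braid of p: the row becomes a column, ranks turning into heights; the column
    spreads sideways according to p; the points return to the axis. Pairs inverted by p turn
    counterclockwise by pi in all, the others turn back. *)
Definition tau (p : 'S_n) : R -> tup :=
  lcat (seg bt col) (lcat (seg col (vp p)) (seg (vp p) (bp p))).

Lemma tau0 p : tau p 0 = bt. Proof. by rewrite /tau lcat0 seg0. Qed.
Lemma tau1 p : tau p 1 = bp p. Proof. by rewrite /tau !lcat1 seg1. Qed.

Lemma tau_continuous p : lcontinuous (tau p).
Proof.
apply: lcat_continuous; [exact: seg_lcontinuous| |by rewrite seg1 lcat0 seg0].
by apply: lcat_continuous; [exact: seg_lcontinuous|exact: seg_lcontinuous|rewrite seg1 seg0].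
Qed.

Lemma tau_pieces C (p : 'S_n) :
  (forall k l : 'I_n, (k < l)%N -> ~ C k l -> (p k < p l)%N) ->
  [/\ lin (reg C) (seg bt col), lin (reg C) (seg col (vp p)) &
      lin (reg C) (seg (vp p) (bp p))].
Proof.
move=> hC; split; apply: seg_in => //; try exact: bt_in; try exact: col_in;
  try exact: vp_in; try (by move=> i; exact: bt_in); move=> k l kl; have b := beta_lt kl.
- split=> _; [right|]; split.
  + by right; split=> // /beta_inj e; rewrite e ltnn in kl.
  + by rewrite /col /=; lra.
  + exact: bt_lexsorted.
  + by rewrite /lexlt /col /= eqxx /=; apply/orP; right; lra.
- split=> [_|/(hC _ _ kl)/beta_lt b']; [left|]; split.
  + by rewrite /col /=; lra.
  + by left; rewrite /vp /=; lra.
  + by rewrite /lexlt /col /= eqxx /=; apply/orP; right; lra.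
  + by rewrite /lexlt /vp /=; apply/orP; left; lra.
- split=> [_|/(hC _ _ kl)/beta_lt b']; [left|]; split.
  + by rewrite /vp /=; lra.
  + by right; split=> // /beta_inj/perm_inj e; rewrite e ltnn in kl.
  + by rewrite /lexlt /vp /=; apply/orP; left; lra.
  + by apply/orP; left; exact: b'.
Qed.

Lemma tau_in C (p : 'S_n) :
  (forall k l : 'I_n, (k < l)%N -> ~ C k l -> (p k < p l)%N) -> lin (reg C) (tau p).
Proof. by move=> /tau_pieces[h1 h2 h3]; do 2!apply: lcat_in => //. Qed.

Lemma tau_path p : continuous (lpath (tau p)).
Proof.
apply: lpath_continuous; first exact: tau_continuous.
by move=> t ht; apply: reg_valid (tau_in (C := fun _ _ => True) _ ht).
Qed.

Lemma lab_bp p : lab (bp p) = x0.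
Proof.
rewrite {2}x0E; apply: lab_perm; split; first exact: bt_in.
exact: lexsorted_inj bt_lexsorted.
Qed.

Lemma tau_loop p : is_loop x0 (lpath (tau p)).
Proof.
split; first exact: tau_path.
  by rewrite lpath0 tau0.
by rewrite lpath1 tau1 lab_bp.
Qed.

Definition tcls (p : 'S_n) : pi1 R x0 := cls x0 (lpath (tau p)).

(** Joins x to the base configuration without changing any lexicographic rank; it closes up the open
    paths in [based]. *)
Definition pcan (x : conf n K) : R -> conf n K := lpath (seg (srt x0 x) bt).

Lemma pcan_in x : lin (reg (fun _ _ => False)) (seg (srt x0 x) bt).
Proof.
apply: seg_in; [exact: (srt_valid x0 x).1|exact: bt_in|].
by move=> k l kl; split=> // _; split; [exact: srt_sorted|exact: bt_lexsorted].
Qed.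

Lemma pcan_continuous x : continuous (pcan x).
Proof.
apply: lpath_continuous; first exact: seg_lcontinuous.
by move=> t ht; apply: reg_valid (pcan_in x ht).
Qed.

Lemma pcan0 x : pcan x 0 = x. Proof. by rewrite /pcan lpath0 seg0 srtK. Qed.
Lemma pcan1 x : pcan x 1 = x0. Proof. by rewrite /pcan lpath1 seg1. Qed.

(** Both sides are labelled paths from [srt x0 x] to [bp p] in the region where only the pairs on a
    common vertical line of x may turn, so [star_hpt] applies. *)
Lemma cell_move x (a : R -> tup) : lcontinuous a ->
  (forall t, 0 <= t <= 1 -> refines (srt x0 x) (a t)) ->
  (forall t, 0 <= t <= 1 -> valid K (a t)) -> a 0 = srt x0 x ->
  hpt (cat (lpath a) (pcan (lab (a 1)))) (cat (pcan x) (lpath (tau (relpos x0 x (lab (a 1)))))).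
Proof.
move=> ca ra va a0; set y := lab (a 1); set p := relpos x0 x y.
have i01 : 0 <= (0 : R) <= 1 by rewrite lexx ler01.
have i11 : 0 <= (1 : R) <= 1 by rewrite lexx ler01.
have ap1 i : a 1 i = srt x0 y (p i) := relposP (va 1 i11) (ra 1 i11) i.
pose C (k l : 'I_n) := (srt x0 x k).1 = (srt x0 x l).1.
have nC (k l : 'I_n) : (k < l)%N -> ~ C k l -> (srt x0 x k).1 < (srt x0 x l).1.
  by move=> /(lexsorted1 (srt_sorted x0 x))[//|[]].
have pC (k l : 'I_n) : (k < l)%N -> ~ C k l -> (p k < p l)%N.
  move=> kl /(nC _ _ kl) h; apply: (lexsorted_le (srt_sorted x0 y)).
  by rewrite -!ap1 /lexlt (ra 1 i11 _ _ kl).1.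
have e1 : hpt (cat (lpath a) (pcan y)) (lpath (lcat a (seg (a 1) (bp p)))).
  apply: hpt_eq => [|t ht].
    apply: cat_continuous; [exact: lpath_continuous|exact: pcan_continuous|].
    by rewrite lpath1 pcan0.
  rewrite lpath_lcat // /cat; case: ifP => // h; rewrite /pcan /lpath.
  have hv : valid K (seg (srt x0 y) bt (c01 (2 * t - 1))).
    by apply: reg_valid (pcan_in y _); exact: c01_itv.
  (* The points of [pcan y] are relabelled by p in order to continue the labels of a. *)
  rewrite -(lab_perm x0 p hv); congr (lab _); apply/funext => i.
  by rewrite /seg ap1.
have e2 : hpt (lpath (lcat (seg (srt x0 x) bt) (tau p))) (cat (pcan x) (lpath (tau p))).
  apply/hpt_sym/hpt_eq => [|t ht]; last by rewrite lpath_lcat.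
  apply: cat_continuous; [exact: pcan_continuous|exact: tau_path|].
  by rewrite pcan1 lpath0 tau0.
apply: hpt_trans e1 _; apply: hpt_trans e2.
have a1 : a 1 = seg (a 1) (bp p) 0 by rewrite seg0.
apply: (@star_hpt R n K x0 (reg C) ctr).
- exact: reg_valid.
- by move=> v t; exact: reg_star.
- by apply: lcat_continuous => //; exact: seg_lcontinuous.
- by apply: lcat_continuous; [exact: seg_lcontinuous|exact: tau_continuous|rewrite seg1 tau0].
- apply: lcat_in => [t ht|].
    split=> [i|k l kl]; first exact: (va t ht).1.
    have [h1 h2] := ra t ht _ _ kl.
    by split=> [/h2|/(nC _ _ kl)/h1 h]; [left|rewrite /lexlt h].
  apply: seg_in => [i|i|k l kl]; [exact: (va 1 i11).1|exact: bt_in|].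
  have [h1 h2] := ra 1 i11 _ _ kl.
  split=> [/h2 h|ckl].
    by left; split=> //; right; split=> // /beta_inj/perm_inj e; rewrite e ltnn in kl.
  split; first by rewrite /lexlt h1 //; exact: nC.
  by apply/orP; left; apply: beta_lt; exact: pC.
- apply: lcat_in; last by apply: tau_in => k l kl; exact: pC.
  apply: seg_in => [i|i|k l kl]; [exact: (srt_valid x0 x).1|exact: bt_in|].
  have b := beta_lt kl.
  split=> [ckl|ckl]; last by split; [exact: srt_sorted|exact: bt_lexsorted].
  left; split; last by right; split=> // /beta_inj e; rewrite e ltnn in kl.
  by have [|[//]] := lexsorted1 (srt_sorted x0 x) kl; rewrite ckl ltxx.
- by rewrite !lcat0 a0 seg0.
- by rewrite !lcat1 tau1 seg1.
Qed.

End ConvexBraids.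

(** * Generation by positive braids *)

Section Generation.
Variables (R : realType) (n : nat) (K : set (R * R)) (x0 : conf n K).
Local Notation tup := ('I_n -> R * R).
Local Notation lab := (lab x0).
Local Notation lpath := (lpath x0).
Local Notation srt := (srt x0).
Local Notation relpos := (relpos x0).
Local Notation incell := (incell x0).
Local Notation tcls := (tcls x0).
Local Notation pcan := (pcan x0).
Local Notation bt := (@bt R n).
Local Notation col := (@col R n).
Local Notation beta := (@beta R n).
Local Notation c01 := (clip (0 : R) 1).
Hypothesis convK : forall p q t, K p -> K q -> 0 <= t <= 1 -> K (sg p q t).
Hypothesis discK : forall p, disc R p -> K p.
Hypothesis x0E : x0 = lab bt.

Definition based (f : R -> conf n K) (t : R) : R -> conf n K := cat (sub f 0 t) (pcan (f t)).

Lemma based_loop (f : R -> conf n K) t : continuous f -> f 0 = x0 -> is_loop x0 (based f t).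
Proof.
move=> cf f0; split; rewrite /based ?cat0 ?cat1 ?sub0 ?(pcan1 x0E) //.
apply: cat_continuous; [exact: sub_continuous|exact: pcan_continuous|].
by rewrite sub1 pcan0.
Qed.

(** While f stays in the cell of f t0, the loop closed up at time t changes by the positive braid of
    the relative position, by [cell_move]. The time t may lie on either side of t0. *)
Lemma based_cell (f : R -> conf n K) (t0 t : R) : continuous f -> f 0 = x0 ->
  (forall s, 0 <= s <= 1 -> incell (f t0) (f (t0 + (t - t0) * s))) ->
  cls x0 (based f t) = (cls x0 (based f t0) * tcls (relpos (f t0) (f t)))%g.
Proof.
move=> cf f0 h; set x := f t0.
pose m s := t0 + (t - t0) * c01 s.
pose a s : tup := fun i => srt (f (m s)) (relpos x (f (m s)) i).
have cm : continuous m.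
  move=> s; apply: cvgD; first exact: cvg_cst.
  by apply: cvgM; [exact: cvg_cst|exact: clip_continuous].
have hm s : incell x (f (m s)) by apply: h; exact: c01_itv.
have va s : valid K (a s) by exact: valid_perm (srt_valid _ _).
have la s : lab (a s) = f (m s).
  by rewrite /a lab_perm ?srtK //; exact: srt_valid.
have m0 : m 0 = t0 by rewrite /m c01_id ?lexx ?ler01 // mulr0 addr0.
have m1 : m 1 = t by rewrite /m c01_id ?lexx ?ler01 // mulr1 addrC subrK.
have ca : lcontinuous a.
  move=> i s; apply: (@continuous_comp _ _ _ m (fun u => srt (f u) (relpos x (f u) i))).
    exact: cm.
  exact: local_lift.
have a0 : a 0 = srt x by apply/funext => i; rewrite /a m0 relpos_self perm1.
have := cell_move convK discK x0E ca (fun s _ => hm s) (fun s _ => va s) a0.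
rewrite la m1 => M.
have cla : continuous (lpath a) by apply: lpath_continuous => // s _.
have csub u v : continuous (sub f u v) by exact: sub_continuous.
have cp y : continuous (pcan y) by exact: pcan_continuous.
have ct p : continuous (lpath (tau p)) by exact: tau_path.
rewrite -cls_cat; [|exact: based_loop|exact: tau_loop].
apply/cls_eqP; [exact: based_loop|by apply: is_loop_cat; [exact: based_loop|exact: tau_loop]|].
apply: (@hpt_trans _ _ _ (cat (cat (sub f 0 t0) (sub f t0 t)) (pcan (f t)))).
  apply: hpt_cat; [exact/hpt_sym/hpt_subcat|exact: (hpt_refl (cp _))|].
  by rewrite sub1 pcan0.
have g1 : sub f 0 t0 1 = sub f t0 t 0 by rewrite sub1 sub0.
have g2 : sub f t0 t 1 = pcan (f t) 0 by rewrite sub1 pcan0.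
have g3 : sub f 0 t0 1 = pcan x 0 by rewrite sub1 pcan0.
have g4 : pcan x 1 = lpath (tau (relpos x (f t))) 0 by rewrite (pcan1 x0E) lpath0 tau0.
apply: hpt_trans (hpt_catA (csub _ _) (csub _ _) (cp _) g1 g2) _.
apply: hpt_trans _ (hpt_sym (hpt_catA (csub _ _) (cp _) (ct _) g3 g4)).
apply: hpt_cat; [exact: (hpt_refl (csub _ _))| |by rewrite cat0 sub1 sub0].
apply: hpt_trans M; apply: hpt_cat; [|exact: (hpt_refl (cp _))|by rewrite sub1 pcan0].
apply: hpt_eq => // s hs; rewrite /lpath la /m !c01_id ?c01_itv //.
Qed.

Lemma tcls1 : tcls 1%g = 1%g.
Proof.
have cf : continuous (fun _ : R => x0) by move=> t; exact: cvg_cst.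
have := @based_cell (fun=> x0) 0 0 cf erefl; rewrite relpos_self => e.
apply: (mulgI (cls x0 (based (fun=> x0) 0))).
by rewrite mulg1 -e // => s _; exact: incell_self.
Qed.

Section Triangle.
Variables (p : 'S_n) (j : nat).
Hypotheses (hj : (j.+1 < n)%N) (dj : (ap p^-1%g j < ap p^-1%g j.+1)%N).
Let jo : 'I_n := Ordinal (ltnW hj).
Let q : 'S_n := (p * adj j)%g.
Let xi (i : 'I_n) : R := if i == j.+1 :> nat then beta jo else beta i.
Let yv : tup := fun i => (xi (p i) / 2, beta i / 2).
(** The path is at the column at time 1, at [yv] at time 2, where the points of ranks j and j.+1
    share a vertical line, and at [vp R q] at time 3. It stays in the cell of the column from time 1
    on, and in the cell of [yv] from time 2 on. *)
Let al (t : R) : tup :=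
  seg (seg (seg bt col (c01 t)) yv (c01 (t - 1))) (vp R q) (c01 (t - 2)).
Let f (t : R) : conf n K := lab (al t).

Let al1 t : t <= 1 -> al t = seg bt col (c01 t).
Proof. by move=> ht; rewrite /al (@c01_le0 _ (t - 1)) ?(@c01_le0 _ (t - 2)) ?seg0 //; lra. Qed.

Let al2 t : 1 <= t -> al t = seg (seg col yv (c01 (t - 1))) (vp R q) (c01 (t - 2)).
Proof. by move=> ht; rewrite /al (@c01_ge1 _ t) // seg1. Qed.

Let al3 t : 2 <= t -> al t = seg yv (vp R q) (c01 (t - 2)).
Proof. by move=> ht; rewrite al2 ?(@c01_ge1 _ (t - 1)) ?seg1 //; lra. Qed.

Let al_im t i : 1 <= t -> (al t i).2 = beta i / 2.
Proof.
move=> ht; rewrite al2 // /seg /=; move: (c01 _) (c01 _) => a b; rewrite /col /=; ring.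
Qed.

Let al_in t i : K (al t i).
Proof.
apply: convK (c01_itv _); last exact: vp_in.
apply: convK (c01_itv _).
  by apply: convK (c01_itv _); [exact: bt_in|exact: col_in].
by apply: half_in => //; [rewrite /xi; case: ifP => _|]; exact: beta_itv.
Qed.

Let inc_valid (v : tup) : (forall i, K (v i)) ->
  (forall k l : 'I_n, (k < l)%N -> (v k).2 < (v l).2) -> valid K v.
Proof.
move=> Kv hv; split=> // k l e.
by case: (ltngtP k l) => [/hv|/hv|/val_inj //]; rewrite e ltxx.
Qed.

Let col_refines (v : tup) : (forall k l : 'I_n, (k < l)%N -> (v k).2 < (v l).2) -> refines col v.
Proof. by move=> h k l /h lt; split=> //; rewrite /col /= ltxx. Qed.

Let al_up t : 1 <= t -> forall k l : 'I_n, (k < l)%N -> (al t k).2 < (al t l).2.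
Proof. by move=> ht k l /(@beta_lt R n _ _) b; rewrite !al_im //; lra. Qed.

Let al_valid t : valid K (al t).
Proof.
case: (leP t 1) => ht; last by apply: inc_valid; [exact: al_in|exact/al_up/ltW].
have nT (k l : 'I_n) : (k < l)%N -> ~ True -> ((1%g : 'S_n) k < (1%g : 'S_n) l)%N by [].
have [h _ _] := tau_pieces convK discK nT.
by rewrite al1 //; exact: reg_valid (h _ (c01_itv t)).
Qed.

Let f_continuous : continuous f.
Proof.
apply: lab_continuous => // i.
have cc (a : R) : continuous (fun t : R => c01 (t - a)).
  apply: continuous_comp2 (@clip_continuous R 0 1).
  by move=> t; apply: cvgB; [exact: cvg_id|exact: cvg_cst].
have cst (v : tup) : continuous (fun _ : R => v i) by move=> t; exact: cvg_cst.
apply: (@continuous_seg R n R (fun t => seg (seg bt col (c01 t)) yv (c01 (t - 1)))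
  (fun=> vp R q) (fun t => c01 (t - 2))) => //.
apply: (@continuous_seg R n R (fun t => seg bt col (c01 t))
  (fun=> yv) (fun t => c01 (t - 1))) => //.
by apply: (@continuous_seg R n R (fun=> bt) (fun=> col)) => //; exact: clip_continuous.
Qed.

Let col_sorted : lexsorted col.
Proof.
move=> k l /(@beta_lt R n _ _) b; rewrite /lexlt /col /= eqxx /=; apply/orP; right; lra.
Qed.

Let f1 : srt (f 1) = col.
Proof.
have e : al 1 = col by rewrite al1 // c01_id ?lexx ?ler01 // seg1.
by rewrite /f e srt_sortedE // -e.
Qed.

Let pV (i : 'I_n) : p (p^-1%g i) = i. Proof. exact: permKV. Qed.

Let xi_lt (k l : 'I_n) : (k < l)%N -> ~ (k = j :> nat /\ l = j.+1 :> nat) -> xi k < xi l.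
Proof.
move=> kl ne; rewrite /xi; case: eqP => k1; case: eqP => l1; try lia.
- by apply: (@beta_lt R n _ _) => /=; lia.
- by apply: (@beta_lt R n _ _) => /=; lia.
- exact: (@beta_lt R n _ _).
Qed.

Let xi_eq (k l : 'I_n) : k = j :> nat -> l = j.+1 :> nat -> xi k = xi l.
Proof.
move=> kj lj; rewrite /xi lj eqxx kj (_ : (j == j.+1) = false); last lia.
by congr beta; exact: val_inj.
Qed.

Let pV_lt (k l : 'I_n) : k = j :> nat -> l = j.+1 :> nat -> (p^-1%g k < p^-1%g l)%N.
Proof. by move=> kj lj; rewrite -!apE kj lj. Qed.

Let y' : tup := fun i => yv (p^-1%g i).

(** The ascent hypothesis [dj] puts the two points of the shared line in the right order of
    height. *)
Let y'_sorted : lexsorted y'.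
Proof.
move=> k l kl; rewrite /lexlt /y' /yv /= !pV.
case: (pselect (k = j :> nat /\ l = j.+1 :> nat)) => [[kj lj]|ne].
  have := @beta_lt R n _ _ (pV_lt kj lj); rewrite (xi_eq kj lj) eqxx /= => b.
  by apply/orP; right; lra.
by have := xi_lt kl ne => b; apply/orP; left; lra.
Qed.

Let f2 : srt (f 2) = y'.
Proof.
have e : al 2 = yv by rewrite al3 // subrr c01_id ?lexx ?ler01 // seg0.
have vy : valid K yv by rewrite -e.
rewrite /f e -(lab_perm x0 p^-1%g vy) srt_sortedE //; exact: valid_perm.
Qed.

Let f3 : srt (f 3) = fun i => vp R q (q^-1%g i).
Proof.
have h32 : 3 - 2 = 1 :> R by lra.
have e : al 3 = vp R q.
  by rewrite al3; [rewrite h32 c01_id ?lexx ?ler01 // seg1|lra].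
have vz : valid K (vp R q) by rewrite -e.
have := lab_perm x0 q^-1%g vz; rewrite /f e => <-.
rewrite srt_sortedE //; first exact: valid_perm.
move=> k l /(@beta_lt R n _ _) b; rewrite /lexlt /vp /= !permKV; apply/orP; left; lra.
Qed.

Let y'_refines s : 0 <= s <= 1 -> refines y' (fun i => al (2 + s) (p^-1%g i)).
Proof.
move=> hs k l kl; have h2 : 2 <= 2 + s by lra.
split=> e.
  have ne : ~ (k = j :> nat /\ l = j.+1 :> nat).
    by move=> [kj lj]; move: e; rewrite /y' /yv /= !pV (xi_eq kj lj) ltxx.
  rewrite al3 // /seg /= (_ : 2 + s - 2 = s); last by ring.
  rewrite c01_id // !permM !pV; apply: convex_lt => //; first by have := xi_lt kl ne; lra.
  have : beta (adj j k) < beta (adj j l); last lra.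
  apply: beta_lt; rewrite -!apE !ap_adj //.
  by repeat case: eqP => ? //; lia.
rewrite !al_im; try lra.
have : beta (p^-1%g k) < beta (p^-1%g l); last lra.
apply: beta_lt; case: (pselect (k = j :> nat /\ l = j.+1 :> nat)) => [[kj lj]|ne].
  exact: pV_lt.
by move: e; rewrite /y' /yv /= !pV; have := xi_lt kl ne; lra.
Qed.

(** [based_cell] computes the loop closed up at time 3 in two ways, directly from time 1 and through
    time 2. *)
Lemma tclsS : tcls (p * adj j)%g = (tcls p * tcls (adj j))%g.
Proof.
have f0 : f 0 = x0.
  by rewrite /f al1 ?ler01 // c01_id ?lexx ?ler01 // seg0.
have f_in u s : 1 <= u -> 0 <= s <= 1 -> incell (f 1) (f (1 + (u - 1) * s)).
  move=> hu hs; apply: incell_lab; first exact: al_valid.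
  by rewrite f1; apply/col_refines/al_up; nra.
have f_in2 s : 0 <= s <= 1 -> incell (f 2) (f (2 + (3 - 2) * s)).
  move=> hs; rewrite (_ : (3 - 2) * s = s); last by ring.
  rewrite /f -(lab_perm x0 p^-1%g (al_valid (2 + s))).
  apply: incell_lab; first exact/valid_perm/al_valid.
  by rewrite -/(f 2) f2; exact: y'_refines.
have r12 : relpos (f 1) (f 2) = p.
  apply: relpos_uniq; rewrite f1 f2; apply: col_refines => k l /(@beta_lt R n _ _) b.
  by rewrite /y' /yv /= !permK; lra.
have r13 : relpos (f 1) (f 3) = q.
  apply: relpos_uniq; rewrite f1 f3; apply: col_refines => k l /(@beta_lt R n _ _) b.
  by rewrite /vp /= !permK; lra.
have r23 : relpos (f 2) (f 3) = adj j.
  apply: relpos_uniq; rewrite f2 f3.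
  have := y'_refines (s := 1); rewrite lexx ler01 => /(_ isT).
  have -> : al (2 + 1) = vp R q.
    have h : 2 + 1 - 2 = 1 :> R by lra.
    by rewrite al3; [rewrite h c01_id ?lexx ?ler01 // seg1|lra].
  have -> // : (fun i => vp R q (p^-1%g i)) = (fun i => vp R q (q^-1%g (adj j i))).
  by apply/funext => i; rewrite /q invMg permM permK.
have e12 := based_cell f_continuous f0 (t0 := 1) (t := 2) (fun s => f_in 2 s ltac:(lra)).
have e13 := based_cell f_continuous f0 (t0 := 1) (t := 3) (fun s => f_in 3 s ltac:(lra)).
have e23 := based_cell f_continuous f0 (t0 := 2) (t := 3) f_in2.
rewrite r12 in e12; rewrite r13 in e13; rewrite r23 e12 in e23.
apply: (mulgI (cls x0 (based f 1))).
by rewrite mulgA -e23 -e13.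
Qed.

End Triangle.
End Generation.

(** * Artin's group as a fundamental group *)

Section ConvexBraidGroup.
Variables (R : realType) (n : nat) (K : set (R * R)) (x0 : conf n K).
Local Notation tup := ('I_n -> R * R).
Local Notation lab := (lab x0).
Local Notation lpath := (lpath x0).
Local Notation srt := (srt x0).
Local Notation relpos := (relpos x0).
Local Notation incell := (incell x0).
Local Notation tcls := (tcls x0).
Local Notation pcan := (pcan x0).
Local Notation bt := (@bt R n).
Local Notation col := (@col R n).
Local Notation c01 := (clip (0 : R) 1).
Hypothesis convK : forall p q t, K p -> K q -> 0 <= t <= 1 -> K (sg p q t).
Hypothesis discK : forall p, disc R p -> K p.
Hypothesis x0E : x0 = lab bt.
Local Notation s := (fun k : nat => tcls (adj k)).

Lemma tcls_mem (P : pi1 R x0 -> Prop) : P 1%g -> (forall a b, P a -> P b -> P (a * b)%g) ->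
  (forall k, (k.+1 < n)%N -> P (s k)) -> forall p, P (tcls p).
Proof.
move=> P1 PM Ps p; rewrite -[p]invgK.
elim/descent_ind: {p}(p^-1)%g => [|j w hj dj IH]; first by rewrite invg1 tcls1.
rewrite invMg adjV tclsS //; first by apply: PM => //; exact: Ps.
by rewrite invgK.
Qed.

Lemma pcan_base : pcan x0 = fun=> x0.
Proof.
have vb : valid K bt.
  by split; [exact: bt_in|exact: lexsorted_inj (@bt_lexsorted R n)].
have e : srt x0 = bt by have := srt_sortedE x0 vb (@bt_lexsorted R n); rewrite -x0E.
apply/funext => t; rewrite /pcan /lpath e [RHS]x0E; congr (lab _).
by apply/funext => i; rewrite /seg -!mulrDl subrK !mul1r -surjective_pairing.
Qed.

Lemma based1 f : is_loop x0 f -> cls x0 (based x0 f 1) = cls x0 f.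
Proof.
move=> fl; have [cf f0 f1] := fl.
apply/cls_eqP => //; first exact: based_loop.
rewrite /based f1 pcan_base -f1.
have -> : sub f 0 1 = f by apply/funext => t; rewrite /sub subr0 mul1r add0r.
exact: hpt_cat1.
Qed.

Lemma based0 f : is_loop x0 f -> cls x0 (based x0 f 0) = 1%g.
Proof.
move=> fl; have [cf f0 f1] := fl.
rewrite -cls_cst; congr cls; apply/funext => t.
rewrite /based f0 pcan_base /cat /sub; case: ifP => // _.
by rewrite subrr mul0r addr0.
Qed.

(** The class of [based x0 f t] goes from 1 to the class of f. Near each time it changes by positive
    braids only, and [cousin] adds the changes up. *)
Lemma tcls_gen (P : pi1 R x0 -> Prop) : P 1%g -> (forall a b, P a -> P b -> P (a * b)%g) ->
  (forall a, P a -> P a^-1%g) -> (forall k, (k.+1 < n)%N -> P (s k)) -> forall b, P b.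
Proof.
move=> P1 PM PV Ps b; have [f fl ->] := cls_surj b; have [cf f0 f1] := fl.
have Pt := tcls_mem P1 PM Ps.
pose E t := cls x0 (based x0 f t).
suff : P ((E 0%R)^-1 * E 1%R)%g by rewrite /E based0 // based1 // invg1 mul1g.
apply: (@cousin R (fun a b => P ((E a)^-1 * E b)%g) 0 1 ler01) => [t0|a c d _ h1 h2].
  have : \forall t \near t0, incell (f t0) (f t).
    apply: cf; apply: filterS (cell_near (incell_self x0 (f t0)) ltr01) => y [].
    by [].
  move=> /nbhs_ballP[e /= e0 he]; exists e => // a c /andP[at0 t0c] ae ce.
  have main t : t0 - e < t -> t < t0 + e -> E t = (E t0 * tcls (relpos (f t0) (f t)))%g.
    move=> h1 h2; apply: based_cell => // u /andP[u0 u1]; apply: he.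
    rewrite /ball /= opprD addNKr normrN normrM.
    rewrite (ger0_norm u0); apply: (@le_lt_trans _ _ `|t - t0|).
      by rewrite ler_piMr.
    by rewrite ltr_norml; lra.
  have a1 : a < t0 + e := le_lt_trans at0 (le_lt_trans t0c ce).
  have c1 : t0 - e < c := lt_le_trans ae (le_trans at0 t0c).
  rewrite (main a) // (main c) //.
  rewrite invMg -mulgA mulKg; apply: PM => //; exact: PV.
by have := PM _ _ h1 h2; rewrite mulgA -(mulgA _ (E c)) mulgV mulg1.
Qed.

(** Both members of each relation are [tcls] of one permutation, expanded by [tclsS] along two
    reduced words. *)
Lemma tcls_braid : braid_rel n s.
Proof.
split=> [j k jk hk|j hj] /=.
  have hj : (j.+1 < n)%N by lia.
  rewrite -tclsS ?adjV //; last by rewrite !ap_adjD //; lia.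
  rewrite -tclsS ?adjV //; last by rewrite !ap_adjD //; lia.
  by rewrite (adj_braid n).1.
have hj1 : (j.+1 < n)%N by lia.
have D2 : ap (adj j : 'S_n) j.+2 = j.+2 by rewrite ap_adjD //; lia.
have D0 : ap (adj j.+1 : 'S_n) j = j by rewrite ap_adjD //; lia.
rewrite -[(tcls (adj j) * _)%g]tclsS ?adjV //; last by rewrite ap_adjr // D2.
rewrite -tclsS //; last first.
  by rewrite invMg !adjV !apM D0 ap_adjl // ap_adjl // D2.
rewrite -[(tcls (adj j.+1) * _)%g]tclsS ?adjV //; last by rewrite D0 ap_adjl; lia.
rewrite -tclsS //; last first.
  by rewrite invMg !adjV !apM ap_adjr // D0 D2 ap_adjr.
by rewrite (adj_braid n).2.
Qed.

Section Holonomies.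
Variables (G : groupType) (phi : 'S_n -> G).
Let c (x y : conf n K) : G := phi (relpos x y).
Hypothesis phi1 : phi 1%g = 1%g.
Hypothesis c_cell : forall x y, incell x y -> \forall z \near y, c x z = (c x y * c y z)%g.
Hypothesis cC : cocycle c.

Lemma hol_sorted (a : R -> tup) : lcontinuous a -> lin (valid K) a ->
  (forall t, 0 <= t <= 1 -> lexsorted (a t)) -> hol cC (lpath a) = 1%g.
Proof.
move=> ca va sa; rewrite (@hol_adm _ _ _ _ _ _ (fun=> 1%g)) ?invg1 ?mulg1 //.
  exact: lpath_continuous.
have srtE t : srt (lpath a t) = a (c01 t).
  by rewrite srt_sortedE //; [apply: va|apply: sa]; exact: c01_itv.
move=> t.
have [e e0 he] := refines_open (sa _ (c01_itv t)) (refines_refl (sa _ (c01_itv t))).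
suff H i : \forall u \near t, ball (a (c01 t) i) e (a (c01 u) i).
  have H' : \forall u \near t, forall i, ball (a (c01 t) i) e (a (c01 u) i).
    exact: filter_forall H.
  apply: filterS H' => u hu.
  rewrite mul1g /c (_ : relpos _ _ = 1%g) //; apply: relpos_uniq; rewrite !srtE => k l kl.
  by rewrite !perm1; exact: he.
have cci : continuous (fun u => a (c01 u) i).
  exact: continuous_comp2 (@clip_continuous R 0 1) (ca i).
by apply: cci; exact: nbhsx_ballx.
Qed.

Lemma hol_cell (f : R -> conf n K) : continuous f ->
  (forall t, 0 <= t <= 1 -> incell (f 0) (f t)) -> hol cC f = c (f 0) (f 1).
Proof.
move=> cf h; rewrite (@hol_eq _ _ _ _ cC f (fun t => c (f 0) (f (c01 t)))) //.
  by rewrite !c01_id ?lexx ?ler01 // {1}/c relpos_self phi1 invg1 mul1g.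
have cfc : continuous (fun t => f (c01 t)).
  exact: continuous_comp2 (@clip_continuous R 0 1) cf.
move=> t; exact: cfc _ (c_cell (h _ (c01_itv t))).
Qed.

(** Only the sideways spread contributes. In the first piece the labelling stays sorted, in the
    third the one permuted by p^-1 does, and the second piece lies in the cell of the column. *)
Lemma hol_tau p : hol cC (lpath (tau p)) = phi p.
Proof.
have nT (k l : 'I_n) : (k < l)%N -> ~ True -> (p k < p l)%N by [].
have [r1 r2 r3] := tau_pieces convK discK nT.
have v1 : lin (valid K) (seg bt col) by move=> t ht; exact: reg_valid (r1 _ ht).
have v2 : lin (valid K) (seg col (vp R p)) by move=> t ht; exact: reg_valid (r2 _ ht).
have v3 : lin (valid K) (seg (vp R p) (bp R p)) by move=> t ht; exact: reg_valid (r3 _ ht).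
have c1 : continuous (lpath (seg bt col)) by apply: lpath_continuous => //; exact: seg_lcontinuous.
have c2 : continuous (lpath (seg col (vp R p))) by apply: lpath_continuous => //; exact: seg_lcontinuous.
have c3 : continuous (lpath (seg (vp R p) (bp R p))) by apply: lpath_continuous => //; exact: seg_lcontinuous.
have e23 : lpath (seg col (vp R p)) 1 = lpath (seg (vp R p) (bp R p)) 0.
  by rewrite lpath1 lpath0 seg0 seg1.
have e1 : lpath (seg bt col) 1 = lpath (seg col (vp R p)) 0.
  by rewrite lpath1 lpath0 seg0 seg1.
have c23 := cat_continuous c2 c3 e23.
have e123 : lpath (seg bt col) 1 = cat (lpath (seg col (vp R p))) (lpath (seg (vp R p) (bp R p))) 0.
  by rewrite cat0.
have c123 := cat_continuous c1 c23 e123.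
have ct : continuous (lpath (tau p)) by exact: tau_path.
rewrite (hol_hpt cC ct c123); last first.
  apply: hpt_eq => [|t ht]; first exact: tau_path.
  rewrite /tau lpath_lcat // /cat; case: leP => // h.
  by rewrite lpath_lcat //; lra.
rewrite hol_cat // hol_cat // hol_sorted //; first last.
- move=> t ht k l kl; have b := @beta_lt R n _ _ kl.
  have n1 (k' l' : 'I_n) : (k' < l')%N -> ~ False -> ((1%g : 'S_n) k' < (1%g : 'S_n) l')%N.
    by rewrite !perm1.
  have [h1 _ _] := tau_pieces convK discK n1.
  by have [_ /(_ _ _ kl)[_ h]] := h1 _ ht; exact: h.
- exact: seg_lcontinuous.
have colE : srt (lab col) = col.
  rewrite srt_sortedE //; first by have := v1 1; rewrite seg1 lexx ler01; apply.
  move=> k l /(@beta_lt R n _ _) b; rewrite /lexlt /col /= eqxx /=; apply/orP; right; lra.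
rewrite mul1g hol_cell //; last first.
  move=> t ht; rewrite lpath0 seg0 /lpath; apply: incell_lab; first exact/v2/c01_itv.
  rewrite colE => k l /(@beta_lt R n _ _) b; split; first by rewrite /col /= ltxx.
  by move=> _; rewrite /seg /col /vp /=; have /andP[t0 t1] := c01_itv t; nra.
rewrite lpath0 lpath1 seg0 seg1.
have vv : valid K (vp R p) by have := v2 1; rewrite seg1 lexx ler01; apply.
have rp : relpos (lab col) (lab (vp R p)) = p.
  have svE : srt (lab (vp R p)) = fun i => vp R p (p^-1%g i).
    rewrite -(lab_perm x0 p^-1%g vv) srt_sortedE //; first exact: valid_perm.
    by move=> k l /(@beta_lt R n _ _) b; rewrite /lexlt /vp /= !permKV; apply/orP; left; lra.
  apply: relpos_uniq; rewrite colE svE => k l /(@beta_lt R n _ _) b.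
  by split; rewrite /col /vp /= ?ltxx // !permK; lra.
rewrite {1}/c rp.
have -> : lpath (seg (vp R p) (bp R p)) =
    lpath (fun t i => seg (vp R p) (bp R p) t (p^-1%g i)).
  by apply/funext => t; rewrite /lpath lab_perm //; exact/v3/c01_itv.
rewrite hol_sorted ?mulg1 //.
- by move=> i; exact: seg_lcontinuous.
- by move=> t ht; apply: valid_perm; exact: v3.
- move=> t ht k l kl; have b := @beta_lt R n _ _ kl.
  apply/orP; left; rewrite /seg /vp /bp /= !permKV.
  by apply: convex_lt => //; lra.
Qed.

Lemma Hol_tcls p : Hol cC (tcls p) = phi p.
Proof. by rewrite Hol_cls ?hol_tau //; exact: tau_loop. Qed.

End Holonomies.

(** The universal map to G is the holonomy of the lifted cocycle: on the positive braid of [adj k]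
    it takes the value [pbraid g (adj k)], which is [g k]. *)
Lemma convex_is_braid_group : is_braid_group n s.
Proof.
split; [exact: tcls_gen|exact: tcls_braid|move=> G g gB].
exists (@Hol R _ G _ (crossing_cocycle x0 gB) x0); first exact: HolM.
move=> k hk; rewrite /= Hol_tcls ?pbraid_adj ?pbraid1 //; exact: crossing_cell.
Qed.

(** Identifies the algebraic strand permutation with the geometric one, so that the stabilizer of a
    strand can be recognized on both sides. *)
Lemma convex_bperm (hB : is_braid_group n s) (b : pi1 R x0) :
  bperm hB b = Hol (@relpos_cocycle R n K x0) b.
Proof.
have HM := @HolM R _ _ _ (@relpos_cocycle R n K x0) x0.
elim/(braid_gen hB): b => [|a b ha hb|a ha|k hk].
- by rewrite (morph_one (bpermM hB)) (morph_one HM).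
- by rewrite bpermM HM ha hb.
- by rewrite (morph_inv (bpermM hB)) (morph_inv HM) ha.
- rewrite bpermE // (Hol_tcls (phi := id)) // => x y xy.
  exact: relpos_cocycle_cell.
Qed.

End ConvexBraidGroup.

(** * The punctured plane *)

Section BaseChange.
Variables (R : realType) (T : topologicalType) (x y : T) (q : R -> T).
Hypotheses (cq : continuous q) (q0 : q 0 = x) (q1 : q 1 = y).
Implicit Types f g : R -> T.

Definition conjp f : R -> T := cat q (cat f (flip q)).

Lemma conjp_loop f : is_loop y f -> is_loop x (conjp f).
Proof.
move=> [cf f0 f1]; have cfl := flip_continuous cq.
split; rewrite /conjp ?cat0 ?cat1 ?flip1 //.
by apply: cat_continuous => //; [apply: cat_continuous => //; rewrite f1 flip0|rewrite cat0 f0].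
Qed.

Lemma conjp_hpt f g : is_loop y f -> is_loop y g -> hpt f g -> hpt (conjp f) (conjp g).
Proof.
move=> [cf f0 f1] [cg g0 g1] fg; apply: hpt_cat; [exact: hpt_refl| |by rewrite cat0 f0].
apply: hpt_cat fg _ _; last by rewrite f1 flip0.
exact/hpt_refl/flip_continuous.
Qed.

Lemma hpt_catIr f g (p : R -> T) : continuous p -> continuous f -> continuous g ->
  f 1 = p 0 -> g 1 = p 0 -> hpt (cat f p) (cat g p) -> hpt f g.
Proof.
move=> cp cf cg fp gp e.
have main (k : R -> T) : continuous k -> k 1 = p 0 -> hpt (cat (cat k p) (flip p)) k.
  move=> ck kp; have cfl := flip_continuous cp.
  apply: hpt_trans (hpt_catA ck cp cfl kp (esym (flip0 p))) _.
  apply: (@hpt_trans _ _ _ (cat k (fun=> k 1))); last exact: hpt_cat1.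
  by apply: hpt_cat; [exact: hpt_refl|rewrite kp; exact: hpt_catV|rewrite cat0].
apply: hpt_trans (hpt_sym (main f cf fp)) _.
apply: hpt_trans _ (main g cg gp).
by apply: hpt_cat e _ _; [exact/hpt_refl/flip_continuous|rewrite cat1 flip0].
Qed.

Lemma conjp_inj f g : is_loop y f -> is_loop y g -> hpt (conjp f) (conjp g) -> hpt f g.
Proof.
move=> [cf f0 f1] [cg g0 g1]; have cfl := flip_continuous cq.
have cfq (k : R -> T) : continuous k -> k 1 = y -> continuous (cat k (flip q)).
  by move=> ck k1; apply: cat_continuous => //; rewrite flip0 k1.
move=> /hpt_catI e; apply: (@hpt_catIr _ _ (flip q)) => //; rewrite ?flip0 ?f1 ?g1 //.
by apply: e; rewrite ?cat0 ?f0 ?g0 //; exact: cfq.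
Qed.

Definition unconjp f : R -> T := cat (flip q) (cat f q).

Lemma unconjp_loop f : is_loop x f -> is_loop y (unconjp f).
Proof.
move=> [cf f0 f1]; have cfl := flip_continuous cq.
split; rewrite /unconjp ?cat0 ?cat1 ?flip0 //.
by apply: cat_continuous => //; [apply: cat_continuous => //; rewrite f1 q0|rewrite cat0 f0 flip1].
Qed.

Lemma conjpK f : is_loop x f -> hpt (conjp (unconjp f)) f.
Proof.
move=> fl; have [cf f0 f1] := fl; have cfl := flip_continuous cq.
have cfq : continuous (cat f q) by apply: cat_continuous => //; rewrite f1 q0.
have e1 : flip q 1 = cat f q 0 by rewrite flip1 cat0 f0 q0.
have e2 : f 1 = q 0 by rewrite f1 q0.
have e3 : q 1 = flip q 0 by rewrite flip0.
have e4 : cat f q 1 = flip q 0 by rewrite cat1 flip0.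
have cfqq : continuous (cat (cat f q) (flip q)) by exact: cat_continuous.
have e5 : flip q 1 = cat (cat f q) (flip q) 0 by rewrite !cat0 flip1 f0 q0.
rewrite /conjp /unconjp.
apply: (@hpt_trans _ _ _ (cat q (cat (flip q) (cat (cat f q) (flip q))))).
  apply: hpt_cat; [exact: hpt_refl|exact: hpt_catA|by rewrite !cat0 flip0].
apply: hpt_trans (hpt_sym (hpt_catA cq cfl cfqq e3 e5)) _.
apply: (@hpt_trans _ _ _ (cat (fun=> f 0) f)); last exact: hpt_1cat.
apply: hpt_cat; [by rewrite f0 -q0; exact: hpt_catV| |by rewrite cat1 e5].
apply: hpt_trans (hpt_catA cf cq cfl e2 e3) _.
apply: (@hpt_trans _ _ _ (cat f (fun=> f 1))); last exact: hpt_cat1.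
by apply: hpt_cat; [exact: hpt_refl|rewrite e2; exact: hpt_catV|rewrite cat0].
Qed.

Lemma conjp_cat f g : is_loop y f -> is_loop y g ->
  hpt (conjp (cat f g)) (cat (conjp f) (conjp g)).
Proof.
move=> fl gl; have [cf f0 f1] := fl; have [cg g0 g1] := gl.
have cl := conjp_loop; have cfl := flip_continuous cq.
have [cc _ _] := conjp_loop fl; have [cd _ _] := conjp_loop gl.
have fg := is_loop_cat fl gl.
have cgq : continuous (cat g (flip q)) by apply: cat_continuous => //; rewrite g1 flip0.
have cfq : continuous (cat f (flip q)) by apply: cat_continuous => //; rewrite f1 flip0.
have a1 : q 1 = cat f (flip q) 0 by rewrite cat0 f0.
have a2 : cat f (flip q) 1 = conjp g 0 by rewrite cat1 flip1 /conjp cat0.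
have a3 : f 1 = flip q 0 by rewrite f1 flip0.
have a4 : flip q 1 = conjp g 0 by rewrite flip1 /conjp cat0.
have a5 : f 1 = g 0 by rewrite f1.
have a6 : g 1 = flip q 0 by rewrite g1 flip0.
have a7 : flip q 1 = q 0 by rewrite flip1.
have a8 : q 1 = cat g (flip q) 0 by rewrite cat0 g0.
apply: hpt_sym; apply: hpt_trans (hpt_catA cq cfq cd a1 a2) _.
apply: hpt_cat; [exact: hpt_refl| |by rewrite a1 !cat0].
apply: hpt_trans (hpt_catA cf cfl cd a3 a4) _.
apply: hpt_trans _ (hpt_sym (hpt_catA cf cg cfl a5 a6)).
apply: hpt_cat; [exact: hpt_refl| |by rewrite a3 !cat0].
apply: hpt_trans (hpt_sym (hpt_catA cfl cq cgq a7 a8)) _.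
apply: (@hpt_trans _ _ _ (cat (fun=> g 0) (cat g (flip q)))).
  by apply: hpt_cat; [rewrite g0 -q1; exact: hpt_Vcat|exact: hpt_refl|rewrite cat1 a8].
by have := hpt_1cat cgq; rewrite cat0.
Qed.

End BaseChange.

Section Lifting.
Variables (R : realType) (n : nat) (K : set (R * R)) (x0 : conf n K).
Local Notation srt := (srt x0).
Local Notation lab := (lab x0).
Local Notation relpos := (relpos x0).

(** A section of [relpos] along f is a continuous labelling of the moving points. *)
Lemma adm_lift (U : topologicalType) (f : U -> conf n K) (g : U -> 'S_n) :
  continuous f -> adm relpos f g -> forall i, continuous (fun u => srt (f u) (g u i)).
Proof.
move=> cf fg i u A hA.
have c1 : {for u, continuous (fun v => srt (f v) (relpos (f u) (f v) (g u i)))}.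
  exact: local_lift cf (incell_self x0 (f u)) (g u i).
have h : \forall v \near u, A (srt (f v) (relpos (f u) (f v) (g u i))).
  by apply: c1; rewrite relpos_self perm1.
suff: \forall v \near u, A (srt (f v) (g v i)) by [].
by apply: filterS2 (fg u) h => v -> ; rewrite permM.
Qed.

Lemma lift_valid x (s : 'S_n) : valid K (fun i => srt x (s i)).
Proof. exact/valid_perm/srt_valid. Qed.

Lemma lab_lift x (s : 'S_n) : lab (fun i => srt x (s i)) = x.
Proof. by rewrite lab_perm ?srtK //; exact: srt_valid. Qed.

End Lifting.

Section ZeroStrand.
Variables (R : realType) (n : nat).

Lemma neq0_near (U : topologicalType) (f : U -> R * R) u : continuous f -> f u <> 0 ->
  \forall v \near u, f v <> 0.
Proof.
move=> cf fu; have cn : continuous (fun v => `|f v|) by move=> v; apply: cvg_norm; exact: cf.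
have : \forall v \near u, 0 < `|f v|.
  by apply: (cvgr_gt `|f u|); [exact: cn|rewrite normr_gt0; apply/eqP].
by apply: filterS => v; rewrite normr_gt0 => /eqP.
Qed.

(** Near each time the other points stay away from 0, so the index of the point at 0 is locally
    constant. *)
Lemma zero_strand (z : R -> 'I_n -> R * R) (j : 'I_n) (t : R) :
  (forall i, continuous (fun t => z t i)) -> (forall t, injective (z t)) ->
  (forall t, exists i, z t i = 0) -> 0 <= t -> z 0 j = 0 -> z t j = 0.
Proof.
move=> cz iz ez t0.
apply: (@cousin R (fun a b => z a j = 0 -> z b j = 0) 0 t t0) => [u|a b c _ h1 h2 /h1/h2 //].
have [k zk] := ez u.
have : \forall v \near u, z v k = 0.
  have H l : \forall v \near u, l <> k -> z v l <> 0.
    case: (pselect (l = k)) => [->|lk]; first by near=> v.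
    have : z u l <> 0 by rewrite -zk => /iz.
    by move=> /(neq0_near (cz l)); apply: filterS.
  have H' : \forall v \near u, forall l, l <> k -> z v l <> 0 by exact: filter_forall H.
  apply: filterS H' => v hv; have [l zl] := ez v.
  by case: (pselect (l = k)) => [<- //|/hv].
move=> /nbhs_ballP[e /= e0 he]; exists e => // a b /andP[au ub] ea be za.
have zb v : u - e < v -> v < u + e -> z v k = 0.
  by move=> h1 h2; apply: he; rewrite /ball /= distrC ltr_distl h1.
have jk : j = k by apply: (iz a); rewrite za zb //; lra.
by rewrite jk zb //; lra.
Unshelve. all: by end_near.
Qed.

End ZeroStrand.

Definition cplane (R : realType) : set (R * R) := [set v | v <> 0].
Arguments cplane R : clear implicits.

Section AddOrigin.
Variables (R : realType) (n : nat) (c : conf n (cplane R)) (y0 : conf n.+1 (setT : set (R * R))).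
Local Notation Kc := (cplane R).
Local Notation lab0 := (lab c).
Local Notation lab := (lab y0).

Definition addt (v : 'I_n -> R * R) (i : 'I_n.+1) : R * R :=
  if unlift ord0 i is Some j then v j else 0.

Lemma addt_lift v k : addt v (lift ord0 k) = v k. Proof. by rewrite /addt liftK. Qed.
Lemma addt0 v : addt v ord0 = 0. Proof. by rewrite /addt unlift_none. Qed.

Lemma addt_valid v : valid Kc v -> valid setT (addt v).
Proof.
move=> [v0 vi]; split=> // i j; rewrite /addt.
case: unliftP => [k ->|->]; case: unliftP => [l ->|->] //.
- by move=> /vi ->.
- by move=> e; case: (v0 k).
- by move=> e; case: (v0 l).
Qed.

Definition add (a : conf n Kc) : conf n.+1 (setT : set (R * R)) :=
  lab (addt (oval (repr (a : {eq_quot same_conf_equiv n Kc}%qT)))).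

Lemma lab_addt_perm v w : valid Kc v -> valid Kc w -> lab0 v = lab0 w -> lab (addt v) = lab (addt w).
Proof.
move=> hv hw /(lab_eqP c hv hw)[s es]; apply/lab_eqP; try exact: addt_valid.
exists (lift_perm ord0 ord0 s) => i; rewrite {1}/addt.
by case: unliftP => [k ->|->]; rewrite ?lift_perm_lift ?lift_perm_id ?addt_lift ?addt0.
Qed.

Lemma add_lab v : valid Kc v -> add (lab0 v) = lab (addt v).
Proof.
move=> hv; apply: lab_addt_perm => //; first exact: oval_valid.
by rewrite lab_oval /conf_class reprK.
Qed.

Lemma addt_continuous (U : topologicalType) (v : U -> 'I_n -> R * R) :
  (forall i, continuous (fun u => v u i)) -> forall i, continuous (fun u => addt (v u) i).
Proof.
move=> cv i; rewrite /addt; case: unliftP => [k _|_]; first exact: cv.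
by move=> u; exact: cvg_cst.
Qed.

Lemma add_continuous : continuous add.
Proof.
apply: (@repr_comp_continuous _ _ _ (fun a => lab (addt (oval a)))).
  apply: lab_continuous => [i|a]; last exact/addt_valid/oval_valid.
  by apply: (addt_continuous (v := fun a => oval a)); exact: oval_continuous.
move=> a b /eqP ab; apply/eqP/lab_addt_perm; try exact: oval_valid.
by rewrite !lab_oval.
Qed.

(** The permutation relating the two extended tuples fixes the index of the origin, hence restricts
    to the other indices. *)
Lemma add_inj : injective add.
Proof.
move=> a b; have [v hv ->] := lab_surj c a; have [w hw ->] := lab_surj c b.
rewrite !add_lab // => /(lab_eqP y0 (addt_valid hv) (addt_valid hw))[s es].
have s0 : s ord0 = ord0.
  by have := es ord0; rewrite addt0 -(addt0 v) => /(addt_valid hv).2.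
apply/lab_eqP => //.
have nz k : {l | s (lift ord0 k) = lift ord0 l}.
  case: (unliftP ord0 (s (lift ord0 k))) => [l ->|]; first by exists l.
  by rewrite -{2}s0 => /perm_inj/eqP; rewrite eq_sym (negPf (neq_lift _ _)).
have qi : injective (fun k => sval (nz k)).
  move=> k l e; apply: (@lift_inj _ ord0); apply: (@perm_inj _ s).
  by rewrite (svalP (nz k)) (svalP (nz l)) e.
by exists (perm qi) => k; rewrite permE /=; case: (nz k) => l /= e; rewrite -(addt_lift w) es e addt_lift.
Qed.

(** Strand j is translated to the origin and deleted: an inverse of [add] up to translation, see
    [add_rem]. *)
Definition rem (j : 'I_n.+1) (u : 'I_n.+1 -> R * R) (k : 'I_n) : R * R := u (lift j k) - u j.

Lemma rem_valid j u : injective u -> valid Kc (rem j u).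
Proof.
move=> ui; split=> [k|k l /addIr/ui/lift_inj //].
by move=> /eqP; rewrite subr_eq0 => /eqP/ui/eqP; rewrite eq_sym (negPf (neq_lift _ _)).
Qed.

Lemma add_rem j u : injective u -> add (lab0 (rem j u)) = lab (fun i => u i - u j).
Proof.
move=> ui; rewrite add_lab; last exact: rem_valid.
have hu : valid setT (fun i => u i - u j) by split=> // i k /addIr/ui.
rewrite -(lab_perm y0 (lift_perm ord0 j 1) hu); congr (lab _); apply/funext => i.
rewrite /addt; case: unliftP => [k ->|->]; rewrite ?lift_perm_lift ?lift_perm_id ?subrr //.
by rewrite perm1.
Qed.

Lemma add_zero a : exists i, srt y0 (add a) i = 0.
Proof.
have [v hv ->] := lab_surj c a; rewrite add_lab //.
have [s es] := srt_lab y0 (addt_valid hv).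
by exists (s ord0); rewrite -es addt0.
Qed.

End AddOrigin.

Section Puncture.
Variables (R : realType) (n : nat) (c : conf n (cplane R)) (y0 : conf n.+1 (setT : set (R * R))).
Local Notation Kc := (cplane R).
Local Notation KT := (setT : set (R * R)).
Local Notation lab0 := (lab c).
Local Notation lab := (lab y0).
Local Notation srt := (srt y0).
Local Notation add := (add y0).
Local Notation relpos := (relpos y0).
Local Notation c01 := (clip (0 : R) 1).
Local Notation bt := (@bt R n.+1).
Hypothesis y0E : y0 = lab bt.
Local Notation Hol0 := (Hol (@relpos_cocycle R n.+1 KT y0)).
Local Notation hol0 := (hol (@relpos_cocycle R n.+1 KT y0)).

Lemma convT p q t : KT p -> KT q -> 0 <= t <= 1 -> KT (sg p q t). Proof. by []. Qed.
Lemma discT p : disc R p -> KT p. Proof. by []. Qed.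

Definition yc : conf n.+1 KT := add c.
(** Moves the base point to that of the plane. Since c is arbitrary, the origin may have any rank j
    in [yc]. *)
Definition qc : R -> conf n.+1 KT := flip (pcan y0 yc).

Lemma qc_continuous : continuous qc.
Proof. exact/flip_continuous/(pcan_continuous convT discT). Qed.
Lemma qc0 : qc 0 = y0. Proof. by rewrite /qc flip0 (pcan1 y0E). Qed.
Lemma qc1 : qc 1 = yc. Proof. by rewrite /qc flip1 pcan0. Qed.

Lemma hol_pcan : hol0 (pcan y0 yc) = 1%g.
Proof.
have h := pcan_in y0 convT discT yc.
apply: (hol_sorted (phi := id)) => //.
- exact: seg_lcontinuous.
- by move=> t ht; apply: reg_valid (h t ht).
- by move=> t ht k l kl; have [_ /(_ _ _ kl)[_]] := h t ht; apply.
Qed.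

(** The connecting path keeps all lexicographic ranks, so its own holonomy is trivial. *)
Lemma hol_conjp f : is_loop yc f -> hol0 (conjp qc f) = hol0 f.
Proof.
move=> [cf f0 f1]; have cq := qc_continuous; have cfl := flip_continuous cq.
have e1 : f 1 = flip qc 0 by rewrite f1 flip0 qc1.
have cfq := cat_continuous cf cfl e1.
have e2 : qc 1 = cat f (flip qc) 0 by rewrite cat0 f0 qc1.
have h1 : hol0 (flip qc) = 1%g by rewrite /qc flipK hol_pcan.
have h2 : hol0 qc = 1%g.
  have e3 : qc 1 = flip qc 0 by rewrite flip0.
  have e := @hol_cat R _ _ _ (@relpos_cocycle R n.+1 KT y0) _ _ cq cfl e3.
  rewrite h1 mulg1 in e; rewrite -e.
  have cc := cat_continuous cq cfl e3.
  have ccst : continuous (fun _ : R => qc 0) by move=> t; exact: cvg_cst.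
  rewrite (hol_hpt _ cc ccst (hpt_catV cq)).
  rewrite (@hol_adm _ _ _ _ _ _ (fun=> 1%g)) ?invg1 ?mulg1 //.
  exact: (@adm_cst _ _ _ (@relpos_cocycle R n.+1 KT y0) R (qc 0)).
by rewrite /conjp !hol_cat // h1 h2 mul1g mulg1.
Qed.

Lemma add_loop (f : R -> conf n Kc) : is_loop c f -> is_loop yc (add \o f).
Proof. exact: is_loop_map (@add_continuous R n c y0). Qed.

Definition theta (a : pi1 R c) : pi1 R y0 := cls y0 (conjp qc (add \o fun_of (repr a))).

Lemma conj_add_loop (f : R -> conf n Kc) : is_loop c f -> is_loop y0 (conjp qc (add \o f)).
Proof. by move=> /add_loop; apply: conjp_loop; [exact: qc_continuous|exact: qc0|exact: qc1]. Qed.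

Lemma theta_cls (f : R -> conf n Kc) : is_loop c f -> theta (cls c f) = cls y0 (conjp qc (add \o f)).
Proof.
move=> fl; have gl := fun_of_loop (repr (cls c f)).
apply/cls_eqP; try exact: conj_add_loop.
apply: (conjp_hpt qc_continuous qc1); try exact: add_loop.
by apply: (hpt_map (@add_continuous R n c y0)); apply/(cls_eqP gl fl); rewrite cls_fun_of pi1_reprK.
Qed.

Lemma thetaM : {morph theta : a b / (a * b)%g}.
Proof.
move=> a b; have [f fl ->] := cls_surj a; have [g gl ->] := cls_surj b.
have fgl := is_loop_cat fl gl.
rewrite -cls_cat // !theta_cls // -cls_cat; try exact: conj_add_loop.
have -> : add \o cat f g = cat (add \o f) (add \o g).
  by apply/funext => t; rewrite /= /cat; case: ifP.
apply/cls_eqP.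
- apply: (conjp_loop qc_continuous qc0 qc1); apply: is_loop_cat; exact: add_loop.
- by apply: is_loop_cat; exact: conj_add_loop.
- by apply: (conjp_cat qc_continuous qc0 qc1); exact: add_loop.
Qed.

Lemma Hol_theta (f : R -> conf n Kc) : is_loop c f -> Hol0 (theta (cls c f)) = hol0 (add \o f).
Proof.
move=> fl; rewrite theta_cls // Hol_cls; last exact: conj_add_loop.
by rewrite hol_conjp //; exact: add_loop.
Qed.

Lemma norm_lift (f : R -> conf n.+1 KT) : continuous f ->
  exists g, [/\ adm relpos (fun t => f (c01 t)) g, g 0 = 1%g & hol0 f = g 1].
Proof.
move=> cf; have [g hg] := adm_ex1 (@relpos_cocycle R n.+1 KT y0) cf.
exists (fun t => (g 0)^-1 * g t)%g; split; [exact: adm_mul|by rewrite mulVg|].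
by rewrite (hol_eq _ cf hg).
Qed.

Section Strands.
Variable j : 'I_n.+1.
Hypothesis j0 : srt yc j = 0.

Lemma lift_strand (f : R -> conf n.+1 KT) g t : continuous f -> adm relpos f g ->
  (forall t, exists a : conf n Kc, f t = add a) ->
  0 <= t -> srt (f 0) (g 0 j) = 0 -> srt (f t) (g t j) = 0.
Proof.
move=> cf fg fa t0; apply: (@zero_strand R n.+1 (fun t i => srt (f t) (g t i))) => //.
- exact: adm_lift.
- by move=> s; case: (lift_valid y0 (f s) (g s)).
- move=> s; have [a ->] := fa s; have [i hi] := add_zero c y0 a.
  by exists ((g s)^-1%g i); rewrite permKV.
Qed.

Lemma theta_fix a : Hol0 (theta a) j = j.
Proof.
have [f fl ->] := cls_surj a; rewrite Hol_theta //; have [cF F0 F1] := add_loop fl.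
have [g [hg g0 ->]] := norm_lift cF.
have cc : continuous (fun t => (add \o f) (c01 t)).
  exact: continuous_comp2 (@clip_continuous R 0 1) cF.
have := lift_strand (t := 1) cc hg _ ler01; rewrite !c01_id ?lexx ?ler01 // F0 F1 g0 perm1.
move=> h; apply: (srt_valid y0 yc).2; rewrite j0; apply: h => // t.
by exists (f (c01 t)).
Qed.

Lemma sub_zero (z : 'I_n.+1 -> R * R) a : injective z -> z j = 0 -> lab z = add a ->
  lab0 (rem j z) = a.
Proof.
move=> iz zj za; apply: (@add_inj _ _ c y0); rewrite add_rem // -za; congr (lab _).
by apply/funext => i; rewrite zj subr0.
Qed.

Lemma rem_continuous (U : topologicalType) (z : U -> 'I_n.+1 -> R * R) :
  (forall i, continuous (fun u => z u i)) -> (forall u, injective (z u)) ->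
  continuous (fun u => lab0 (rem j (z u))).
Proof.
move=> cz iz; apply: lab_continuous => [k u|u]; last exact: rem_valid.
by apply: cvgB; exact: cz.
Qed.

(** A homotopy in the plane is labelled continuously by [z]. On the four sides of the square strand
    j stays at the origin, so subtracting strand j everywhere and deleting it gives a homotopy in
    the punctured plane with the right boundary. *)
Lemma theta_inj : injective theta.
Proof.
move=> a b; have [f fl ->] := cls_surj a; have [g gl ->] := cls_surj b.
rewrite !theta_cls // => /cls_eqP e.
have {e} := conjp_inj qc_continuous qc1 (add_loop fl) (add_loop gl) (e (conj_add_loop fl) (conj_add_loop gl)).
have [cf f0 f1] := fl; have [cg g0 g1] := gl.
move=> [H cH [h0 h1 h2 h3]].
have [k hk] := @adm_ex2 R _ _ _ (@relpos_cocycle R n.+1 KT y0) H 0 1 0 1 ler01 ler01 cH.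
pose F (u : R * R) := H (c01 u.1, c01 u.2).
pose k' u := ((k (0, 0)%R)^-1 * k u)%g.
have {}hk : adm relpos F k' by exact: adm_mul hk.
have k0 : k' (0, 0) = 1%g by rewrite /k' mulVg.
have cF : continuous F.
  apply: continuous_comp2 cH; apply: continuous_pair; apply: continuous_comp2 (@clip_continuous R 0 1).
    exact: continuous_fst2.
  exact: continuous_snd2.
pose z u i := srt (F u) (k' u i).
have cz : forall i, continuous (fun u => z u i) by exact: adm_lift.
have iz u : injective (z u) by case: (lift_valid y0 (F u) (k' u)).
have lz u : lab (z u) = F u by exact: lab_lift.
have hc (s : R) : continuous (fun t : R => (t, s)).
  by apply: continuous_pair => t; [exact: cvg_id|exact: cvg_cst].
have hr (s : R) : continuous (fun t : R => (s, t)).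
  by apply: continuous_pair => t; [exact: cvg_cst|exact: cvg_id].
have c0 : c01 0 = 0 by rewrite c01_id ?lexx ?ler01.
have c1 : c01 1 = 1 by rewrite c01_id ?lexx ?ler01.
have B0 t : F (t, 0) = add (f (c01 t)) by rewrite /F /= c0 h0 //; exact: c01_itv.
have B1 t : F (t, 1) = add (g (c01 t)) by rewrite /F /= c1 h1 //; exact: c01_itv.
have L0 t : F (0, t) = add c by rewrite /F /= c0 h2 ?c01_itv //= f0.
have L1 t : F (1, t) = add c by rewrite /F /= c1 h3 ?c01_itv //= f1.
(* The bottom and left sides start from the corner (0, 0), where [k'] is normalized to 1; the other
   two sides start from their far ends. *)
have Z0 t : 0 <= t -> z (t, 0) j = 0.
  move=> t0; apply: (lift_strand (continuous_comp2 (hc 0) cF) (adm_comp (hc 0) hk)) => //= [s|].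
    by exists (f (c01 s)).
  by rewrite k0 perm1 L0.
have W0 t : 0 <= t -> z (0, t) j = 0.
  move=> t0; apply: (lift_strand (continuous_comp2 (hr 0) cF) (adm_comp (hr 0) hk)) => //= [s|].
    by exists c.
  by rewrite k0 perm1 L0.
have Z1 t : 0 <= t -> z (t, 1) j = 0.
  move=> t0; apply: (lift_strand (continuous_comp2 (hc 1) cF) (adm_comp (hc 1) hk)) => //= [s|].
    by exists (g (c01 s)).
  exact: W0.
have W1 t : 0 <= t -> z (1, t) j = 0.
  move=> t0; apply: (lift_strand (continuous_comp2 (hr 1) cF) (adm_comp (hr 1) hk)) => //= [s|].
    by exists c.
  exact: Z0.
apply/cls_eqP => //; exists (fun u => lab0 (rem j (z u))); first exact: rem_continuous.
split=> t ht; have /andP[t0 t1] := ht; apply: sub_zero => //.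
- exact: Z0.
- by rewrite lz B0 c01_id.
- exact: Z1.
- by rewrite lz B1 c01_id.
- exact: W0.
- by rewrite lz L0 f0.
- exact: W1.
- by rewrite lz L1 f1.
Qed.

(** If strand j closes up, subtracting a growing multiple of its position from all points deforms
    the loop until that strand rests at the origin. The ends do not move, because strand j is at 0
    there. *)
Lemma theta_surj b : Hol0 b j = j -> exists a, theta a = b.
Proof.
have [h hl ->] := cls_surj b; rewrite Hol_cls //.
have q0 := qc0; have q1 := qc1; have cq := qc_continuous.
pose f := unconjp qc h; have fl : is_loop yc f by exact: (unconjp_loop cq q0 q1 hl).
have fh := conjpK cq q0 hl; rewrite -/f in fh.
have cl := conjp_loop cq q0 q1 fl.
have [[cc _ _] [ch _ _]] := (cl, hl).
rewrite -(hol_hpt _ cc ch fh) hol_conjp //; have [cf f0 f1] := fl.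
have [g [hg g0 ->]] := norm_lift cf => gj.
have cF : continuous (fun t => f (c01 t)).
  exact: continuous_comp2 (@clip_continuous R 0 1) cf.
pose z t i := srt (f (c01 t)) (g t i).
have cz : forall i, continuous (fun u => z u i) by exact: adm_lift.
have iz u : injective (z u) by case: (lift_valid y0 (f (c01 u)) (g u)).
have lz u : lab (z u) = f (c01 u) by exact: lab_lift.
have z0 : z 0 j = 0 by rewrite /z c01_id ?lexx ?ler01 // f0 g0 perm1.
have z1 : z 1 j = 0 by rewrite /z c01_id ?lexx ?ler01 // f1 gj.
pose f' t := lab0 (rem j (z t)).
have fl' : is_loop c f'.
  split; first exact: rem_continuous.
    by apply: sub_zero => //; rewrite lz c01_id ?lexx ?ler01 ?f0 ?f1.
  by apply: sub_zero => //; rewrite lz c01_id ?lexx ?ler01 ?f0 ?f1.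
exists (cls c f'); rewrite theta_cls //; apply/cls_eqP => //; first exact: conj_add_loop.
apply: hpt_trans fh; apply: (conjp_hpt cq q1) => //; first exact: add_loop.
apply: hpt_sym.
have itvE (t : R) : 0 <= t <= 1 -> f t = f (c01 t) by move=> ht; rewrite c01_id.
have sub0E t : lab (fun i => z t i - 0) = f (c01 t).
  by rewrite -lz; congr (lab _); apply/funext => i; rewrite subr0.
exists (fun u => lab (fun i => z u.1 i - u.2 *: z u.1 j)).
  apply: lab_continuous => [i u|u]; last by split=> // i k /addIr/iz.
  have czi i' : continuous (fun u : R * R => z u.1 i') by exact: continuous_comp2 (@continuous_fst2 R) (cz i').
  by apply: cvgB; [exact: czi|apply: cvgZ; [exact: continuous_snd2|exact: czi]].
split=> t ht /=.
- by rewrite scale0r sub0E -itvE ?lexx ?ler01.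
- by rewrite scale1r -(add_rem c y0 j).
- by rewrite z0 scaler0 sub0E -itvE ?lexx ?ler01.
- by rewrite z1 scaler0 sub0E -itvE ?lexx ?ler01.
Qed.

End Strands.
End Puncture.

Lemma inj_surj_bij (A B : Type) (f : A -> B) :
  injective f -> (forall b, exists a, f a = b) -> bijective f.
Proof.
move=> fi fs; exists (fun b => sval (cid (fs b))) => [a|b]; last exact: svalP (cid (fs b)).
by apply: fi; exact: svalP (cid (fs (f a))).
Qed.

Section PlaneConf.
Variables (R : realType) (n : nat) (K : set (R * R)).
Hypothesis convK : forall p q t, K p -> K q -> 0 <= t <= 1 -> K (sg p q t).
Hypothesis discK : forall p, disc R p -> K p.

Lemma bt_valid : valid K (@bt R n).
Proof. by split; [exact: bt_in|exact: lexsorted_inj (@bt_lexsorted R n)]. Qed.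

Lemma base_ex : exists x : conf n K, x = lab x (@bt R n).
Proof. by exists (conf_class (conf_of bt_valid)); rewrite (labE _ bt_valid). Qed.

End PlaneConf.

Lemma braid_group_ex (R : realType) n :
  exists (B : groupType) (s : nat -> B), is_braid_group n s.
Proof.
have [x xE] := @base_ex R n setT (@discT R).
by exists (pi1 R x), (fun k => tcls x (adj k)); exact: convex_is_braid_group.
Qed.

Lemma artin_faithfulT (R : realType) n (B : groupType) (s : nat -> B)
  (hB : is_braid_group n s) : artin_faithful hB.
Proof. exact: (@artin_faithful_all (braid_group_ex R) n B s hB). Qed.

Section PuncturedPlane.
Variables (R : realType) (n : nat) (c : conf n (cplane R)).
Variables (B : groupType) (s : nat -> B).
Hypothesis hB : is_braid_group n s.
Local Open Scope group_scope.

(** Conjugation by [coset_rep] at j carries the stabilizer of strand j, the image of [theta], onto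
    the stabilizer of strand 0, the image of [mixed]; as both maps are injective, each loop has a
    unique pair of coordinates. *)
Lemma punctured_plane_iso : exists f : pi1 R c -> semidirect (artin_gaction hB),
  {morph f : x y / x * y} /\ bijective f.
Proof.
have [y0 y0E] := @base_ex R n.+1 setT (@discT R).
pose hB' := convex_is_braid_group (@convT R) (@discT R) y0E.
have [j j0] := add_zero c y0 c.
pose r : pi1 R y0 := coset_rep (fun k => tcls y0 (adj k)) j.
pose conj (b : pi1 R y0) := r * b * r^-1.
have conjM : {morph conj : x y / x * y} by move=> x y; rewrite /conj !mulgA mulgVK.
have conjI : injective conj by move=> x y /mulIg/mulgI.
have pr : ap (bperm hB' r) 0 = j by apply: perm_coset_rep; rewrite -ltnS.
have conj_mixed b : is_mixed hB hB' (conj b) <-> bperm hB' b j = j.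
  rewrite is_mixedP /conj !bpermM (morph_inv (bpermM hB')) !apM pr apE.
  split=> [|->]; last by rewrite -pr apK.
  move=> /(congr1 (ap (bperm hB' r))); rewrite apKV pr => e.
  exact: val_inj.
have ex (a : pi1 R c) : exists p : free_group 'I_n * B, conj (theta y0 a) = mixed hB hB' p.1 p.2.
  have [v [b e]] : is_mixed hB hB' (conj (theta y0 a)).
    by apply/conj_mixed; rewrite (convex_bperm (@convT R) (@discT R) y0E) (theta_fix y0E j0).
  by exists (v, b).
pose f a : semidirect (artin_gaction hB) := sval (cid (ex a)).
have fE a : mixed hB hB' (f a).1 (f a).2 = conj (theta y0 a).
  by rewrite /f; case: cid.
have faithful := @artin_faithfulT R n B s hB.
have fU a v b : conj (theta y0 a) = mixed hB hB' v b -> f a = (v, b).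
  by rewrite -fE => /(mixed_inj faithful)[]; case: (f a) => v' b' /= -> ->.
exists f; split.
  by move=> x y; apply: fU; rewrite thetaM // conjM -!fE mixedM.
apply: inj_surj_bij => [x y e|[v b]].
  by apply: (theta_inj y0E j0); apply: conjI; rewrite -!fE e.
have [a ha] : exists a : pi1 R c, theta y0 a = r^-1 * mixed hB hB' v b * r.
  apply: (theta_surj y0E j0); rewrite -(convex_bperm (@convT R) (@discT R) y0E hB').
  by apply/conj_mixed; exists v, b; rewrite /conj !mulgA mulgV mul1g mulgK.
by exists a; apply: fU; rewrite ha /conj !mulgA mulgV mul1g mulgK.
Qed.

End PuncturedPlane.

(** * The twice punctured sphere *)

Section Pi1Homeo.
Variables (R : realType) (X Y : topologicalType) (F : X -> Y) (F' : Y -> X).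
Hypotheses (cF : continuous F) (cF' : continuous F').
Hypotheses (FK : cancel F F') (FK' : cancel F' F).

Lemma pi1_homeo (x : X) : exists f : pi1 R x -> pi1 R (F x),
  {morph f : a b / (a * b)%g} /\ bijective f.
Proof.
pose p (a : pi1 R x) : pi1 R (F x) := cls (F x) (F \o fun_of (repr a)).
have pE f : is_loop x f -> p (cls x f) = cls (F x) (F \o f).
  move=> fl; have gl := fun_of_loop (repr (cls x f)).
  apply/cls_eqP; try exact: is_loop_map.
  by apply: hpt_map => //; apply/(cls_eqP gl fl); rewrite cls_fun_of pi1_reprK.
exists p; split=> [a b|].
  have [f fl ->] := cls_surj a; have [g gl ->] := cls_surj b.
  rewrite -cls_cat // !pE //; last exact: is_loop_cat.
  rewrite -cls_cat; try exact: is_loop_map.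
  by congr cls; apply/funext => t; rewrite /= /cat; case: ifP.
apply: (@inj_surj_bij _ _ p) => [a b|b].
  have [f fl ->] := cls_surj a; have [g gl ->] := cls_surj b.
  rewrite !pE // => /cls_eqP e; apply/cls_eqP => //.
  have := hpt_map cF' (e (is_loop_map cF fl) (is_loop_map cF gl)).
  have K (k : R -> X) : F' \o (F \o k) = k by apply/funext => t; rewrite /= FK.
  by rewrite !K.
have [g gl ->] := cls_surj b; have [cg g0 g1] := gl.
have fl : is_loop x (F' \o g) by have := is_loop_map cF' gl; rewrite FK.
exists (cls x (F' \o g)); rewrite pE //; congr cls.
by apply/funext => t; rewrite /= FK'.
Qed.

End Pi1Homeo.

Section ConfMap.
Variables (n : nat) (M N : topologicalType) (h : M -> N).
Hypotheses (ch : continuous h) (ih : injective h).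

Definition omap_fun (y : ordered_conf n M) : {ptws 'I_n -> N} := fun i => h (conf_fun y i).

Lemma omap_inj y : injective (omap_fun y).
Proof. by move=> i j /ih; exact: (set_valP y). Qed.

Definition omap (y : ordered_conf n M) : ordered_conf n N := SigSub (mem_set (@omap_inj y)).

Lemma omap_same y z : same_conf y z -> same_conf (omap y) (omap z).
Proof. by move=> [s hs]; exists s => i; have := congr1 h (hs i). Qed.

Definition cmap (a : conf n M) : conf n N :=
  conf_class (omap (repr (a : {eq_quot same_conf_equiv n M}%qT))).

Lemma cmap_class y : cmap (conf_class y) = conf_class (omap y).
Proof.
by apply/conf_classP/omap_same/conf_class_eqP; rewrite {1}/conf_class reprK.
Qed.

Lemma cmap_continuous : continuous cmap.
Proof.
apply: (@repr_comp_continuous _ _ _ (fun y => conf_class (omap y))); last first.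
  by move=> a b /eqP ab; apply/eqP/conf_classP/omap_same/conf_class_eqP.
move=> y; apply: continuous_comp; last exact: conf_class_continuous.
move: y; apply: continuous_ordered_conf => i.
apply: (continuous_comp2 _ ch (f := fun y : ordered_conf n M => conf_fun y i)) => y.
apply: (@continuous_comp _ _ _ (@conf_fun n M) (fun f : {ptws 'I_n -> M} => f i)).
  exact: initial_continuous.
exact: (@proj_continuous 'I_n (fun _ => M) i).
Qed.

Lemma conf_surj (a : conf n M) : exists y, a = conf_class y.
Proof.
exists (repr (a : {eq_quot same_conf_equiv n M}%qT)).
by rewrite /conf_class reprK.
Qed.

End ConfMap.

Lemma cmapK n (M N : topologicalType) (h : M -> N) (h' : N -> M)
    (ih : injective h) (ih' : injective h') :
  cancel h h' -> cancel (@cmap n M N h ih) (@cmap n N M h' ih').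
Proof.
move=> hK a; have [y ->] := conf_surj a; rewrite !cmap_class.
by apply: conf_classP; exists 1%g => i; rewrite perm1; exact/esym/hK.
Qed.

Lemma conf_homeo (R : realType) n (M N : topologicalType) (h : M -> N) (h' : N -> M) :
  continuous h -> continuous h' -> cancel h h' -> cancel h' h -> forall c : conf n M,
  exists (d : conf n N) (f : pi1 R c -> pi1 R d), {morph f : a b / (a * b)%g} /\ bijective f.
Proof.
move=> ch ch' hK hK' c; have ih := can_inj hK; have ih' := can_inj hK'.
have [f hf] := @pi1_homeo R _ _ (cmap ih) (cmap ih')
  (@cmap_continuous _ _ _ h ch ih) (@cmap_continuous _ _ _ h' ch' ih') (cmapK _ _ hK) (cmapK _ _ hK') c.
by exists (cmap ih c), f.
Qed.

(** * The twice punctured sphere as a punctured plane *)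

Section Stereographic.
Variable R : realType.
Local Notation R3 := (R * R * R)%type.
Implicit Types (p w : R3) (q : R * R).

Definition north : R3 := (0, 0, 1).
Definition stereo p : R * R := (p.1.1 / (1 - p.2), p.1.2 / (1 - p.2)).
Definition istereo q : R3 :=
  let s := q.1 ^+ 2 + q.2 ^+ 2 in (2 * q.1 / (s + 1), 2 * q.2 / (s + 1), (s - 1) / (s + 1)).

Lemma istereo_den q : q.1 ^+ 2 + q.2 ^+ 2 + 1 != 0.
Proof. by apply/eqP => e; have := sqr_ge0 q.1; have := sqr_ge0 q.2; lra. Qed.

Lemma stereo_den p : sphere R p -> p <> north -> 1 - p.2 != 0.
Proof.
case: p => [[x y] z]; rewrite /sphere /= => e ne; apply/eqP => z1; apply: ne.
have -> : z = 1 by lra.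
have {}e : x ^+ 2 + y ^+ 2 = 0 by nra.
have x0 : x = 0 by apply/eqP; rewrite -sqrf_eq0; apply/eqP; have := sqr_ge0 x; have := sqr_ge0 y; lra.
have y0 : y = 0 by apply/eqP; rewrite -sqrf_eq0; apply/eqP; have := sqr_ge0 x; have := sqr_ge0 y; lra.
by rewrite x0 y0.
Qed.

Lemma istereoK : cancel istereo stereo.
Proof.
move=> [x y]; have := istereo_den (x, y); rewrite /stereo /istereo /= => d.
have d2 : 1 - (x ^+ 2 + y ^+ 2 - 1) / (x ^+ 2 + y ^+ 2 + 1) = 2 / (x ^+ 2 + y ^+ 2 + 1) by field.
by rewrite d2; congr (_, _); field.
Qed.

Lemma stereoK p : sphere R p -> p <> north -> istereo (stereo p) = p.
Proof.
move=> sp ne; have := stereo_den sp ne; case: p sp {ne} => [[x y] z].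
rewrite /sphere /stereo /istereo /= => e d.
have s1 : (x / (1 - z)) ^+ 2 + (y / (1 - z)) ^+ 2 = (1 + z) / (1 - z).
  have -> : (x / (1 - z)) ^+ 2 + (y / (1 - z)) ^+ 2 = (x ^+ 2 + y ^+ 2) / (1 - z) ^+ 2 by field.
  have -> : x ^+ 2 + y ^+ 2 = (1 + z) * (1 - z) by lra.
  by field.
rewrite s1.
have -> : (1 + z) / (1 - z) + 1 = 2 / (1 - z) by field.
have -> : (1 + z) / (1 - z) - 1 = 2 * z / (1 - z) by field.
by congr (_, _, _); field.
Qed.

Lemma istereo_sphere q : sphere R (istereo q).
Proof.
have := istereo_den q; case: q => x y; rewrite /sphere /istereo /= => d.
by field.
Qed.

Lemma istereo_north q : istereo q <> north.
Proof.
have := istereo_den q; case: q => x y /= d [_ _] /(congr1 ( *%R^~ (x ^+ 2 + y ^+ 2 + 1))).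
by rewrite divfK // mul1r; lra.
Qed.

Definition dot p w : R := p.1.1 * w.1.1 + p.1.2 * w.1.2 + p.2 * w.2.

(* The Householder reflection exchanging x and the north pole; for x = north the
   division by 0 makes it the identity. *)
Section Reflection.
Variable x : R3.
Hypothesis sx : sphere R x.
Definition mirror : R3 := (x.1.1, x.1.2, x.2 - 1).
Definition reflect_coef p : R := dot p mirror / (1 - x.2).
Definition reflect p : R3 :=
  let k := reflect_coef p in
  (p.1.1 - k * mirror.1.1, p.1.2 - k * mirror.1.2, p.2 - k * mirror.2).

(** A form free of division that remains true for x = north, where [mirror] vanishes. *)
Lemma reflect_coefE p : reflect_coef p * (1 - x.2) = dot p mirror.
Proof.
case: (pselect (x = north)) => [xN|/(stereo_den sx) d]; last by rewrite divfK.
by rewrite /dot /mirror xN /= subrr !mulr0 !addr0.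
Qed.

Lemma mirror2 : dot mirror mirror = 2 * (1 - x.2).
Proof. by move: sx; rewrite /sphere /dot /= => e; lra. Qed.

Lemma reflectK : involutive reflect.
Proof.
move=> p; have E := reflect_coefE p.
have e : reflect_coef (reflect p) = - reflect_coef p.
  rewrite {1}/reflect_coef.
  have -> : dot (reflect p) mirror = dot p mirror - reflect_coef p * dot mirror mirror.
    by rewrite /dot /reflect /=; ring.
  rewrite mirror2 -E {2}/reflect_coef.
  have -> : reflect_coef p * (1 - x.2) - reflect_coef p * (2 * (1 - x.2)) =
    - (reflect_coef p * (1 - x.2)) by ring.
  by rewrite E mulNr.
rewrite {1}/reflect e; case: p {E e} => [[a b] d] /=.
by congr (_, _, _); ring.
Qed.

Lemma reflect_sphere p : sphere R p -> sphere R (reflect p).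
Proof.
have E := reflect_coefE p; have M := mirror2.
rewrite /sphere /= => e.
transitivity (dot p p - 2 * reflect_coef p * dot p mirror +
    reflect_coef p ^+ 2 * dot mirror mirror).
  by rewrite /dot /=; ring.
have -> : dot p p = 1 by rewrite -e /dot; ring.
by rewrite M -E; ring.
Qed.

Lemma reflect_pole : reflect x = north.
Proof.
case: (pselect (x = north)) => [xN|/(stereo_den sx) d].
  by rewrite /reflect /mirror xN /= !subrr !mulr0 !subr0.
have k1 : reflect_coef x = 1.
  apply: (mulIf d); rewrite reflect_coefE mul1r; move: sx; rewrite /sphere /dot /mirror /= => e; lra.
by rewrite /reflect k1 /mirror /=; congr (_, _, _); ring.
Qed.

End Reflection.
End Stereographic.

Section StereographicContinuity.
Variables (R : realType) (U : topologicalType).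
Local Notation R3 := (R * R * R)%type.

Lemma continuous_cD (f g : U -> R) : continuous f -> continuous g -> continuous (fun u => f u + g u).
Proof. by move=> cf cg u; apply: cvgD; [exact: cf|exact: cg]. Qed.
Lemma continuous_cS (f g : U -> R) : continuous f -> continuous g -> continuous (fun u => f u - g u).
Proof. by move=> cf cg u; apply: cvgB; [exact: cf|exact: cg]. Qed.
Lemma continuous_cM (f g : U -> R) : continuous f -> continuous g -> continuous (fun u => f u * g u).
Proof. by move=> cf cg u; apply: cvgM; [exact: cf|exact: cg]. Qed.
Lemma continuous_cV (f : U -> R) : continuous f -> (forall u, f u != 0) -> continuous (fun u => (f u)^-1).
Proof. by move=> cf f0 u; apply: cvgV; [exact: f0|exact: cf]. Qed.

Lemma continuous_coord (V W : topologicalType) (f : U -> V * W) : continuous f ->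
  continuous (fun u => (f u).1) /\ continuous (fun u => (f u).2).
Proof.
by move=> cf; split=> u; apply: continuous_comp; try exact: cf; [exact: cvg_fst|exact: cvg_snd].
Qed.

Lemma continuous_shift (a : R * R) (f : U -> R * R) : continuous f -> continuous (fun u => f u + a).
Proof. by move=> cf u; apply: cvgD; [exact: cf|exact: cvg_cst]. Qed.

Lemma reflect_continuous (x : R3) (f : U -> R3) :
  continuous f -> continuous (fun u => reflect x (f u)).
Proof.
move=> cf; have [c12 c3] := continuous_coord cf; have [c1 c2] := continuous_coord c12.
have cd : continuous (fun u => reflect_coef x (f u)).
  apply: continuous_cM; last exact: continuous_cst.
  apply: continuous_cD; last by apply: continuous_cM => //; exact: continuous_cst.
  by apply: continuous_cD; apply: continuous_cM => //; exact: continuous_cst.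
have cc (a : R) (g : U -> R) : continuous g -> continuous (fun u => g u - reflect_coef x (f u) * a).
  by move=> cg; apply: continuous_cS => //; apply: continuous_cM => //; exact: continuous_cst.
by apply: continuous_pair; [apply: continuous_pair|]; exact: cc.
Qed.

Lemma stereo_continuous (f : U -> R3) : continuous f -> (forall u, sphere R (f u)) ->
  (forall u, f u <> north R) -> continuous (fun u => stereo (f u)).
Proof.
move=> cf fs fn; have [c12 c3] := continuous_coord cf; have [c1 c2] := continuous_coord c12.
have cv : continuous (fun u => (1 - (f u).2)^-1).
  by apply: continuous_cV => [|u]; [exact: continuous_cB|exact: stereo_den].
by apply: continuous_pair; exact: continuous_cM.
Qed.

Lemma istereo_continuous (f : U -> R * R) : continuous f -> continuous (fun u => istereo (f u)).
Proof.
move=> cf; have [c1 c2] := continuous_coord cf.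
have cs : continuous (fun u => (f u).1 ^+ 2 + (f u).2 ^+ 2).
  by apply: continuous_cD; exact: continuous_cM.
have cv : continuous (fun u => ((f u).1 ^+ 2 + (f u).2 ^+ 2 + 1)^-1).
  by apply: continuous_cV => [|u]; [exact: continuous_Dc|exact: istereo_den].
apply: continuous_pair; last by apply: continuous_cM => //; exact: continuous_Dc.
by apply: continuous_pair; apply: continuous_cM => //; exact: continuous_affine1.
Qed.

End StereographicContinuity.

Section SphereHomeo.
Variables (R : realType) (x1 x2 : R * R * R).
Hypotheses (s1 : sphere R x1) (s2 : sphere R x2) (ne : x1 <> x2).
Local Notation S := (twice_punctured_sphere x1 x2).
Local Notation rho := (reflect x2).

(** The reflection sends x2 to the pole, so projection sends it to infinity; x1 lands on [a], which
    a translation brings to the origin. *)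
Let a := stereo (rho x1).
Let rhoI : injective rho := inv_inj (reflectK s2).

Let to_plane p := stereo (rho p) - a.
Let of_plane q := rho (istereo (q + a)).

Lemma reflect_north p : p <> x2 -> rho p <> north R.
Proof. by rewrite -(reflect_pole s2) => h /rhoI. Qed.

Lemma rho_x1 : istereo a = rho x1.
Proof. by apply: stereoK; [exact: reflect_sphere|exact: reflect_north]. Qed.

Lemma to_plane_in p : S p -> cplane R (to_plane p).
Proof.
move=> [sp np] /subr0_eq e; apply: (np); left; apply: rhoI; rewrite -rho_x1 -e stereoK //.
  exact: reflect_sphere.
by apply: reflect_north => px; apply: np; right.
Qed.

Lemma of_plane_in q : cplane R q -> S (of_plane q).
Proof.
move=> q0; split; first by apply: reflect_sphere => //; exact: istereo_sphere.
case=> [/(congr1 rho)|/(congr1 rho)]; rewrite (reflectK s2).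
  rewrite -rho_x1 => /(can_inj (@istereoK R)) e; apply: q0.
  by apply: (addIr a); rewrite add0r.
by rewrite (reflect_pole s2) => /istereo_north.
Qed.

Lemma to_planeK p : S p -> of_plane (to_plane p) = p.
Proof.
move=> [sp np]; rewrite /of_plane /to_plane subrK stereoK ?(reflectK s2) //.
  exact: reflect_sphere.
by apply: reflect_north => px; apply: np; right.
Qed.

Lemma of_planeK q : to_plane (of_plane q) = q.
Proof. by rewrite /to_plane /of_plane (reflectK s2) istereoK addrK. Qed.

Lemma sphere_homeo : exists (h : S -> cplane R) (h' : cplane R -> S),
  [/\ continuous h, continuous h', cancel h h' & cancel h' h].
Proof.
exists (fun p => SigSub (mem_set (to_plane_in (set_valP p)))).
exists (fun q => SigSub (mem_set (of_plane_in (set_valP q)))).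
have cv : continuous (fun p : S => set_val p) by exact: initial_continuous.
have cw : continuous (fun q : cplane R => set_val q) by exact: initial_continuous.
split.
- apply: continuous_comp_initial.
  apply: continuous_shift; apply: stereo_continuous; first exact: reflect_continuous.
    by move=> p; apply: reflect_sphere => //; case: (set_valP p).
  by move=> p; apply: reflect_north => px; have [_] := set_valP p; apply; right; exact: px.
- apply: continuous_comp_initial.
  by apply: reflect_continuous; apply: istereo_continuous; exact: continuous_shift.
- by move=> p; apply: val_inj; exact: to_planeK (set_valP p).
- by move=> q; apply: val_inj; exact: of_planeK.
Qed.

End SphereHomeo.

(** * Half twists in the disc *)

Section Disc.
Variables (R : realType) (m : nat).
Local Notation bt := (@bt R m).

Lemma disc_convex (p q : R * R) t : disc R p -> disc R q -> 0 <= t <= 1 -> disc R (sg p q t).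
Proof.
case: p => a b; case: q => c d; rewrite /disc /sg /= => h1 h2 /andP[t0 t1].
have : 0 <= t * (1 - t) * ((a - c) ^+ 2 + (b - d) ^+ 2).
  by apply: mulr_ge0; [apply: mulr_ge0; rewrite ?subr_ge0|apply: addr_ge0; exact: sqr_ge0].
move=> h3; have h4 := ler_wpM2l t0 h2; have h5 : (1 - t) * (a ^+ 2 + b ^+ 2) <= (1 - t) * 1.
  by apply: ler_wpM2l; rewrite ?subr_ge0.
lra.
Qed.

Lemma disc_disc (p : R * R) : disc R p -> disc R p. Proof. by []. Qed.

Definition dbase : conf m (disc R) := conf_class (base_conf R m).

Lemma dbaseE : dbase = lab dbase bt.
Proof.
rewrite (labE _ (bt_valid m (@disc_disc))); apply: conf_classP; exists 1%g => i.
by apply: val_inj; rewrite /= perm1.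
Qed.

Section HalfTwist.
Variable k : 'I_m.-1.
Let tw (t : R) (i : 'I_m) : R * R := twist_pos m k t i.
Let C (i j : 'I_m) : Prop := i = k :> nat /\ j = k.+1 :> nat.

Lemma twist_valid t : valid (disc R) (tw t).
Proof.
split=> [i|i j e]; first exact: twist_pos_disc (twist_index k) (ltn_ord i).
by apply: val_inj; exact: (twist_pos_inj (twist_index k) e).
Qed.

(** [C] holds for the one pair that turns, whose difference vector has direction pi * t. The
    abscissae of these two points stay between those of the base points k and k.+1, so all other
    pairs keep their order. *)
Lemma twist_reg : lin (reg (disc R) C) tw.
Proof.
move=> t /andP[t0 t1]; have [hd hi] := twist_valid t; split=> // i j ij.
have km := twist_index k.
have m0 : 0 < m%:R :> R by rewrite ltr0n; lia.
pose a : R := m%:R^-1; have a0 : 0 < a by rewrite invr_gt0.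
split=> [[ik jk]|nC].
  have s0 : 0 <= sin (pi * t).
    apply: sin_ge0_pi; rewrite mulr_ge0 ?pi_ge0 //=.
    by rewrite -[leRHS]mulr1 ler_wpM2l ?pi_ge0.
  have e2 : (tw t i).2 = - (sin (pi * t) * a) by rewrite /tw /twist_pos ik eqxx.
  have e3 : (tw t j).2 = sin (pi * t) * a by rewrite /tw /twist_pos jk gtn_eqF ?eqxx.
  have sa : 0 <= sin (pi * t) * a by rewrite mulr_ge0 // ltW.
  rewrite /up e2 e3; case: (ltP 0 (sin (pi * t) * a)) => h; first by left; lra.
  have z : sin (pi * t) * a = 0 by apply/eqP; rewrite eq_le h.
  right; split=> [|e1]; first by rewrite z oppr0.
  have e : tw t i = tw t j.
    by rewrite (surjective_pairing (tw t i)) (surjective_pairing (tw t j)) e1 e2 e3 z oppr0.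
  by move: ij; rewrite (hi _ _ e) ltnn.
have far (l : 'I_m) : (l < k)%N || (k.+1 < l)%N -> (tw t l).1 = (2 * l%:R + 1) * a - 1.
  move=> hl; have lk : (l == k :> nat) = false by apply/eqP; lia.
  have lk1 : (l == k.+1 :> nat) = false by apply/eqP; lia.
  by rewrite /tw /twist_pos lk lk1 /base_point /= natrD natrM.
have lo (l : 'I_m) : (l < k)%N -> (tw t l).1 = (2 * l%:R + 1) * a - 1.
  by move=> lk; rewrite far ?lk.
have hi' (l : 'I_m) : (k.+1 < l)%N -> (tw t l).1 = (2 * l%:R + 1) * a - 1.
  by move=> lk; rewrite far ?lk ?orbT.
have c1 := cos_le1 (pi * t); have c2 := cos_geN1 (pi * t).
have mi (l : 'I_m) : (k <= l <= k.+1)%N ->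
    (2 * k%:R + 1) * a - 1 <= (tw t l).1 <= (2 * k%:R + 3) * a - 1.
  move=> hl; have [lk|lk] : l = k :> nat \/ l = k.+1 :> nat by lia.
    rewrite /tw /twist_pos lk eqxx /= /twist_center natrD natrM -/a.
    by apply/andP; split; nra.
  rewrite /tw /twist_pos lk gtn_eqF // eqxx /= /twist_center natrD natrM -/a.
  by apply/andP; split; nra.
have nat_lt (u v : nat) : (u < v)%N -> u%:R + 1 <= v%:R :> R by move=> uv; rewrite natr1 ler_nat.
rewrite /lexlt; apply/orP; left.
have [ik|ik] := ltnP i k; have [jk|jk] := ltnP j k; try (by exfalso; lia).
- by rewrite !lo //; have := nat_lt _ _ ij; nra.
- rewrite lo //; have [jk1|jk1] := ltnP k.+1 j; first by rewrite hi' //; have := nat_lt _ _ ij; nra.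
  have /mi/andP[h _] : (k <= j <= k.+1)%N by lia.
  by apply: lt_le_trans h; have := nat_lt _ _ ik; nra.
- have [ik1|ik1] := ltnP k.+1 i.
    by rewrite !hi' //; [have := nat_lt _ _ ij; nra|lia].
  have jk1 : (k.+1 < j)%N.
    by rewrite ltnNge; apply/negP => jk1; apply: nC; split; lia.
  have /mi/andP[_ h] : (k <= i <= k.+1)%N by lia.
  rewrite (hi' j) //; apply: le_lt_trans h _; have := nat_lt _ _ jk1; rewrite -natr1; nra.
Qed.

(** The half twist and [tau (adj k)] have the same labelled ends and both stay in the region of
    [twist_reg], so [star_hpt] contracts one to the other. *)
Lemma half_twistE : pi1_class (half_twist R k) = tcls dbase (adj k).
Proof.
have km := twist_index k; have km' := ltnW km.
have vC : (forall i j : 'I_m, (i < j)%N -> ~ C i j -> ((adj k : 'S_m) i < (adj k : 'S_m) j)%N).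
  move=> i j ij nC; rewrite (@adjE m k (Ordinal km') (Ordinal km)) //.
  case: tpermP => [iE|iE|ni1 ni2]; case: tpermP => [jE|jE|nj1 nj2] /=.
  all: try (move: ij nC; rewrite /C ?iE ?jE /= => ij nC; lia).
have tl := tau_loop (@disc_convex) (@disc_disc) dbaseE (adj k).
have tc : lcontinuous tw.
  by move=> i; exact: twist_pos_continuous.
have e0 : tw 0 = @tau R m (adj k) 0.
  by rewrite tau0; apply/funext => i; exact: twist_pos0.
have e1 : tw 1 = @tau R m (adj k) 1.
  rewrite tau1; apply/funext => i.
  by rewrite /bp (@adjE m k (Ordinal km') (Ordinal km)) //; exact: twist_pos1.
rewrite -cls_fun_of; apply/cls_eqP => //; first exact: fun_of_loop.
apply: (@hpt_trans _ _ _ (lpath dbase tw)); last first.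
  apply: (@star_hpt R m (disc R) dbase (reg (disc R) C) (@ctr R m)) => //.
  - exact: reg_valid.
  - by move=> v t; exact: (reg_star (@disc_convex) (@disc_disc)).
  - exact: tau_continuous.
  - exact: twist_reg.
  - exact: (tau_in (@disc_convex) (@disc_disc) vC).
apply: hpt_eq => [|t ht]; first by case: (fun_of_loop (half_twist R k)).
have -> : fun_of (half_twist R k) t = conf_class (twist_conf k (ival (clamp t))) by [].
rewrite clampK // /lpath c01_id //.
rewrite (labE _ (twist_valid t)); apply: conf_classP; exists 1%g => i.
by apply: val_inj; rewrite /= perm1.
Qed.

End HalfTwist.
End Disc.

Theorem proposition10 (R : realType) (m : nat) (x1 x2 : R * R * R)
    (c : conf m (twice_punctured_sphere x1 x2)) :
  (2 <= m)%N -> sphere R x1 -> sphere R x2 -> x1 <> x2 ->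
  (forall b : disc_braid_group R m,
     b \in gen_subgroup [set sigma R m i | i in [set i | (3 <= i <= m.+1)%N]]) /\
  exists phi : gaction (disc_braid_group R m) (free_group 'I_m),
    [/\ forall i j : nat, (3 <= i <= m.+1)%N -> (3 <= j <= m.+2)%N ->
          phi (sigma R m i) (A2 m j) =
            if j == i then A2 m j.+1
            else if j == i.+1 then
              ((A2 m j)^-1 * A2 m j.-1 * A2 m j)%g
            else A2 m j,
        forall b b' : disc_braid_group R m, phi b =1 phi b' -> b = b',
        group_iso (braid_group R c) (semidirect phi) &
        exists psi : gaction (subgrp (Gamma2 (disc_braid_group R m)))
                             (subgrp (Ker_augmentation 'I_m)),
          (forall q n, val (psi q n) = phi (val q) (val n)) /\
          group_iso (subgrp (Gamma2 (braid_group R c))) (semidirect psi)].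
Proof.
move=> _ s1 s2 ne.
(* The statement numbers both families of generators from 3, [s] and [xg] number them from 0. *)
pose s (k : nat) : disc_braid_group R m := tcls (dbase R m) (adj k).
have hB : is_braid_group m s.
  exact: (convex_is_braid_group (@disc_convex R) (@disc_disc R) (dbaseE R m)).
have sigmaE i : (3 <= i <= m.+1)%N -> sigma R m i = s (i - 3)%N.
  move=> hi; rewrite /sigma; case: insubP => [k _ ki|]; last by lia.
  by rewrite half_twistE /s ki.
have AE j : A2 m j = xg (j - 3)%N by [].
have [h [h' [ch ch' hK hK']]] := sphere_homeo s1 s2 ne.
have [d [p [pM pb]]] := conf_homeo R ch ch' hK hK' c.
have [f [fM fb]] := punctured_plane_iso d hB.
pose g (a : braid_group R c) : semidirect (artin_gaction hB) := f (p a).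
have gM : {morph g : a b / (a * b)%g} by move=> a b; rewrite /g pM fM.
have gb : bijective g by exact: bij_comp.
split=> [b|].
  have gen := gen_subgroup_group_closed [set sigma R m i | i in [set i | (3 <= i <= m.+1)%N]].
  elim/(braid_gen hB): b => [|x y hx hy|x hx|k hk].
  - exact: gen.1.
  - exact: group_closedM gen _ _ hx hy.
  - exact: group_closedV gen _ hx.
  - apply: sub_gen_subgroup; exists (k + 3)%N; first by rewrite /=; lia.
    by rewrite sigmaE ?addnK //; lia.
exists (artin_gaction hB); split.
- move=> i j hi hj; rewrite sigmaE // !AE /=.
  have hk : ((i - 3).+1 < m)%N by lia.
  rewrite act_gen //; case: (j =P i) => [->|ji].
    by rewrite art_funl //; congr xg; lia.
  case: (j =P i.+1) => [->|ji1].
    have -> : (i.+1 - 3 = (i - 3).+1)%N by lia.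
    by rewrite art_funr.
  by rewrite art_funD //; lia.
- move=> b b' e; apply/(mulIg b'^-1%g); rewrite mulgV.
  apply: (@artin_faithfulT R m _ s hB) => v.
  have := e (artin_gaction hB b'^-1%g v); rewrite /= -!bactM mulgV => ->.
  exact: bact1.
- exact: iso_semidirect gM gb.
- exists (gamma_gaction hB); split=> //.
  exact: iso_Gamma2 gM gb.
Qed.
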